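(* For every fixed integer $r\ge 1$ and every real $\varepsilon>0$, there exists $n_0=n_0(r,\varepsilon)$ such that, for every natural number $n\ge n_0$, writing $N=\binom{n}{2}$, the following statements hold. (i) If $r\le 5$, then $\rho_{r,4}(K_n)=r^N$. (ii) If $6\le r\le 24$, then $$\left(\binom r5-\varepsilon\right)5^N\le \rho_{r,4}(K_n)\le \left(\binom r5+\varepsilon\right)5^N.$$ (iii) If $r\ge 25$, then $$\frac12\binom{n}{\lfloor n/2\rfloor}\left(1-\frac1r\right)^{n-1} r^{\lfloor n^2/4\rfloor}\le \rho_{r,4}(K_n)\le r^{(1/4+\varepsilon)n^2}.$$
   Context: Write $[r]=\{1,\dots,r\}$. An $r$-coloring of a graph $G$ is any function $\varphi:E(G)\to[r]$ (not necessarily a proper edge-coloring, and not necessarily using all colors). An $r$-coloring of $G$ is rainbow-$K_k$-free if every copy of $K_k$ in $G$ has at least two edges of the same color. $\rho_{r,k}(G)$ denotes the number of rainbow-$K_k$-free $r$-colorings of $G$. $K_n$ is the complete graph on $n$ labeled vertices. *)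

(* Defs.v *)
From mathcomp Require Import all_boot.

Set Implicit Arguments.
Unset Strict Implicit.
Unset Printing Implicit Defensive.

Record sgraph := SGraph {
  vertex : finType;
  adj : rel vertex;
  adj_sym : symmetric adj;
  adj_irrefl : irreflexive adj
}.

Definition edges (G : sgraph) : {set {set vertex G}} :=
  [set e : {set vertex G} |
    [exists x, [exists y, adj x y && (e == [set x; y])]]].

Definition edge (G : sgraph) := {e : {set vertex G} | e \in edges G}.

Definition coloring (r : nat) (G : sgraph) := {ffun edge G -> 'I_r}.

(* The vertex sets of the copies of K_k in G. The edges of the copy on such a
   set S are exactly the edges of G contained in S. *)
Definition kclique (k : nat) (G : sgraph) (S : {set vertex G}) : bool :=
  (#|S| == k) && [forall x in S, [forall y in S, (x != y) ==> adj x y]].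

Definition rainbow_free (r k : nat) (G : sgraph) (phi : coloring r G) : bool :=
  [forall S : {set vertex G}, kclique k S ==>
    [exists e1 : edge G, [exists e2 : edge G,
      [&& e1 != e2, val e1 \subset S, val e2 \subset S & phi e1 == phi e2]]]].

Definition rho (r k : nat) (G : sgraph) : nat :=
  #|[set phi : coloring r G | rainbow_free k phi]|.

Definition neq_op (T : eqType) : rel T := fun x y => x != y.

Lemma neq_op_sym (T : eqType) : symmetric (@neq_op T).
Proof. by move=> x y; rewrite /neq_op eq_sym. Qed.

Lemma neq_op_irrefl (T : eqType) : irreflexive (@neq_op T).
Proof. by move=> x; rewrite /neq_op eqxx. Qed.

Definition complete_graph (n : nat) : sgraph :=
  SGraph (@neq_op_sym 'I_n) (@neq_op_irrefl 'I_n).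

(* Main.v *)
Require Import Defs.
From mathcomp Require Import all_boot all_order all_algebra.
From mathcomp Require Import reals exp.
From mathcomp Require Import ring lra zify.

(** With at most five colors no copy of K_4 is rainbow. The lower bounds come from the
    colorings with exactly five colors ([card_exactly_five]) and from balanced
    bipartitions with a single color inside the parts ([bipartite_lower]).

    The upper bounds compare a family F of rainbow-K_4-free colorings with a template,
    a list of colors for every edge. Let the energy of F be the sum over all pairs and
    colors of the squared frequency of the color at the pair. Call a color popular at an
    edge if its frequency in F is not tiny. If the popular colors allow a rainbow
    selection on many copies of K_4, then, as no coloring of F realizes any of them, the
    colors of the edges in these copies are correlated, and fixing all colors at two
    suitable vertices increases the energy of a typical class by a constant times n^2
    ([energy_step]). The energy is at most n^2 and fixing two stars costs a factor
    exponential in n only; so, up to such factors, every family is bounded by the product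
    of the sizes of its lists, where the lists have few rainbow selections
    ([regular_template]).

    A template without rainbow selections has a product of list sizes of at most about
    max (5, sqrt r) ^ 'C(n, 2): lists with at least 6 colors can only form a bipartite
    pattern ([total_weight_le]). Sampling carries this over to templates with few rainbow
    selections ([sampled_weight]). For r >= 25 this is the upper bound
    ([rfree_upper_bound]). For r <= 24 there is room to conclude that a template of nearly
    maximal weight has one and the same list of five colors on almost all edges, so that
    colorings far from every set of five colors are exponentially rare ([far_bound]).

    It remains to see that few colorings are close to a set C of five colors without being
    colored by C. Such a coloring contains a vertex or a pair of vertices whose edges are
    more restricted than by five colors each ([off_edge_structure]), so that removing it
    gains an exponential factor ([near_bound]). Relative to 5 ^ 'C(n, 2), the number of
    colorings then satisfies a recursion with vanishing feedback, which gives the sharp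
    constant 'C(r, 5) ([five_color_upper]). *)

Set Implicit Arguments.
Unset Strict Implicit.
Unset Printing Implicit Defensive.

Import Order.TTheory GRing.Theory Num.Theory.
Local Open Scope ring_scope.

Local Notation expR := sequences.expR.

(** * Colors of vertex pairs *)

Section Colors.
Variables q n : nat.
Local Notation color := 'I_q.+1.
Local Notation Kn := (complete_graph n).
Implicit Types (phi psi : coloring q.+1 Kn) (u v : 'I_n).

Lemma mem_edges (e : {set 'I_n}) : (e \in edges Kn) = (#|e| == 2).
Proof.
rewrite inE; apply/existsP/cards2P => [[x /existsP[y /andP[xy /eqP ->]]]|].
  by exists x, y.
by move=> [x [y [xy ->]]]; exists x; apply/existsP; exists y; rewrite eqxx andbT.
Qed.

Lemma card_edge : #|{: edge Kn}| = 'C(n, 2).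
Proof.
rewrite card_sig -[in RHS](card_ord n) -card_draws -[LHS]/#|_|.
by apply: eq_card => e; rewrite [LHS]mem_edges inE.
Qed.

Definition col phi u v : color :=
  if insub [set u; v] is Some e then phi e else ord0.

Lemma colC phi u v : col phi u v = col phi v u.
Proof. by rewrite /col setUC. Qed.

Lemma coluu phi u : col phi u u = ord0.
Proof. by rewrite /col insubF // [LHS]mem_edges setUid cards1. Qed.

Lemma edgeP (u v : 'I_n) : u != v -> [set u; v] \in edges Kn.
Proof. by move=> uv; rewrite mem_edges cards2 uv. Qed.

Lemma colE phi u v (uv : [set u; v] \in edges Kn) :
  col phi u v = phi (exist (fun e => e \in edges Kn) [set u; v] uv).
Proof.
rewrite /col; case: insubP => [e _ ee|]; last by rewrite uv.
by congr (phi _); apply: val_inj.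
Qed.

Lemma edge_ends (e : edge Kn) : exists u, exists v, u != v /\ val e = [set u; v].
Proof.
have := valP e; rewrite [_ \in _]mem_edges => /cards2P[u [v [uv ee]]].
by exists u, v.
Qed.

Lemma edge_col (e : edge Kn) :
  exists u, exists v, u != v /\ forall phi, phi e = col phi u v.
Proof.
have [u [v [uv ee]]] := edge_ends e; exists u, v; split=> // phi.
by rewrite (colE phi (edgeP uv)); congr (phi _); apply: val_inj.
Qed.

Lemma col_inj phi psi :
  (forall u v, u != v -> col phi u v = col psi u v) -> phi = psi.
Proof.
move=> H; apply/ffunP => e; have [u [v [uv E]]] := edge_col e.
by rewrite !E H.
Qed.

(** Opposite edges sit symmetrically in this list: first and last, second and fifth,
    third and fourth. *)
Definition k4edges (x y u v : 'I_n) : seq ('I_n * 'I_n) :=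
  [:: (x, y); (x, u); (x, v); (y, u); (y, v); (u, v)].

Lemma k4edges_neq (x y u v : 'I_n) : uniq [:: x; y; u; v] ->
  all (fun p : 'I_n * 'I_n => p.1 != p.2) (k4edges x y u v).
Proof.
rewrite /= !inE !negb_or -!andbA.
by case/and5P=> -> -> -> -> /and3P[-> -> _].
Qed.

Definition pcol phi (p : 'I_n * 'I_n) := col phi p.1 p.2.

Definition k4colors phi x y u v := [seq pcol phi p | p <- k4edges x y u v].

Lemma uniq_k4sets (x y u v : 'I_n) : uniq [:: x; y; u; v] ->
  uniq [seq [set p.1; p.2] | p <- k4edges x y u v].
Proof.
rewrite /= !inE !negb_or -!andbA.
case/and5P=> xy xu xv yu /and3P[yv uv _].
have ne (a b c d : 'I_n) : (a != c) && (a != d) || (b != c) && (b != d) ->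
    [set a; b] != [set c; d].
  move=> H; apply: contraTneq H => E.
  have := set21 a b; have := set22 a b; rewrite E !inE.
  by case/orP => /eqP->; case/orP => /eqP->; rewrite ?eqxx ?andbF.
have [yx ux vx] : [/\ y != x, u != x & v != x] by rewrite ![_ == x]eq_sym.
have [uy vy vu] : [/\ u != y, v != y & v != u].
  by rewrite ![_ == y]eq_sym [v == u]eq_sym.
by rewrite !ne ?xy ?xu ?xv ?yu ?yv ?uv ?yx ?ux ?vx ?uy ?vy ?vu ?orbT.
Qed.

Lemma uniq_map_inj (T1 T2 : eqType) (f : T1 -> T2) (s : seq T1) :
  uniq [seq f i | i <- s] -> {in s &, injective f}.
Proof.
elim: s => //= a s IH /andP[fa us] x y.
rewrite !inE => /predU1P[->|xs] /predU1P[->|ys] //.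
- by move=> E; rewrite E map_f in fa.
- by move=> E; rewrite -E map_f in fa.
- exact: IH.
Qed.

(** Listing the vertices of a copy of K_4 turns a repeated color into a failure of
    [uniq]; the colors are read off through [col], which needs no membership proof. *)
Lemma rainbow_freeP phi :
  reflect (forall x y u v, uniq [:: x; y; u; v] -> ~~ uniq (k4colors phi x y u v))
          (rainbow_free 4 phi).
Proof.
have K4 (x y u v : 'I_n) : uniq [:: x; y; u; v] ->
    exists es : seq (edge Kn), [/\ uniq es,
      forall e, (e \in es) = (val e \subset [set z in [:: x; y; u; v]])
      & k4colors phi x y u v = [seq phi e | e <- es]].
  move=> U; have := uniq_k4sets U.
  have ed p : p \in k4edges x y u v -> [set p.1; p.2] \in edges Kn.
    by move=> pk; apply: edgeP; apply: (allP (k4edges_neq U)).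
  pose es := pmap (insub : {set 'I_n} -> option (edge Kn))
    [seq [set p.1; p.2] | p <- k4edges x y u v].
  have vs : [seq val e | e <- es] = [seq [set p.1; p.2] | p <- k4edges x y u v].
    rewrite /es (@pmap_filter _ _ (insub : {set 'I_n} -> option (edge Kn)) val).
      by apply/all_filterP/allP => _ /mapP[p pk ->]; rewrite insubT ?ed.
    exact: insubK.
  move=> US; exists es; split.
  - by move: US; rewrite -vs; apply: map_uniq.
  - move=> e; rewrite -(mem_map val_inj) vs.
    apply/idP/idP.
      case/mapP=> p pk ->; rewrite subUset !sub1set !inE.
      move: pk; rewrite /k4edges !(in_cons, in_nil) orbF.
      by do 6?[case/orP] => /eqP-> /=; rewrite !eqxx ?orbT.
    have [a [b [ab ->]]] := edge_ends e.
    move=> /subsetP S4.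
    have Ha := S4 a (set21 a b); rewrite !inE in Ha.
    have Hb := S4 b (set22 a b); rewrite !inE in Hb.
    have M c d : ((c, d) \in k4edges x y u v) || ((d, c) \in k4edges x y u v) ->
        [set c; d] \in [seq [set p.1; p.2] | p <- k4edges x y u v].
      by case/orP => H; [|rewrite setUC]; apply: (map_f (fun p => [set p.1; p.2]) H).
    apply: M; rewrite /k4edges !in_cons.
    by case/or4P: Ha ab => /eqP->; case/or4P: Hb => /eqP->; rewrite !eqxx ?orbT.
  - have -> : [seq phi e | e <- es] =
       [seq (if insub s is Some e then phi e else ord0) | s <- [seq val e | e <- es]].
      by rewrite -map_comp; apply: eq_map => e /=; rewrite valK.
    by rewrite vs -map_comp.
apply: (iffP forallP) => [H x y u v U|H S].
  have [es [ue mes ->]] := K4 x y u v U.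
  have KS : @kclique 4 Kn [set z in [:: x; y; u; v]].
    rewrite /kclique cardsE (card_uniqP U) eqxx /=.
    by apply/forall_inP => a _; apply/forall_inP => b _; apply/implyP.
  have /implyP/(_ KS) := H [set z in [:: x; y; u; v]].
  case/existsP=> e1 /existsP[e2 /and4P[e12 s1 s2 /eqP E]].
  apply/negP => /uniq_map_inj I; case/eqP: e12.
  by apply: I => //; rewrite mes.
apply/implyP => /andP[/eqP S4 _].
have [x [y [u [v [U SE]]]]] : exists x, exists y, exists u, exists v,
   uniq [:: x; y; u; v] /\ S = [set z in [:: x; y; u; v]].
  have := enum_uniq S; have := cardE S; rewrite S4.
  have SE : S =i enum S by move=> z; rewrite mem_enum.
  case: (enum S) SE => [|x [|y [|u [|v [|]]]]] // SE _ U.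
  by exists x, y, u, v; split=> //; apply/setP => z; rewrite [RHS]inE; apply: SE.
have [es [ue mes kE]] := K4 x y u v U.
have := H _ _ _ _ U; rewrite kE => NU.
case: existsP => // NE; case/negP: NU; rewrite map_inj_in_uniq // => e1 e2.
rewrite !mes -SE => s1 s2 E; apply/eqP; apply: contra_notT NE => e12.
by exists e1; apply/existsP; exists e2; rewrite e12 s1 s2 E eqxx.
Qed.

Definition rfree : {set coloring q.+1 Kn} := [set phi | rainbow_free 4 phi].

Lemma rfree_k4 phi x y u v : phi \in rfree -> uniq [:: x; y; u; v] ->
  ~~ uniq (k4colors phi x y u v).
Proof. by rewrite inE => /rainbow_freeP; apply. Qed.

End Colors.

(** * Restriction, sums over edges, and maps with few exceptions *)

Section Pairs.
Variables q m n : nat.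

(** Restriction to the image of f; the default color is unreachable when f is
    injective, as f then maps edges to edges. *)
Definition pullback (f : 'I_m -> 'I_n) (phi : coloring q.+1 (complete_graph n)) :
  coloring q.+1 (complete_graph m) :=
  [ffun e : edge (complete_graph m) =>
    if insub (f @: val e) is Some e' then phi e' else ord0].

Lemma col_pullback f phi u v : injective f ->
  col (pullback f phi) u v = col phi (f u) (f v).
Proof.
move=> fI; have [->|uv] := eqVneq u v; first by rewrite !coluu.
by rewrite (colE _ (edgeP uv)) ffunE /= imsetU !imset_set1.
Qed.

Lemma pullback_rfree f phi : injective f ->
  phi \in rfree q n -> pullback f phi \in rfree q m.
Proof.
move=> fI pf; rewrite inE; apply/rainbow_freeP => x y u v U.
rewrite /k4colors /= /pcol /= !col_pullback //.
by apply: (rfree_k4 pf (x := f x)); rewrite -[X in uniq X]/(map f [:: x; y; u; v]) map_inj_uniq.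
Qed.

End Pairs.

Section OrderedPairs.
Variable n : nat.

(** One representative for each edge, so that a sum over edges is half of a double
    sum over vertices. *)
Definition ipair := {p : 'I_n * 'I_n | (p.1 < p.2)%N}.

Lemma col_inj_lt q (phi psi : coloring q.+1 (complete_graph n)) :
  (forall p : ipair, pcol phi (val p) = pcol psi (val p)) -> phi = psi.
Proof.
move=> H; apply: col_inj => u v; rewrite -(inj_eq val_inj) neq_ltn => /orP[uv|uv].
  exact: (H (exist (fun p : 'I_n * 'I_n => (p.1 < p.2)%N) (u, v) uv)).
by rewrite !(colC _ u); exact: (H (exist (fun p : 'I_n * 'I_n => (p.1 < p.2)%N) (v, u) uv)).
Qed.

Lemma sum_ipair (V : nmodType) (h : 'I_n -> 'I_n -> V) :
  (forall u v, h u v = h v u) ->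
  \sum_u \sum_(v | v != u) h u v = (\sum_(p : ipair) h (val p).1 (val p).2) *+ 2.
Proof.
move=> hC.
have -> : \sum_(p : ipair) h (val p).1 (val p).2 = \sum_(u : 'I_n) \sum_(v : 'I_n | (u < v)%N) h u v.
  rewrite pair_big_dep /= (reindex_omap (val : ipair -> _) insub); last first.
    by move=> p Pp; rewrite insubT.
  by apply: eq_bigl => p; rewrite valK eqxx andbT (valP p).
have -> : \sum_u \sum_(v | v != u) h u v =
   \sum_(u : 'I_n) \sum_(v : 'I_n | (u < v)%N) h u v + \sum_(u : 'I_n) \sum_(v : 'I_n | (v < u)%N) h u v.
  rewrite -big_split; apply: eq_bigr => u _ /=.
  rewrite (bigID (fun v : 'I_n => (u < v)%N)) /=; congr (_ + _); apply: eq_bigl => v;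
    by rewrite -val_eqE /=; lia.
rewrite mulr2n; congr (_ + _); rewrite (exchange_big_dep xpredT) //=.
by apply: eq_bigr => u _; apply: eq_bigr.
Qed.

Lemma card_ipair : #|{: ipair}| = 'C(n, 2).
Proof.
have := @sum_ipair nat (fun _ _ => 1%N) (fun _ _ => erefl).
rewrite sum1_card => H.
have {H} : (#|{: ipair}| + #|{: ipair}| = n * n.-1)%N.
  rewrite -[LHS]/(#|{: ipair}| *+ 2) -H (eq_bigr (fun=> n.-1)) ?sum_nat_const ?card_ord // => u _.
  by rewrite sum1_card cardC1 card_ord.
by rewrite bin2 => <-; rewrite addnn doubleK.
Qed.

End OrderedPairs.

Section Exceptions.
Variable R : realType.

Section Count.
Variables I Z : finType.

Definition exceptions (A : I -> {set Z}) (g : {ffun I -> Z}) := [set i | g i \notin A i].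

(** Exponential moments: with weight exp(-s) for each exception, the total weight of
    all maps factors over I. *)
Lemma count_exceptions (A : I -> {set Z}) (s t : R) : 0 <= s ->
  #|[set g | #|exceptions A g|%:R <= t]|%:R
    <= expR (s * t) * \prod_i (#|A i|%:R + expR (- s) * #|Z|%:R).
Proof.
move=> s0.
pose F i c : R := if c \in A i then 1 else expR (- s).
have F0 i c : 0 <= F i c by rewrite /F; case: ifP => // _; exact: expR_ge0.
have S i : \sum_c F i c <= #|A i|%:R + expR (- s) * #|Z|%:R.
  rewrite (bigID (mem (A i))) /=; apply: lerD.
    rewrite (eq_bigr (fun=> 1)) ?sumr_const // => c; by rewrite /F => ->.
  rewrite (eq_bigr (fun=> expR (- s))); last by move=> c; rewrite /F => /negbTE->.
  rewrite sumr_const -[X in X <= _]mulr_natr ler_wpM2l ?expR_ge0 // ler_nat.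
  exact: max_card.
have le_prod : \prod_i \sum_c F i c <= \prod_i (#|A i|%:R + expR (- s) * #|Z|%:R).
  by apply: ler_prod => i _; rewrite S sumr_ge0.
apply: le_trans (ler_wpM2l (expR_ge0 _) le_prod).
rewrite bigA_distr_bigA /= mulr_sumr.
apply: le_trans (_ : \sum_(g in [set g | #|exceptions A g|%:R <= t]) 1 <= _).
  by rewrite sumr_const.
rewrite [X in _ <= X](bigID (mem [set g | #|exceptions A g|%:R <= t])) /=.
apply: ler_wpDr.
  by apply: sumr_ge0 => g _; rewrite mulr_ge0 ?expR_ge0 // prodr_ge0.
apply: ler_sum => g; rewrite inE => gt.
have -> : \prod_i F i (g i) = expR (- (s * #|exceptions A g|%:R)).
  rewrite (bigID (fun i => g i \in A i)) /= big1 ?mul1r; last by move=> i; rewrite /F => ->.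
  rewrite (eq_bigr (fun=> expR (- s))); last by move=> i; rewrite /F => /negbTE->.
  by rewrite prodr_const /exceptions cardsE -expRM_natl mulrN mulrC.
by rewrite -expRD; apply: le_trans (expR_ge1Dx _); rewrite lerDl subr_ge0 ler_wpM2l.
Qed.

End Count.

(** Allowing kappa #|I| exceptions costs an exponential factor whose rate tends to 0
    with kappa, while sets reduced to 23/25 of the maximal size on a proportion gamma
    of I gain at the rate gamma ln (25 / 23). The ratio 23/25 is the loss found in
    [card_avoid_uniq]; lists of at most 3 out of 5 colors lose even more. *)
Lemma exceptions_gain (gamma : R) (N : nat) : 0 < gamma ->
  exists2 kappa : R, 0 < kappa & exists2 c : R, 0 < c &
  forall (I Z : finType) (b : R) (A : I -> {set Z}), (#|Z| <= N)%N -> 2 <= b ->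
    (forall i, #|A i|%:R <= b) ->
    gamma * #|I|%:R <= #|[set i | #|A i|%:R <= 23 / 25 * b]|%:R ->
    #|[set g | #|exceptions A g|%:R <= kappa * #|I|%:R]|%:R
      <= b ^+ #|I| * expR (- (c * #|I|%:R)).
Proof.
move=> g0; pose l : R := ln (25 / 23).
have l0 : 0 < l by rewrite /l ln_gt0 //; lra.
pose d := gamma * l / 3; have d0 : 0 < d by rewrite /d; nra.
pose s := (N%:R + 1) / d.
have s0 : 0 < s by rewrite divr_gt0 // ltr_wpDl.
have sN : expR (- s) * N%:R <= d.
  rewrite expRN mulrC ler_pdivrMr ?expR_gt0 //.
  apply: le_trans (ler_wpM2l (ltW d0) (expR_ge1Dx s)).
  rewrite /s mulrDr mulr1 [d * _]mulrC divfK ?gt_eqF //; lra.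
exists (d / s); first exact: divr_gt0.
exists d => // I Z b A ZN b2 Ab Asm.
apply: le_trans (count_exceptions A (d / s * #|I|%:R) (ltW s0)) _.
have -> : s * (d / s * #|I|%:R) = d * #|I|%:R by rewrite mulrA [s * _]mulrC divfK ?gt_eqF.
pose small := [set i | #|A i|%:R <= 23 / 25 * b].
have bd : 0 < b * expR d by rewrite mulr_gt0 ?expR_gt0 //; lra.
have prod_le : \prod_i (#|A i|%:R + expR (- s) * #|Z|%:R) <=
    \prod_(i : I) (b * expR d * (if i \in small then 23 / 25 else 1)).
  apply: ler_prod => i _; apply/andP; split.
    by rewrite addr_ge0 // mulr_ge0 // expR_ge0.
  have Zd : expR (- s) * #|Z|%:R <= d.
    apply: le_trans sN; rewrite ler_wpM2l ?expR_ge0 //; by rewrite ler_nat.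
  have ed := expR_ge1Dx d.
  have := Ab i; rewrite inE; case: ifP => [sm _|_ sm]; nra.
apply: le_trans (ler_wpM2l (expR_ge0 _) prod_le) _.
rewrite big_split /= prodr_const -big_mkcond /= prodr_const -/small.
have -> : (23 / 25 : R) = expR (- l).
  by rewrite expRN lnK ?posrE ?invf_div //; lra.
rewrite -expRM_natl exprMn -expRM_natl cardT -cardE mulrCA -!mulrA ler_wpM2l //.
  by rewrite exprn_ge0; lra.
rewrite -!expRD ler_expR.
have : gamma * #|I|%:R * l <= #|small|%:R * l by rewrite ler_wpM2r // ltW.
rewrite /d; lra.
Qed.

End Exceptions.

(** * Frequencies within classes of a finite family *)

Section KeyedClasses.
Variable R : realType.
Variables (T Key : finType) (key : T -> Key).
Implicit Types (F A B : {set T}).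

Definition frac F B : R := #|F :&: B|%:R / #|F|%:R.

Definition keyclass F t := [set s in F | key s == key t].

Lemma frac_ge0 F B : 0 <= frac F B.
Proof. by rewrite /frac divr_ge0. Qed.

Lemma frac_le1 F B : frac F B <= 1.
Proof.
rewrite /frac; have [->|F0] := eqVneq F set0.
  by rewrite set0I cards0 mul0r.
rewrite ler_pdivrMr ?ltr0n ?card_gt0 // mul1r ler_nat.
by apply: subset_leq_card; apply: subsetIl.
Qed.

Lemma keyclass_self F t : t \in F -> t \in keyclass F t.
Proof. by rewrite inE eqxx andbT. Qed.

Lemma card_keyclass_gt0 F t : t \in F -> (0 < #|keyclass F t|)%N.
Proof. by move=> /keyclass_self tF; apply/card_gt0P; exists t. Qed.

Definition key_closed F A :=
  forall s t, t \in A -> s \in F -> key s = key t -> s \in A.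

(** The law of total probability: a class of size k inside A is counted k times, each
    time with the number of its elements in B divided by k. *)
Lemma sum_frac_keyclass F A B : A \subset F -> key_closed F A ->
  \sum_(t in A) frac (keyclass F t) B = #|A :&: B|%:R.
Proof.
move=> AF cA.
pose fib k := [set s in F | key s == k].
rewrite (partition_big key xpredT) //=.
transitivity (\sum_(k : Key) (#|A :&: B :&: fib k|%:R : R)).
  apply: eq_bigr => k _.
  rewrite (eq_bigr (fun=> frac (fib k) B)); last by move=> t /andP[_ /eqP <-].
  have [/existsP[t /andP[tA /eqP tk]]|N] := boolP [exists t, (t \in A) && (key t == k)].
    have fA : fib k \subset A.
      apply/subsetP => s; rewrite inE => /andP[sF /eqP sk].
      by apply: (cA s t) => //; rewrite sk tk.
    rewrite (eq_bigl (mem (fib k))); last first.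
      move=> s; rewrite [RHS]inE; case: eqP => sk; rewrite ?andbF // !andbT.
      apply/idP/idP => [/(subsetP AF)//|sF]; apply: (subsetP fA).
      by rewrite inE sF sk eqxx.
    rewrite sumr_const /frac -[LHS]mulr_natr divfK; last first.
      rewrite pnatr_eq0 -lt0n; apply/card_gt0P; exists t.
      by rewrite inE (subsetP AF) //= tk.
    by rewrite setIAC (setIidPr fA).
  have -> : A :&: B :&: fib k = set0.
    apply/setP => s; rewrite !inE; apply/negbTE; apply: contra N.
    by move=> /andP[/andP[sA _] /andP[_ sk]]; apply/existsP; exists s; rewrite sA.
  rewrite cards0 big_pred0 // => s.
  by apply/negbTE; apply: contra N => H; apply/existsP; exists s.
rewrite -natr_sum; congr (_%:R).
rewrite -sum1_card (partition_big key xpredT) //=.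
apply: eq_bigr => k _; rewrite -sum1_card; apply: eq_bigl => s.
by rewrite !inE; case sA: (s \in A) => //=; rewrite (subsetP AF).
Qed.

Lemma sum_inv_keyclass F : \sum_(t in F) (#|keyclass F t|%:R)^-1 <= #|Key|%:R :> R.
Proof.
rewrite (partition_big key xpredT) //=.
rewrite -sum1_card natr_sum; apply: ler_sum => k _.
pose fib := [set s in F | key s == k].
rewrite (eq_bigr (fun=> (#|fib|%:R)^-1)); last by move=> t /andP[_ /eqP tk]; rewrite /fib -tk.
rewrite (eq_bigl (mem fib)); last by move=> s; rewrite [RHS]inE.
rewrite sumr_const -[X in X <= _]mulr_natr.
have [->|f0] := eqVneq fib set0; first by rewrite cards0 mulr0.
by rewrite mulVf // pnatr_eq0 -lt0n card_gt0.
Qed.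

(** There are at most #|Key| classes, so those of size at most s cover little. *)
Lemma card_small_keyclass F (s : R) : 0 <= s ->
  #|[set t in F | #|keyclass F t|%:R <= s]|%:R <= s * #|Key|%:R.
Proof.
move=> s0; apply: le_trans (ler_wpM2l s0 (sum_inv_keyclass F)).
rewrite mulr_sumr -sum1_card natr_sum.
rewrite [X in _ <= X](bigID (fun t => #|keyclass F t|%:R <= s)) /=.
apply: ler_wpDr; first by apply: sumr_ge0 => t _; rewrite mulr_ge0 // invr_ge0.
rewrite (eq_bigl (fun t => (t \in F) && (#|keyclass F t|%:R <= s))); last first.
  by move=> t; rewrite inE.
apply: ler_sum => t /andP[tF ts].
by rewrite ler_pdivlMr ?mul1r // ltr0n card_keyclass_gt0.
Qed.

(** The increase of the mean square is the variance of the class frequency. On A this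
    frequency is at most eta / 2 on average, whereas its overall mean is at least eta,
    so A alone contributes a deviation of eta / 2. *)
Lemma keyclass_variance F A B (eta : R) : A \subset F -> key_closed F A ->
  0 <= eta -> (A != set0 -> eta <= frac F B) -> #|A :&: B|%:R <= eta / 2 * #|A|%:R ->
  #|F|%:R * frac F B ^+ 2 + (eta / 2) ^+ 2 * #|A|%:R
    <= \sum_(t in F) frac (keyclass F t) B ^+ 2.
Proof.
move=> AF cA eta0 pe AB; set p := frac F B.
have sF : \sum_(t in F) frac (keyclass F t) B = #|F|%:R * p.
  rewrite sum_frac_keyclass //.
  have [->|F0] := eqVneq F set0; first by rewrite set0I cards0 mul0r.
  by rewrite /p /frac mulrC divfK // pnatr_eq0 -lt0n card_gt0.
have E : \sum_(t in F) frac (keyclass F t) B ^+ 2 =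
    #|F|%:R * p ^+ 2 + \sum_(t in F) (frac (keyclass F t) B - p) ^+ 2.
  have -> : \sum_(t in F) (frac (keyclass F t) B - p) ^+ 2 =
     \sum_(t in F) frac (keyclass F t) B ^+ 2 - 2 * p * \sum_(t in F) frac (keyclass F t) B
     + #|F|%:R * p ^+ 2.
    rewrite (eq_bigr (fun t => frac (keyclass F t) B ^+ 2
        + (- (2 * p)) * frac (keyclass F t) B + p ^+ 2)); last by move=> t _; ring.
    by rewrite !big_split /= -mulr_sumr sumr_const [#|F|%:R * _]mulr_natl mulNr.
  by rewrite sF; ring.
rewrite E lerD2l.
apply: le_trans (_ : \sum_(t in A) (frac (keyclass F t) B - p) ^+ 2 <= _); last first.
  rewrite [X in _ <= X](bigID (mem A)) /=; apply: ler_wpDr.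
    by apply: sumr_ge0 => t _; apply: sqr_ge0.
  rewrite le_eqVlt; apply/orP; left; apply/eqP; apply: eq_bigl => t.
  by case tA: (t \in A); rewrite ?andbF // (subsetP AF).
apply: le_trans (_ : \sum_(t in A) (eta * (p - frac (keyclass F t) B) - (eta / 2) ^+ 2) <= _).
  rewrite sumrB -mulr_sumr sumrB !sumr_const sum_frac_keyclass //.
  rewrite -[p *+ _]mulr_natr -[(eta / 2) ^+ 2 *+ _]mulr_natr.
  have [->|A0] := eqVneq A set0.
    by rewrite set0I !cards0; lra.
  have := pe A0; rewrite -/p => pe'.
  have : eta * #|A|%:R <= p * #|A|%:R by rewrite ler_wpM2r.
  move=> h1; have : eta * #|A :&: B|%:R <= eta * (p * #|A|%:R - eta / 2 * #|A|%:R).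
    by rewrite ler_wpM2l //; lra.
  move=> h2; have : eta * (eta * #|A|%:R) <= eta * (p * #|A|%:R) by rewrite ler_wpM2l.
  have : eta * #|A :&: B|%:R <= eta * (eta / 2 * #|A|%:R) by rewrite ler_wpM2l.
  lra.
apply: ler_sum => t _.
(* The tangent line at eta / 2 replaces the Cauchy-Schwarz inequality. *)
have := sqr_ge0 (p - frac (keyclass F t) B - eta / 2); lra.
Qed.

Definition events F (l : seq {set T}) := [set t in F | all (fun B : {set T} => t \in B) l].

(** Otherwise each event would keep at least the proportion h of what the previous ones
    left, and something would remain at the end. *)
Lemma rare_event F (l : seq {set T}) (h : R) :
  F != set0 -> 0 < h -> events F l = set0 ->
  exists l1 B l2, [/\ l = l1 ++ B :: l2, h ^+ size l1 * #|F|%:R <= #|events F l1|%:R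
    & #|events F l1 :&: B|%:R < h * #|events F l1|%:R].
Proof.
move=> F0 h0 ev0.
have F1 : 0 < #|F|%:R :> R by rewrite ltr0n card_gt0.
have : #|events F l|%:R < h ^+ size l * #|F|%:R by rewrite ev0 cards0 mulr_gt0 ?exprn_gt0.
elim/last_ind: l {ev0} => [|l B IH].
  rewrite expr0 mul1r (_ : events F [::] = F) ?ltxx //.
  by apply/setP => t; rewrite inE andbT.
have evB : events F (rcons l B) = events F l :&: B.
  by apply/setP => t; rewrite !inE all_rcons; case: (t \in B); rewrite ?andbF ?andbT.
rewrite evB size_rcons => lt.
have [small|big] := ltP #|events F l|%:R (h ^+ size l * #|F|%:R).
  have [l1 [C [l2 [-> ? ?]]]] := IH small.
  by exists l1, C, (rcons l2 B); split; rewrite // rcons_cat.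
exists l, B, [::]; split; rewrite ?cats1 //.
apply: lt_le_trans lt _; rewrite exprS -mulrA ler_wpM2l // ltW //.
Qed.

End KeyedClasses.

(** * Rainbow selections of popular colors raise the energy *)

Section EnergyIncrement.
Variable R : realType.
Variables q n : nat.
Local Notation color := 'I_q.+1.
Local Notation Col := (coloring q.+1 (complete_graph n)).
Implicit Types (F : {set Col}) (x y u v : 'I_n) (L : 'I_n -> 'I_n -> {set color}).

Definition with_color u v (c : color) : {set Col} := [set phi | col phi u v == c].

Lemma with_colorC u v c : with_color u v c = with_color v u c.
Proof. by apply/setP => phi; rewrite !inE colC. Qed.

Definition freq F u v c : R := frac R F (with_color u v c).

Definition energy F : R := \sum_u \sum_v \sum_c freq F u v c ^+ 2.

Definition star x y (phi : Col) : {ffun 'I_n -> color * color} :=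
  [ffun z => (col phi x z, col phi y z)].

Lemma sum_freq F u v : F != set0 -> \sum_c freq F u v c = 1.
Proof.
move=> F0; rewrite /freq /frac -mulr_suml -natr_sum.
have -> : (\sum_c #|F :&: with_color u v c| = #|F|)%N.
  rewrite -[RHS]sum1_card (partition_big (fun phi => col phi u v) xpredT) //=.
  apply: eq_bigr => c _; rewrite -sum1_card; apply: eq_bigl => phi.
  by rewrite !inE.
by rewrite divff // pnatr_eq0 -lt0n card_gt0.
Qed.

Lemma freq_ge0 F u v c : 0 <= freq F u v c. Proof. exact: frac_ge0. Qed.

Lemma energy_le F : F != set0 -> energy F <= n%:R ^+ 2.
Proof.
move=> F0; have -> : n%:R ^+ 2 = \sum_(u < n) \sum_(v < n) (1 : R).
  by rewrite !sumr_const card_ord -[RHS]mulr_natr expr2.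
apply: ler_sum => u _; apply: ler_sum => v _.
rewrite -(sum_freq u v F0); apply: ler_sum => c _.
by rewrite expr2 -[X in _ <= X]mulr1 ler_wpM2l ?freq_ge0 // frac_le1.
Qed.

(** The increase of the mean square frequencies at uv when the colors at x and y are
    fixed, multiplied by the size of the family. *)
Definition gain F x y u v : R := \sum_c
  (\sum_(phi in F) freq (keyclass (star x y) F phi) u v c ^+ 2
   - #|F|%:R * freq F u v c ^+ 2).

Lemma gain_term_ge0 F x y u v c : 0 <=
  \sum_(phi in F) freq (keyclass (star x y) F phi) u v c ^+ 2
   - #|F|%:R * freq F u v c ^+ 2.
Proof.
have kc : key_closed (star x y) F set0 by move=> s t; rewrite inE.
have := @keyclass_variance R _ _ (star x y) F set0 (with_color u v c) 0 (sub0set F) kc (lexx 0).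
rewrite eqxx set0I !cards0 !mulr0 addr0 subr_ge0; apply=> //.
Qed.

Lemma gain_ge0 F x y u v : 0 <= gain F x y u v.
Proof. by apply: sumr_ge0 => c _; apply: gain_term_ge0. Qed.

Lemma sum_gain F x y : \sum_u \sum_v gain F x y u v =
  \sum_(phi in F) (energy (keyclass (star x y) F phi) - energy F).
Proof.
rewrite sumrB sumr_const -[energy F *+ _]mulr_natl /energy.
rewrite [X in _ = X - _]exchange_big mulr_sumr -sumrB; apply: eq_bigr => u _ /=.
rewrite [X in _ = X - _]exchange_big mulr_sumr -sumrB; apply: eq_bigr => v _ /=.
by rewrite [X in _ = X - _]exchange_big mulr_sumr -sumrB; apply: eq_bigr => c _.
Qed.

Definition rainbow_sel L x y u v :=
  [exists cs : 6.-tuple color, uniq cs &&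
     all2 (fun c (p : 'I_n * 'I_n) => c \in L p.1 p.2) cs (k4edges x y u v)].

Definition bad_quads L := [set p : ('I_n * 'I_n) * ('I_n * 'I_n) |
  uniq [:: p.1.1; p.1.2; p.2.1; p.2.2] && rainbow_sel L p.1.1 p.1.2 p.2.1 p.2.2].

Definition popular F (eta : R) u v := [set c | eta <= freq F u v c].

Lemma le_sum6 (a g1 g2 g3 g4 g5 g6 : R) :
  0 <= g1 -> 0 <= g2 -> 0 <= g3 -> 0 <= g4 -> 0 <= g5 -> 0 <= g6 ->
  a <= g1 \/ a <= g2 \/ a <= g3 \/ a <= g4 \/ a <= g5 \/ a <= g6 ->
  a <= g1 + g2 + g3 + g4 + g5 + g6.
Proof. by move=> *; repeat match goal with H : _ \/ _ |- _ => case: H => H end; lra. Qed.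

(** No coloring of F realizes a rainbow selection of popular colors, so along the six
    edges some popular color becomes rare once the earlier edges have their colors.
    The earlier edges all meet the edge opposite to the current one, so fixing the
    colors at the two ends of that opposite edge reveals the drop. *)
Lemma rainbow_sel_gain F (eta : R) x y u v :
  F != set0 -> F \subset rfree q n -> 0 < eta -> uniq [:: x; y; u; v] ->
  rainbow_sel (popular F eta) x y u v ->
  (eta / 2) ^+ 7 * #|F|%:R <=
    gain F x y u v + gain F x u y v + gain F x v y u
    + gain F y u x v + gain F y v x u + gain F u v x y.
Proof.
move=> F0 Ff eta0 U /existsP[[[|c1 [|c2 [|c3 [|c4 [|c5 [|c6 []]]]]]] //= i]].
rewrite /= !inE !andbT => /andP[Uc /and5P[p1 p2 p3 p4 /andP[p5 p6]]].
pose l := [:: with_color x y c1; with_color x u c2; with_color x v c3; with_color y u c4; with_color y v c5; with_color u v c6].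
have ev0 : events F l = set0.
  apply/setP => phi; rewrite in_set0; apply/negbTE; rewrite inE; apply/negP => /andP[pF].
  rewrite /l /= !inE andbT => /and5P[/eqP e1 /eqP e2 /eqP e3 /eqP e4 /andP[/eqP e5 /eqP e6]].
  have := rfree_k4 (subsetP Ff _ pF) U.
  by rewrite /k4colors /= /pcol /= e1 e2 e3 e4 e5 e6 !inE !andbT Uc.
have h0 : 0 < eta / 2 by lra.
have eta1 : eta <= 1 by apply: le_trans p1 _; apply: frac_le1.
have [l1 [B [l2 [El lo hi]]]] := rare_event F0 h0 ev0.
(* Here st is the edge whose color becomes rare, and ab the opposite edge. *)
have key (a b s t : 'I_n) (c : color) : B = with_color s t c -> (size l1 <= 5)%N ->
    eta <= freq F s t c -> key_closed (star a b) F (events F l1) ->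
    (eta / 2) ^+ 7 * #|F|%:R <= gain F a b s t.
  move=> EB sl pc kc.
  have AF : events F l1 \subset F by apply/subsetP => phi; rewrite inE => /andP[].
  have := keyclass_variance AF kc (ltW eta0) (fun _ => pc) _.
  rewrite -EB => /(_ (ltW hi)) V.
  rewrite /gain (bigD1 c) //=; apply: ler_wpDr.
    by apply: sumr_ge0 => c' _; apply: gain_term_ge0.
  rewrite lerBrDl /freq -EB; apply: le_trans V; rewrite lerD2l.
  have -> : 7%N = (2 + 5)%N by [].
  rewrite exprD -mulrA ler_wpM2l ?exprn_ge0 ?(ltW h0) //.
  apply: le_trans lo; rewrite ler_wpM2r //.
  rewrite -(subnKC sl) exprD ger_pMr ?exprn_gt0 // exprn_ile1 ?(ltW h0) //; lra.
have clos (a b : 'I_n) : all (fun B : {set Col} => [exists s, exists c,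
      (B == with_color a s c) || (B == with_color b s c)]) l1 -> key_closed (star a b) F (events F l1).
  move=> al phi psi; rewrite !inE => /andP[_ /allP psiB] -> /ffunP E /=.
  apply/allP => C Cl; have := psiB C Cl.
  have /allP/(_ C Cl)/existsP[s /existsP[c]] := al.
  have := E s; rewrite !ffunE => -[Ea Eb].
  by case/orP => /eqP ->; rewrite !inE ?Ea ?Eb.
have A1 (a b s : 'I_n) c : [exists s', exists c', (with_color a s c == with_color a s' c') || (with_color a s c == with_color b s' c')].
  by apply/existsP; exists s; apply/existsP; exists c; rewrite eqxx.
have A2 (a b s : 'I_n) c : [exists s', exists c', (with_color b s c == with_color a s' c') || (with_color b s c == with_color b s' c')].
  by apply/existsP; exists s; apply/existsP; exists c; rewrite eqxx orbT.
have A3 (a b s : 'I_n) c : [exists s', exists c', (with_color s a c == with_color a s' c') || (with_color s a c == with_color b s' c')].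
  by rewrite (with_colorC s a).
have A4 (a b s : 'I_n) c : [exists s', exists c', (with_color s b c == with_color a s' c') || (with_color s b c == with_color b s' c')].
  by rewrite (with_colorC s b).
apply: le_sum6; try exact: gain_ge0.
move: El clos key; rewrite /l.
case: l1 lo hi => [|b1 [|b2 [|b3 [|b4 [|b5 [|b6 l1]]]]]] lo hi /= E clos key.
- case: E => EB _; do 5 right.
  by apply: (key u v x y c1) => //; apply: clos.
- case: E => E1 EB _; do 4 right; left.
  by apply: (key y v x u c2) => //; apply: clos; rewrite -E1 /=;
    repeat (apply/andP; split=> //); first [exact: A1 | exact: A2 | exact: A3 | exact: A4].
- case: E => E1 E2 EB _; do 3 right; left.
  by apply: (key y u x v c3) => //; apply: clos; rewrite -E1 -E2 /=;
    repeat (apply/andP; split=> //); first [exact: A1 | exact: A2 | exact: A3 | exact: A4].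
- case: E => E1 E2 E3 EB _; do 2 right; left.
  by apply: (key x v y u c4) => //; apply: clos; rewrite -E1 -E2 -E3 /=;
    repeat (apply/andP; split=> //); first [exact: A1 | exact: A2 | exact: A3 | exact: A4].
- case: E => E1 E2 E3 E4 EB _; do 1 right; left.
  by apply: (key x u y v c5) => //; apply: clos; rewrite -E1 -E2 -E3 -E4 /=;
    repeat (apply/andP; split=> //); first [exact: A1 | exact: A2 | exact: A3 | exact: A4].
- case: E => E1 E2 E3 E4 E5 EB _; left.
  by apply: (key x y u v c6) => //; apply: clos; rewrite -E1 -E2 -E3 -E4 -E5 /=;
    repeat (apply/andP; split=> //); first [exact: A1 | exact: A2 | exact: A3 | exact: A4].
- by case: E => _ _ _ _ _ _ /(congr1 size); rewrite size_cat /= addnS.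
Qed.

End EnergyIncrement.

(** * The energy increment *)

Section Regularity.
Variable R : realType.
Variables q n : nat.
Local Notation color := 'I_q.+1.
Local Notation Col := (coloring q.+1 (complete_graph n)).
Implicit Types (F : {set Col}) (x y u v : 'I_n).

Let sum4 (g : 'I_n -> 'I_n -> 'I_n -> 'I_n -> R) := \sum_x \sum_y \sum_u \sum_v g x y u v.

Let sum4_yu g : sum4 (fun x y u v => g x u y v) = sum4 g.
Proof. by apply: eq_bigr => x _; rewrite exchange_big. Qed.

Let sum4_xy g : sum4 (fun x y u v => g y x u v) = sum4 g.
Proof. by rewrite /sum4 exchange_big. Qed.

Let sum4_uv g : sum4 (fun x y u v => g x y v u) = sum4 g.
Proof. by apply: eq_bigr => x _; apply: eq_bigr => y _; rewrite exchange_big. Qed.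

(** Each bad quadruple contributes to one of six gains, and permuting the vertices
    identifies the six total sums. *)
Lemma sum_rainbow_gain F (eta : R) :
  F != set0 -> F \subset rfree q n -> 0 < eta ->
  (eta / 2) ^+ 7 * #|F|%:R * #|bad_quads (popular F eta)|%:R
    <= 6 * \sum_x \sum_y \sum_u \sum_v gain R F x y u v.
Proof.
move=> F0 Ff eta0; pose g := gain R F.
pose six x y u v := g x y u v + g x u y v + g x v y u + g y u x v + g y v x u + g u v x y.
have six0 x y u v : 0 <= six x y u v by rewrite /six !addr_ge0 // gain_ge0.
have -> : 6 * \sum_x \sum_y \sum_u \sum_v gain R F x y u v = sum4 six.
  transitivity (sum4 g + sum4 (fun x y u v => g x u y v) + sum4 (fun x y u v => g x v y u)
    + sum4 (fun x y u v => g y u x v) + sum4 (fun x y u v => g y v x u)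
    + sum4 (fun x y u v => g u v x y)).
    have e2 := sum4_yu g.
    have e3 := etrans (sum4_uv (fun x y u v => g x u y v)) e2.
    have e4 := etrans (sum4_xy (fun x y u v => g x u y v)) e2.
    have e5 := etrans (sum4_uv (fun x y u v => g y u x v)) e4.
    have e6 := etrans (sum4_yu (fun x y u v => g y v x u)) e5.
    rewrite e2 e3 e4 e5 e6 -[\sum_x _]/(sum4 g); ring.
  rewrite /sum4 -!big_split; apply: eq_bigr => x _; rewrite -!big_split.
  by apply: eq_bigr => y _; rewrite -!big_split; apply: eq_bigr => u _; rewrite -!big_split.
have -> : sum4 six = \sum_(p : ('I_n * 'I_n) * ('I_n * 'I_n)) six p.1.1 p.1.2 p.2.1 p.2.2.
  rewrite /sum4 pair_bigA [RHS](eq_bigr (fun p => six p.1.1 p.1.2 p.2.1 p.2.2)) //.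
  rewrite -(pair_bigA _ (fun p r => six p.1 p.2 r.1 r.2)) /=.
  by apply: eq_bigr => p _; rewrite pair_bigA.
rewrite [X in _ <= X](bigID (mem (bad_quads (popular F eta)))) /=.
apply: ler_wpDr; first by apply: sumr_ge0.
rewrite mulr_natr -sumr_const; apply: ler_sum => -[[x y] [u v]]; rewrite inE /= => /andP[U S].
exact: rainbow_sel_gain.
Qed.

(** By averaging, the stars of some x and y have a gain of order n^2. The number of
    classes they cut out is only exponential in n, so the classes of tiny size carry a
    negligible share of it, and some class of reasonable size has the increase. *)
Lemma energy_step F (eta beta : R) (d := beta * (eta / 2) ^+ 7 / 12) :
  F != set0 -> F \subset rfree q n -> 0 < eta -> 0 < beta ->
  beta * n%:R ^+ 4 < #|bad_quads (popular F eta)|%:R ->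
  exists2 F' : {set Col}, F' != set0 /\ F' \subset F &
    energy R F + d * n%:R ^+ 2 <= energy R F' /\
    d * #|F|%:R <= ((q.+1 * q.+1) ^ n)%:R * #|F'|%:R.
Proof.
move=> F0 Ff eta0 beta0 manybad.
have F1 : 0 < #|F|%:R :> R by rewrite ltr0n card_gt0.
have k0 : 0 < (eta / 2) ^+ 7 by rewrite exprn_gt0 //; lra.
have d0 : 0 < d by rewrite /d; nra.
have [x [y xy]] : exists x, exists y, 2 * d * n%:R ^+ 2 * #|F|%:R <
    \sum_(phi in F) (energy R (keyclass (star x y) F phi) - energy R F).
  pose P x y := 2 * d * n%:R ^+ 2 * #|F|%:R <
    \sum_(phi in F) (energy R (keyclass (star x y) F phi) - energy R F).
  have [/existsP[x /existsP[y xy]]|N] := boolP [exists x, exists y, P x y].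
    by exists x, y.
  have : \sum_x \sum_y \sum_u \sum_v gain R F x y u v
      <= \sum_(x < n) \sum_(y < n) 2 * d * n%:R ^+ 2 * #|F|%:R.
    apply: ler_sum => x _; apply: ler_sum => y _; rewrite sum_gain leNgt.
    apply: contra N => H; apply/existsP; exists x; apply/existsP; exists y; exact: H.
  rewrite !sumr_const card_ord -mulrnA -[_ *+ (n * n)]mulr_natr natrM.
  have := sum_rainbow_gain F0 Ff eta0.
  have : (eta / 2) ^+ 7 * #|F|%:R * (beta * n%:R ^+ 4) <
     (eta / 2) ^+ 7 * #|F|%:R * #|bad_quads (popular F eta)|%:R.
    by rewrite ltr_pM2l // mulr_gt0.
  have -> : (eta / 2) ^+ 7 * #|F|%:R * (beta * n%:R ^+ 4) =
     6 * (2 * d * n%:R ^+ 2 * #|F|%:R * (n%:R * n%:R)) by rewrite /d; field.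
  lra.
pose Key := {ffun 'I_n -> color * color}.
have cK : #|{: Key}| = ((q.+1 * q.+1) ^ n)%N.
  by rewrite card_ffun card_prod !card_ord.
have K0 : 0 < #|{: Key}|%:R :> R by rewrite cK ltr0n expn_gt0.
pose s := d * #|F|%:R / #|{: Key}|%:R.
have s0 : 0 <= s by rewrite divr_ge0 // mulr_ge0 // ltW.
have [/existsP[phi /and3P[pF p1 p2]]|N] := boolP [exists phi,
   [&& phi \in F, s <= #|keyclass (star x y) F phi|%:R &
    energy R F + d * n%:R ^+ 2 <= energy R (keyclass (star x y) F phi)]].
  exists (keyclass (star x y) F phi); split.
  - by rewrite -card_gt0 card_keyclass_gt0.
  - by apply/subsetP => psi; rewrite inE => /andP[].
  - by [].
  - by rewrite -cK [X in _ <= X]mulrC -ler_pdivrMr.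
have := card_small_keyclass (star x y) F s0.
rewrite divfK ?gt_eqF // => small.
have : \sum_(phi in F) (energy R (keyclass (star x y) F phi) - energy R F) <=
   \sum_(phi in F) (d * n%:R ^+ 2 + (if #|keyclass (star x y) F phi|%:R <= s then n%:R ^+ 2 else 0)).
  apply: ler_sum => phi pF.
  have E0 : 0 <= energy R F.
    by apply: sumr_ge0 => a _; apply: sumr_ge0 => b _; apply: sumr_ge0 => c _; apply: sqr_ge0.
  have dn : 0 <= d * n%:R ^+ 2 by rewrite mulr_ge0 ?sqr_ge0 // ltW.
  case: ifP => sm.
    have := @energy_le R _ _ (keyclass (star x y) F phi).
    by rewrite -card_gt0 card_keyclass_gt0 // => /(_ isT); move: E0 dn; clear; lra.
  move/negbT: sm; rewrite -ltNge addr0 => /ltW sm.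
  have := N; rewrite negb_exists => /forallP/(_ phi); rewrite pF sm /= -ltNge; clear; lra.
rewrite [X in _ <= X -> _]big_split /= [\sum_(i in F) d * _]sumr_const -[_ *+ #|F|]mulr_natr.
rewrite -big_mkcondr /= sumr_const.
have -> : #|[pred phi in F | #|keyclass (star x y) F phi|%:R <= s]| =
  #|[set t in F | #|keyclass (star x y) F t|%:R <= s]| by rewrite cardsE.
rewrite -[_ *+ #|[set _ in F | _]|]mulr_natr => H.
have : n%:R ^+ 2 * #|[set t in F | #|keyclass (star x y) F t|%:R <= s]|%:R
   <= n%:R ^+ 2 * (d * #|F|%:R) by rewrite ler_wpM2l // sqr_ge0.
lra.
Qed.

(** The loss of size is a factor exponential in n for each of the k steps, negligible
    against exponentials in n^2. *)
Lemma energy_iter F (eta beta : R) (k : nat) (d := beta * (eta / 2) ^+ 7 / 12) :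
  F != set0 -> F \subset rfree q n -> 0 < eta <= 1 -> 0 < beta <= 1 ->
  exists2 F' : {set Col}, F' != set0 /\ F' \subset F &
    (d / ((q.+1 * q.+1) ^ n)%:R) ^+ k * #|F|%:R <= #|F'|%:R /\
    (#|bad_quads (popular F' eta)|%:R <= beta * n%:R ^+ 4
     \/ k%:R * (d * n%:R ^+ 2) <= energy R F').
Proof.
move=> F0 Ff /andP[eta0 eta1] /andP[beta0 beta1].
have e7 : 0 < (eta / 2) ^+ 7 by rewrite exprn_gt0 //; lra.
have e7' : (eta / 2) ^+ 7 <= 1 by rewrite exprn_ile1 //; lra.
have d0 : 0 < d by rewrite /d; nra.
have d1 : d <= 1 by rewrite /d; nra.
have K1 : 1 <= ((q.+1 * q.+1) ^ n)%:R :> R by rewrite ler1n expn_gt0.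
have K0 : 0 < ((q.+1 * q.+1) ^ n)%:R :> R by apply: lt_le_trans K1.
elim: k => [|k [F1 [F10 F1F] [big alt]]].
  exists F => //; rewrite expr0 mul1r; split=> //; right.
  rewrite mul0r; apply: sumr_ge0 => u _; apply: sumr_ge0 => v _.
  by apply: sumr_ge0 => c _; apply: sqr_ge0.
have [few|many] := leP #|bad_quads (popular F1 eta)|%:R (beta * n%:R ^+ 4).
  exists F1 => //; split; last by left.
  apply: le_trans big; rewrite exprS -mulrA.
  apply: ler_piMl; first by rewrite mulr_ge0 // exprn_ge0 // ltW // divr_gt0.
  by rewrite ler_pdivrMr // mul1r (le_trans d1).
have {alt} en : k%:R * (d * n%:R ^+ 2) <= energy R F1.
  by case: alt => // few; move: (le_lt_trans few many); rewrite ltxx.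
have F1f : F1 \subset rfree q n by apply: subset_trans Ff.
have [F2 [F20 F21] [en2 big2]] := energy_step F10 F1f eta0 beta0 many.
exists F2; first by split=> //; apply: subset_trans F1F.
split; last by right; rewrite -natr1; move: en2; rewrite -/d; lra.
rewrite exprS -mulrA; apply: le_trans (ler_wpM2l _ big) _.
  by rewrite ltW // divr_gt0.
by rewrite mulrAC ler_pdivrMr // [X in _ <= X]mulrC.
Qed.

End Regularity.

(** * Templates of large families *)

Section Template.
Variable R : realType.

Lemma ln_prod (I : finType) (f : I -> R) : (forall i, 0 < f i) ->
  ln (\prod_i f i) = \sum_i ln (f i).
Proof.
move=> f0; suff [] : 0 < \prod_i f i /\ ln (\prod_i f i) = \sum_i ln (f i) by [].
elim/big_rec2: _ => [|i x y _ [y0 E]]; first by rewrite ln1.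
by split; rewrite ?mulr_gt0 // lnM ?posrE // E.
Qed.
Variable q : nat.
Local Notation color := 'I_q.+1.

Section Fixed.
Variable n : nat.
Local Notation Col := (coloring q.+1 (complete_graph n)).
Implicit Types (F : {set Col}) (L : 'I_n -> 'I_n -> {set color}).

Definition unlisted L (phi : Col) : {set ipair n} :=
  [set p | pcol phi (val p) \notin L (val p).1 (val p).2].

Lemma sum_unlisted_popular F (eta : R) : 0 <= eta ->
  \sum_(phi in F) #|unlisted (popular F eta) phi|%:R <=
    q.+1%:R * eta * #|{: ipair n}|%:R * #|F|%:R.
Proof.
move=> e0; have [->|F0] := eqVneq F set0; first by rewrite big_set0 cards0 mulr0.
have F1 : 0 < #|F|%:R :> R by rewrite ltr0n card_gt0.
under eq_bigr do rewrite -sum1_card natr_sum big_mkcond.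
rewrite exchange_big /=.
have -> : q.+1%:R * eta * #|{: ipair n}|%:R * #|F|%:R =
    \sum_(p : ipair n) \sum_(c : color) eta * #|F|%:R.
  rewrite !sumr_const card_ord -[_ *+ q.+1]mulr_natr -[RHS]mulr_natr; ring.
apply: ler_sum => p _; set u := (val p).1; set v := (val p).2.
rewrite (partition_big (fun phi => col phi u v) xpredT) //=.
apply: ler_sum => c _.
have [cL|cL] := boolP (c \in popular F eta u v).
  rewrite big1 ?mulr_ge0 // => phi /andP[_ /eqP E].
  by rewrite inE /pcol E cL.
rewrite (eq_bigr (fun=> 1)); last first.
  by move=> phi /andP[_ /eqP E]; rewrite inE /pcol E cL.
move: cL; rewrite inE -ltNge /freq /frac ltr_pdivrMr // => /ltW; apply: le_trans.
rewrite sumr_const ler_nat; apply: subset_leq_card; apply/subsetP => phi.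
by rewrite !inE.
Qed.

(** On average a coloring of F has an unpopular color on a proportion (q + 1) eta of the
    edges, so half of F exceeds twice this at most; [count_exceptions] counts that half. *)
Lemma card_popular_lists F (eta s : R) : F != set0 -> 0 < eta -> 0 <= s -> (1 < n)%N ->
  #|F|%:R <= 2 * (expR (s * (2 * (q.+1%:R * eta) * #|{: ipair n}|%:R)) *
    \prod_(p : ipair n)
      (#|popular F eta (val p).1 (val p).2|%:R + expR (- s) * q.+1%:R)).
Proof.
move=> F0 e0 s0 n1; set t := 2 * (q.+1%:R * eta) * #|{: ipair n}|%:R.
have F1 : 0 < #|F|%:R :> R by rewrite ltr0n card_gt0.
have t0 : 0 < t.
  by rewrite /t !mulr_gt0 // ltr0n card_ipair bin_gt0.
pose Fs := [set phi in F | #|unlisted (popular F eta) phi|%:R <= t].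
have half : #|F|%:R <= 2 * #|Fs|%:R :> R.
  have : \sum_(phi in F) (t - #|unlisted (popular F eta) phi|%:R) <=
      \sum_(phi in F) (if #|unlisted (popular F eta) phi|%:R <= t then t else 0).
    apply: ler_sum => phi _; case: ifP => [_|/negbT]; first by rewrite gerBl.
    by rewrite -ltNge subr_le0 => /ltW.
  rewrite [X in X <= _ -> _]sumrB sumr_const -[t *+ _]mulr_natr.
  rewrite -big_mkcondr /= sumr_const.
  have -> : #|[pred phi in F | #|unlisted (popular F eta) phi|%:R <= t]| = #|Fs|.
    by rewrite cardsE.
  rewrite -[t *+ #|Fs|]mulr_natr => H.
  have := sum_unlisted_popular F (ltW e0).
  have -> : q.+1%:R * eta * #|{: ipair n}|%:R * #|F|%:R = t * #|F|%:R / 2 by rewrite /t; field.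
  move=> H2; rewrite -(ler_pM2l t0); lra.
apply: le_trans half _; rewrite ler_wpM2l //.
pose enc (phi : Col) : {ffun ipair n -> color} := [ffun p => pcol phi (val p)].
have encI : injective enc.
  by move=> phi psi /ffunP E; apply: col_inj_lt => p; have := E p; rewrite !ffunE.
have := count_exceptions (fun p : ipair n => popular F eta (val p).1 (val p).2) t s0.
rewrite card_ord; apply: le_trans.
rewrite -(card_imset _ encI) ler_nat; apply: subset_leq_card.
apply/subsetP => _ /imsetP[phi pF ->]; move: pF; rewrite !inE => /andP[_].
rewrite (_ : unlisted _ _ = exceptions (fun p : ipair n => popular F eta (val p).1 (val p).2)
  (enc phi)) //.
by apply/setP => p; rewrite !inE ffunE.
Qed.

Lemma popular_neq0 F (eta : R) u v : F != set0 -> eta <= (q.+1%:R)^-1 ->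
  popular F eta u v != set0.
Proof.
move=> F0 e1; apply/negP => /eqP N.
have := sum_freq R u v F0 => S.
have : \sum_(c : color) freq R F u v c < \sum_(c : color) (q.+1%:R)^-1.
  apply: ltr_sum; first by apply/hasP; exists ord0; rewrite ?mem_index_enum.
  move=> c _; apply: lt_le_trans e1; rewrite ltNge; apply/negP => H.
  by have := in_set0 c; rewrite -N inE H.
by rewrite S sumr_const card_ord -[_ *+ _]mulr_natr mulVf ?ltxx // pnatr_eq0.
Qed.

Lemma few_unlisted F (eta : R) : F != set0 -> 0 <= eta ->
  exists2 phi, phi \in F &
    #|unlisted (popular F eta) phi|%:R <= q.+1%:R * eta * #|{: ipair n}|%:R.
Proof.
move=> F0 e0; have [/existsP[phi /andP[]]|N] := boolP [exists phi, (phi \in F) &&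
  (#|unlisted (popular F eta) phi|%:R <= q.+1%:R * eta * #|{: ipair n}|%:R)].
  by exists phi.
have : \sum_(phi in F) q.+1%:R * eta * #|{: ipair n}|%:R <
   \sum_(phi in F) (#|unlisted (popular F eta) phi|%:R : R).
  have /set0Pn[psi pF] := F0.
  apply: ltr_sum; first by apply/hasP; exists psi; rewrite ?mem_index_enum.
  move=> phi phiF; rewrite ltNge; apply: contra N => H; apply/existsP; exists phi.
  by rewrite phiF.
by rewrite sumr_const -[_ *+ #|F|]mulr_natr ltNge sum_unlisted_popular.
Qed.

End Fixed.

(** The energy never exceeds n^2, so boundedly many applications of [energy_step] lead
    to a subfamily whose popular lists have few rainbow selections. Its size, and hence
    up to a factor exponential in n that of F, is controlled by the product of its lists. *)
Theorem regular_template (eps beta : R) : 0 < eps -> 0 < beta <= 1 ->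
  exists n0, forall n, (n0 <= n)%N -> forall F : {set coloring q.+1 (complete_graph n)},
  F != set0 -> F \subset rfree q n ->
  exists L : 'I_n -> 'I_n -> {set color},
  [/\ (forall u v, L u v = L v u) /\ (forall u v, L u v != set0),
      #|bad_quads L|%:R <= beta * n%:R ^+ 4,
      ln #|F|%:R <= \sum_(p : ipair n) ln #|L (val p).1 (val p).2|%:R + eps * n%:R ^+ 2
    & exists2 phi, phi \in F & #|unlisted L phi|%:R <= eps * n%:R ^+ 2].
Proof.
move=> eps0 beta01; have beta0 : 0 < beta by case/andP: beta01.
set K : R := q.+1%:R; have K1 : 1 <= K by rewrite /K ler1n.
have K0 : 0 < K by lra.
(* With this s the unlisted colors cost a factor 1 + eps / 4 per edge; eta is then so
   small that paying exp(s) for every unlisted edge costs no more than that. *)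
pose s := 4 * K / eps.
have s0 : 0 < s by rewrite divr_gt0 // mulr_gt0.
pose eta := Num.min K^-1 (Num.min (eps / (8 * s * K)) (eps / K)).
have eta0 : 0 < eta.
  rewrite /eta !lt_min invr_gt0 K0 /=; apply/andP; split; first by rewrite divr_gt0 // mulr_gt0 // mulr_gt0.
  by rewrite divr_gt0.
have eta1 : eta <= K^-1 by rewrite /eta ge_min lexx.
have eta2 : eta <= eps / (8 * s * K) by rewrite /eta !ge_min lexx !orbT.
have eta3 : eta <= eps / K by rewrite /eta !ge_min lexx !orbT.
have eta01 : 0 < eta <= 1.
  by rewrite eta0 /=; apply: le_trans eta1 _; rewrite invf_le1.
pose d := beta * (eta / 2) ^+ 7 / 12.
have d0 : 0 < d by rewrite /d divr_gt0 // mulr_gt0 // exprn_gt0 //; lra.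
pose k := Num.bound d^-1.
have kd : 1 < k%:R * d.
  by rewrite -ltr_pdivrMr // mul1r; apply: archi_boundP; rewrite invr_ge0 ltW.
pose c1 := k%:R * (2 * ln K).
pose c2 : R := `|k%:R * ln d| + ln 2.
have c10 : 0 <= c1 by rewrite !mulr_ge0 // ln_ge0.
have c20 : 0 <= c2 by rewrite addr_ge0 // ln_ge0 //; lra.
pose n0 := maxn 2 (Num.bound (2 * (c1 + c2) / eps)).
exists n0 => n; rewrite geq_max => /andP[n2 nb] F F0 Ff.
have n20 : 2 <= n%:R :> R by rewrite (ler_nat _ 2 n).
have nbig : 2 * (c1 + c2) <= eps * n%:R.
  rewrite -ler_pdivrMl // mulrC.
  have h : 0 <= 2 * (c1 + c2) / eps.
    by apply: divr_ge0; [apply: mulr_ge0 => //; apply: addr_ge0|exact: ltW].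
  by apply: le_trans (ltW (archi_boundP h)) _; rewrite ler_nat.
have [F' [F'0 F'F] [big alt]] := energy_iter k F0 Ff eta01 beta01.
have few : #|bad_quads (popular F' eta)|%:R <= beta * n%:R ^+ 4.
  case: alt => // H; exfalso; have := le_trans H (energy_le R F'0).
  have N0 : 0 < n%:R ^+ 2 :> R by rewrite exprn_gt0 // (lt_le_trans _ n20).
  by rewrite mulrA -/d ger_pMl // leNgt kd.
exists (popular F' eta); split=> //.
- split=> u v; last exact: popular_neq0.
  by apply/setP => c; rewrite !inE /freq with_colorC.
- have F1 : 0 < #|F|%:R :> R by rewrite ltr0n card_gt0.
  have F'1 : 0 < #|F'|%:R :> R by rewrite ltr0n card_gt0.
  set P : R := #|{: ipair n}|%:R.
  have Pn : P <= n%:R ^+ 2 / 2.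
    rewrite /P card_ipair -[2]/(2%:R) ler_pdivlMr // -natrX -natrM ler_nat.
    rewrite muln2 bin2; apply: (@leq_trans (n * n.-1)).
      by rewrite -[X in (_ <= X)%N]odd_double_half leq_addl.
    by rewrite -mulnn leq_mul2l leq_pred orbT.
  have P0 : 0 <= P by rewrite /P.
  have step1 : ln #|F|%:R <= ln #|F'|%:R + (c1 * n%:R + `|k%:R * ln d|).
    have X0 : 0 < d / ((q.+1 * q.+1) ^ n)%:R.
      by rewrite divr_gt0 // ltr0n expn_gt0.
    have : ln ((d / ((q.+1 * q.+1) ^ n)%:R) ^+ k * #|F|%:R) <= ln #|F'|%:R.
      by rewrite ler_ln ?posrE // mulr_gt0 // exprn_gt0.
    have lnKey : ln (((q.+1 * q.+1) ^ n)%:R : R) = 2 * ln K * n%:R.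
      rewrite natrX lnXn ?ltr0n // natrM lnM ?posrE // -/K -[LHS]mulr_natr; ring.
    rewrite [ln (_ ^+ k * _)]lnM ?posrE ?exprn_gt0 // [ln (_ ^+ k)]lnXn //.
    rewrite [ln (d / _)]ln_div ?posrE ?ltr0n ?expn_gt0 // lnKey -[_ *+ k]mulr_natl /c1.
    have := ler_norm (- (k%:R * ln d)); rewrite normrN.
    by clear; move: (k%:R) (ln d) (ln K) (n%:R) (ln #|F|%:R) (ln #|F'|%:R) => *; lra.
  have step2 : ln #|F'|%:R <= ln 2 + eps / 2 * n%:R ^+ 2
      + \sum_(p : ipair n) ln #|popular F' eta (val p).1 (val p).2|%:R.
    have L1 u v : 1 <= #|popular F' eta u v|%:R :> R.
      by rewrite ler1n card_gt0 popular_neq0.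
    have := card_popular_lists F'0 eta0 (ltW s0) n2; rewrite -/K -/P.
    set Q := \prod_p _ => cl.
    have Qle : Q <= expR (eps / 4 * P) * \prod_(p : ipair n) #|popular F' eta (val p).1 (val p).2|%:R.
      have -> : expR (eps / 4 * P) = \prod_(p : ipair n) expR (eps / 4).
        by rewrite prodr_const -expRM_natl mulrC.
      rewrite -big_split; apply: ler_prod => p _ /=; apply/andP; split.
        by rewrite addr_ge0 // mulr_ge0 // expR_ge0.
      have sK : expR (- s) * K <= eps / 4.
        rewrite expRN mulrC ler_pdivrMr ?expR_gt0 //.
        have : 1 + s <= expR s := expR_ge1Dx s.
        have -> : K = eps / 4 * s by rewrite /s; field; rewrite gt_eqF.
        by move=> h; rewrite ler_wpM2l ?divr_ge0 ?(ltW eps0) // (le_trans _ h) // lerDr.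
      have := L1 (val p).1 (val p).2; have := expR_ge1Dx (eps / 4).
      set E := expR (eps / 4); set l := #|_|%:R => e1 l1.
      have : (1 + eps / 4) * l <= E * l by rewrite ler_wpM2r // (le_trans ler01).
      have : eps / 4 * 1 <= eps / 4 * l by rewrite ler_wpM2l // divr_ge0 // ltW.
      by move: sK; clear; lra.
    set Pi := \prod_(p : ipair n) _ in Qle.
    have Pi0 : 0 < Pi by apply: prodr_gt0 => p _; apply: lt_le_trans (L1 _ _).
    have lnPi : ln Pi = \sum_(p : ipair n) ln #|popular F' eta (val p).1 (val p).2|%:R.
      by apply: ln_prod => p; apply: lt_le_trans (L1 _ _).
    rewrite -lnPi.
    have se : s * (2 * (K * eta) * P) <= eps / 4 * P.
      rewrite mulrA ler_wpM2r //; move: eta2.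
      rewrite ler_pdivlMr; first by clear; lra.
      by rewrite mulr_gt0 // mulr_gt0.
    have : #|F'|%:R <= 2 * (expR (eps / 2 * P) * Pi).
      apply: le_trans cl _; rewrite ler_wpM2l //.
      have -> : eps / 2 * P = eps / 4 * P + eps / 4 * P by field.
      rewrite expRD -[X in _ <= X]mulrA; apply: ler_pM; rewrite ?expR_ge0 ?ler_expR //.
      apply: prodr_ge0 => p _; by rewrite addr_ge0 // mulr_ge0 // expR_ge0.
    have X0 : 0 < expR (eps / 2 * P) * Pi by rewrite mulr_gt0 ?expR_gt0.
    move=> Hle; have : ln #|F'|%:R <= ln (2 * (expR (eps / 2 * P) * Pi)).
      by rewrite ler_ln ?posrE // mulr_gt0.
    rewrite [ln (2 * _)]lnM ?posrE // [ln (expR _ * _)]lnM ?posrE ?expR_gt0 // expRK.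
    have : eps / 2 * P <= eps / 2 * (n%:R ^+ 2 / 2) by rewrite ler_wpM2l // divr_ge0 // ltW.
    have : 0 <= eps * n%:R ^+ 2 by rewrite mulr_ge0 ?sqr_ge0 // ltW.
    by clear; lra.
  have : (c1 + c2) * n%:R <= eps / 2 * n%:R ^+ 2.
    by rewrite expr2 mulrA ler_wpM2r //; move: nbig; clear; lra.
  have : c2 * 1 <= c2 * n%:R by rewrite ler_wpM2l // (le_trans _ n20) // ler1n.
  by rewrite /c2; move: step1 step2; clear; lra.
- have [phi pF' H] := few_unlisted F'0 (ltW eta0).
  exists phi; first exact: (subsetP F'F).
  apply: le_trans H _; rewrite -/K.
  apply: ler_pM; rewrite ?mulr_ge0 ?(ltW eta0) ?(ltW K0) //.
    by move: eta3; rewrite ler_pdivlMr // mulrC.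
  rewrite card_ipair -natrX ler_nat bin2 -mulnn.
  apply: (@leq_trans (n * n.-1)); last by rewrite leq_mul2l leq_pred orbT.
  by rewrite -divn2 leq_div.
Qed.

End Template.

(** * Rainbow selections from large lists *)

Section Selection.
Variables q n : nat.
Local Notation color := 'I_q.+1.
Implicit Types (L : 'I_n -> 'I_n -> {set color}) (ps : seq ('I_n * 'I_n)).

Definition selects L (g : 'I_n * 'I_n -> color) ps :=
  uniq [seq g p | p <- ps] && all (fun p => g p \in L p.1 p.2) ps.

(** When the i-th list is reached, X and the earlier choices exclude at most #|X| + i
    colors. *)
Lemma greedy_selects_avoid L (X : {set color}) ps : uniq ps ->
  (forall i, (i < size ps)%N -> (#|X| + i < nth 0 [seq #|L p.1 p.2| | p <- ps] i)%N) ->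
  exists g, selects L g ps /\ all (fun p => g p \notin X) ps.
Proof.
elim: ps X => [|p ps IH] X /=; first by exists (fun=> ord0).
move=> /andP[pps ups] H.
have /set0Pn[c] : L p.1 p.2 :\: X != set0.
  rewrite -card_gt0 cardsD subn_gt0.
  have := H 0%N isT; rewrite /= addn0; apply: leq_ltn_trans.
  by apply: subset_leq_card; apply: subsetIr.
rewrite inE => /andP[cX cL].
have [|g [/andP[ug gL] gX]] := IH (c |: X) ups.
  move=> i si; have := H i.+1 si; rewrite /= cardsU1 cX.
  by rewrite add1n addSn addnS.
exists (fun r => if r == p then c else g r).
have E : {in ps, forall r, (if r == p then c else g r) = g r}.
  by move=> r rps; case: eqP => // Er; rewrite -Er rps in pps.
split; last first.
  rewrite /= eqxx cX; apply/allP => r rps; rewrite E //.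
  by have := allP gX _ rps; rewrite !inE negb_or => /andP[].
apply/andP; split; rewrite /= eqxx.
  have -> : [seq (if r == p then c else g r) | r <- ps] = [seq g r | r <- ps] by apply/eq_in_map.
  rewrite ug andbT; apply/mapP => -[r rps cr].
  by have := allP gX _ rps; rewrite -cr !inE eqxx.
by rewrite cL; apply/allP => r rps; rewrite E //; apply: (allP gL).
Qed.

Lemma greedy_selects L ps : uniq ps ->
  (forall i, (i < size ps)%N -> (i < nth 0 [seq #|L p.1 p.2| | p <- ps] i)%N) ->
  exists g, selects L g ps.
Proof.
move=> ups H; have [|g [sg _]] := @greedy_selects_avoid L set0 ps ups; last by exists g.
by move=> i; rewrite cards0; apply: H.
Qed.

Lemma selects_perm L g ps ps' : perm_eq ps ps' -> selects L g ps = selects L g ps'.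
Proof.
by move=> pp; rewrite /selects (perm_uniq (perm_map g pp)) (perm_all _ pp).
Qed.

Lemma selects_rainbow L g x y u v :
  selects L g (k4edges x y u v) -> rainbow_sel L x y u v.
Proof.
case/andP=> ug gL; apply/existsP; exists [tuple of [seq g p | p <- k4edges x y u v]].
rewrite [X in uniq X]/= ug /=; move: gL => /=.
by rewrite !andbT.
Qed.

Lemma uniq_k4edges (x y u v : 'I_n) : uniq [:: x; y; u; v] -> uniq (k4edges x y u v).
Proof. by move=> /uniq_k4sets; apply: map_uniq. Qed.

(** A greedy choice by increasing size: two sizes with product at least 6 are at least
    2 and 3 in some order, or else at least 1 and 6. *)
Lemma selects_tri L p1 p2 p3 p4 p5 p6 (s := fun p : 'I_n * 'I_n => #|L p.1 p.2|) :
  uniq [:: p1; p2; p3; p4; p5; p6] ->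
  (6 <= s p1)%N -> (6 <= s p2)%N -> (6 <= s p3)%N -> (2 <= s p4)%N ->
  (6 <= s p5 * s p6)%N -> exists g, selects L g [:: p1; p2; p3; p4; p5; p6].
Proof.
move=> U b1 b2 b3 b4 b56.
have go ps : perm_eq [:: p1; p2; p3; p4; p5; p6] ps ->
   (forall i, (i < size ps)%N -> (i < nth 0 [seq #|L p.1 p.2| | p <- ps] i)%N) ->
   exists g, selects L g [:: p1; p2; p3; p4; p5; p6].
  move=> pp H; rewrite (perm_uniq pp) in U.
  by have [g sg] := greedy_selects U H; exists g; rewrite (selects_perm _ _ pp).
have s5 : (0 < s p5)%N by case: (s p5) b56.
have s6 : (0 < s p6)%N by case: (s p6) b56; rewrite ?muln0.
wlog le56 : p5 p6 U b56 go s5 s6 / (s p6 <= s p5)%N.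
  move=> W; have [le|/ltnW le] := leqP (s p6) (s p5); first exact: W.
  have P : perm_eq [:: p1; p2; p3; p4; p5; p6] [:: p1; p2; p3; p4; p6; p5].
    by clear; apply/permP => a /=; lia.
  have [g sg] : exists g, selects L g [:: p1; p2; p3; p4; p6; p5].
    apply: (W p6 p5) => //; first by rewrite -(perm_uniq P).
      by rewrite mulnC.
    move=> ps pp H; have [g sg] := go ps (perm_trans P pp) H.
    by exists g; rewrite -(selects_perm _ _ P).
  by exists g; rewrite (selects_perm _ _ P).
have s53 : (3 <= s p5)%N by move: b56 le56; case: (s p5) => [|[|[|]]] //; case: (s p6) => [|[|[|]]].
have [s62|s61] := leqP 2 (s p6).
  apply: (go [:: p4; p6; p5; p1; p2; p3]); first by clear; apply/permP => a /=; lia.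
  by move=> [|[|[|[|[|[|]]]]]] //= _; rewrite -/(s _); lia.
have e6 : s p6 = 1%N by lia.
rewrite e6 muln1 in b56.
apply: (go [:: p6; p4; p5; p1; p2; p3]); first by clear; apply/permP => a /=; lia.
by move=> [|[|[|[|[|[|]]]]]] //= _; rewrite -/(s _); lia.
Qed.

(** A greedy choice from six lists of size 5 fails only at the last one. Giving the first
    edge a color that the last list lacks saves the missing color. *)
Lemma selects_five L p1 p2 p3 p4 p5 p6 (s := fun p : 'I_n * 'I_n => #|L p.1 p.2|) :
  uniq [:: p1; p2; p3; p4; p5; p6] ->
  all (fun p => s p == 5%N) [:: p1; p2; p3; p4; p5; p6] -> L p1.1 p1.2 != L p6.1 p6.2 ->
  exists g, selects L g [:: p1; p2; p3; p4; p5; p6].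
Proof.
move=> U; rewrite /= !andbT => /and5P[/eqP s1 /eqP s2 /eqP s3 /eqP s4 /andP[/eqP s5 /eqP s6]] ne.
have /subsetPn[a a1 a6] : ~~ (L p1.1 p1.2 \subset L p6.1 p6.2).
  apply: contra ne => sub; rewrite eqEcard sub /=.
  by rewrite -[X in (X <= _)%N]/(s p6) -[X in (_ <= X)%N]/(s p1) s1 s6.
have [N1 U'] : p1 \notin [:: p2; p3; p4; p5; p6] /\ uniq [:: p2; p3; p4; p5; p6].
  by move: U => /andP[].
(* Only the last of the five remaining lists needs all its colors, and a is not there. *)
pose L' u v := if (u, v) == p6 then L u v else L u v :\ a.
have L'6 : L' p6.1 p6.2 = L p6.1 p6.2 by rewrite /L' -surjective_pairing eqxx.
have L'D p : (L p.1 p.2 :\ a \subset L' p.1 p.2) && (L' p.1 p.2 \subset L p.1 p.2).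
  by rewrite /L'; case: ifP => _; rewrite ?subxx subsetDl.
have L'4 p : s p = 5%N -> (4 <= #|L' p.1 p.2|)%N.
  move=> sp; have /andP[le _] := L'D p; apply: leq_trans (subset_leq_card le).
  by have := cardsD1 a (L p.1 p.2); rewrite -/(s p) sp; case: (_ \in _) => /=; lia.
have [|g /andP[ug /allP gL]] := @greedy_selects L' [:: p2; p3; p4; p5; p6] U'.
  have := L'4 _ s2; have := L'4 _ s3; have := L'4 _ s4; have := L'4 _ s5.
  have : #|L' p6.1 p6.2| = 5%N by rewrite L'6.
  move=> e6 e5 e4 e3 e2 [|[|[|[|[|]]]]] //= _;
    rewrite ?e6 //; by [apply: leq_trans e2|apply: leq_trans e3|apply: leq_trans e4|apply: leq_trans e5].
exists (fun r => if r == p1 then a else g r).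
have E : {in [:: p2; p3; p4; p5; p6], forall r, (if r == p1 then a else g r) = g r}.
  by move=> r rps; case: eqP => // Er; rewrite -Er rps in N1.
have ag : {in [:: p2; p3; p4; p5; p6], forall r, g r != a /\ g r \in L r.1 r.2}.
  move=> r rps; have gr := gL r rps; have /andP[_ sub] := L'D r.
  split; last exact: (subsetP sub).
  move: gr; rewrite /L' -surjective_pairing; case: eqP => [->|_]; last first.
    by rewrite !inE => /andP[].
  by apply: contraTneq => ->.
have -> : selects L (fun r => if r == p1 then a else g r) [:: p1; p2; p3; p4; p5; p6] =
  uniq (a :: [seq (if r == p1 then a else g r) | r <- [:: p2; p3; p4; p5; p6]]) &&
  all (fun r => (if r == p1 then a else g r) \in L r.1 r.2) [:: p1; p2; p3; p4; p5; p6].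
  by rewrite /selects [in LHS]map_cons eqxx.
have -> : [seq (if r == p1 then a else g r) | r <- [:: p2; p3; p4; p5; p6]] =
   [seq g r | r <- [:: p2; p3; p4; p5; p6]] by apply/eq_in_map.
apply/andP; split; first rewrite cons_uniq ug andbT.
  by apply/mapP => -[r /ag[/eqP ga _] e]; apply: ga.
apply/allP => r; rewrite in_cons; have [->|_] := eqVneq r p1; first by rewrite a1.
by move=> /= /ag[].
Qed.

End Selection.

(** * The extremal weight of a template without rainbow selections *)

Section Extremal.
Variables (R : realType) (q n : nat).
Local Notation color := 'I_q.+1.
Variable rho : R.
Hypothesis rho25 : 25 <= rho.
Variable L : 'I_n -> 'I_n -> {set color}.
Hypothesis LC : forall u v, L u v = L v u.
Hypothesis L0 : forall u v, L u v != set0.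
Hypothesis clean : forall x y u v, uniq [:: x; y; u; v] -> ~~ rainbow_sel L x y u v.

(** All lists with at least 6 colors count as rho. With rho the number of colors this
    dominates the logarithm of the size; with rho = 25 and at most 24 colors it exceeds
    it on such lists, which shows that they are few in a nearly extremal template. *)
Definition lweight (A : {set color}) : R :=
  ln (if (#|A| <= 5)%N then #|A|%:R else rho).

Let w u v := lweight (L u v).
Let s u v := #|L u v|.
Let l := ln rho.

Let wC u v : w u v = w v u. Proof. by rewrite /w LC. Qed.
Let sC u v : s u v = s v u. Proof. by rewrite /s LC. Qed.
Let s1 u v : (1 <= s u v)%N. Proof. by rewrite /s card_gt0. Qed.

Lemma ln5_le : ln 5 <= l / 2.
Proof.
have E : 5 ^+ 2 = 25 :> R by ring.
have : ln (5 ^+ 2) <= l by rewrite E ler_ln ?posrE //; move: rho25 => ?; lra.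
rewrite lnXn // -[ln 5 *+ 2]mulr_natr; lra.
Qed.

Let l0 : 0 <= l. Proof. by rewrite ln_ge0 //; apply: le_trans rho25; rewrite ler1n. Qed.

Let w_small u v : (s u v <= 5)%N -> w u v = ln (s u v)%:R.
Proof. by rewrite /w /lweight /s => ->. Qed.

Let w_small_le u v : (s u v <= 5)%N -> w u v <= l / 2.
Proof.
move=> s5; rewrite w_small //; apply: le_trans ln5_le.
by rewrite ler_ln ?posrE ?ltr0n ?s1 // (ler_nat _ _ 5).
Qed.

Let w_le u v : w u v <= l.
Proof.
have [s5|s6] := leqP (s u v) 5.
  by have := w_small_le s5; have := l0; lra.
by rewrite /w /lweight leqNgt -/(s u v) s6.
Qed.

Let w_prod_le u v a b : (s u v * s a b <= 5)%N -> w u v + w a b <= l / 2.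
Proof.
move=> le5; have := s1 u v; have := s1 a b => sab suv.
have le1 : (s u v <= 5)%N by apply: leq_trans le5; rewrite leq_pmulr.
have le2 : (s a b <= 5)%N by apply: leq_trans le5; rewrite leq_pmull.
rewrite !w_small // -lnM ?posrE ?ltr0n ?s1 // -natrM; apply: le_trans ln5_le.
by rewrite ler_ln ?posrE ?ltr0n ?muln_gt0 ?suv // (ler_nat _ _ 5).
Qed.

Let no_selection (x y u v : 'I_n) ps g : uniq [:: x; y; u; v] ->
  perm_eq ps (k4edges x y u v) -> ~~ selects L g ps.
Proof.
move=> U pp; apply: contra (clean U) => sg; apply: (@selects_rainbow _ _ _ g).
by rewrite -(selects_perm _ _ pp).
Qed.

(** If one more of these lists is large, the other two have a product of at most 5,
    since [selects_tri] excludes more; otherwise all three have at most 5 colors. *)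
Let tri_le u v x y : uniq [:: u; v; x; y] -> (6 <= s u v)%N -> (6 <= s u x)%N ->
  (2 <= s v x)%N -> w u y + w v y + w x y <= 3 / 2 * l.
Proof.
move=> U uv ux vx.
have U6 := uniq_k4edges U.
have key ps : perm_eq ps (k4edges u v x y) ->
   (exists g, selects L g ps) -> False.
  by move=> pp [g]; apply/negP; apply: no_selection U pp.
have [uy|uy] := leqP 6 (s u y).
  have [le5|gt5] := leqP (s v y * s x y) 5.
    by have := w_prod_le le5; have := w_le u y; lra.
  exfalso; apply: (key [:: (u, v); (u, x); (u, y); (v, x); (v, y); (x, y)]) => //.
  exact: selects_tri.
have [vy|vy] := leqP 6 (s v y).
  have [le5|gt5] := leqP (s u y * s x y) 5.
    by have := w_prod_le le5; have := w_le v y; lra.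
  have P : perm_eq [:: (u, v); (u, x); (v, y); (v, x); (u, y); (x, y)] (k4edges u v x y).
    by clear; apply/permP => a /=; lia.
  by exfalso; apply: (key _ P); apply: selects_tri => //; rewrite (perm_uniq P).
have [xy|xy] := leqP 6 (s x y).
  have [le5|gt5] := leqP (s u y * s v y) 5.
    by have := w_prod_le le5; have := w_le x y; lra.
  have P : perm_eq [:: (u, v); (u, x); (x, y); (v, x); (u, y); (v, y)] (k4edges u v x y).
    by clear; apply/permP => a /=; lia.
  by exfalso; apply: (key _ P); apply: selects_tri => //; rewrite (perm_uniq P).
have := @w_small_le u y; have := @w_small_le v y; have := @w_small_le x y.
by move=> /(_ xy) h1 /(_ vy) h2 /(_ uy) h3; lra.
Qed.

Let total (W : {set 'I_n}) : R := \sum_(u : 'I_n | u \in W) \sum_(v in W :\ u) w u v.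

Let total_del (W : {set 'I_n}) u : u \in W -> total W = total (W :\ u) + 2 * \sum_(v in W :\ u) w u v.
Proof.
move=> uW; rewrite /total (big_setD1 u) //=.
have -> : \sum_(a : 'I_n | a \in W :\ u) \sum_(b in W :\ a) w a b =
    \sum_(a in W :\ u) (w u a + \sum_(b in W :\ u :\ a) w a b).
  apply: eq_bigr => a; rewrite !inE => /andP[au aW].
  rewrite (big_setD1 u) ?inE ?uW 1?eq_sym ?au //= wC; congr (_ + _).
  by apply: eq_bigl => b; rewrite !inE andbCA.
by rewrite big_split /=; ring.
Qed.

(** Large lists behave as in a complete bipartite graph. If two adjacent large edges are
    closed by a list with two colors, [tri_le] allows to remove their three vertices.
    If not, remove the ends u, v of a large edge: any other vertex sends to them either
    two lists of at most 5 colors, or a large list and a singleton, so its weight is at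
    most ln rho. Without large lists every weight is at most ln 5 <= ln rho / 2. *)
Lemma total_weight_le (W : {set 'I_n}) :
  \sum_(u : 'I_n | u \in W) \sum_(v in W :\ u) lweight (L u v) <= (#|W|%:R ^+ 2 / 2 + #|W|%:R) * l.
Proof.
rewrite -/(total W); have [k] := ubnP #|W|; elim: k W => // k IH W Wk.
have del_card (U : {set 'I_n}) a : a \in U -> #|U|%:R = 1 + #|U :\ a|%:R :> R.
  by move=> aU; rewrite (cardsD1 a U) aU natrD.
have IH' (U : {set 'I_n}) a : a \in W -> U \subset W :\ a ->
    total U <= (#|U|%:R ^+ 2 / 2 + #|U|%:R) * l.
  move=> aW UW; apply: IH; apply: leq_trans (_ : #|W| <= k)%N; last by [].
  by rewrite (cardsD1 a W) aW add1n ltnS subset_leq_card.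
have [/existsP[u /existsP[v /existsP[x]]]|N3] := boolP [exists u : 'I_n, [exists v : 'I_n, [exists x : 'I_n,
   [&& u \in W, v \in W :\ u, x \in W :\ u :\ v, (6 <= s u v)%N, (6 <= s u x)%N & (2 <= s v x)%N]]]].
  case/and5P=> uW vW xW uv /andP[ux vx].
  rewrite (total_del uW) (total_del vW) (total_del xW).
  set W3 := W :\ u :\ v :\ x.
  have B : \sum_(y in W3) (w u y + w v y + w x y) <= \sum_(y in W3) (3 / 2 * l).
    apply: ler_sum => y; rewrite !inE => /and4P[yx yv yu yW]; apply: tri_le => //.
    move: vW xW; rewrite !inE => /andP[vu _] /and3P[xv xu _].
    by rewrite /= !inE !negb_or (eq_sym u v) (eq_sym u x) (eq_sym u y)
      (eq_sym v x) (eq_sym v y) (eq_sym x y) vu xu yu xv yv yx.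
  have T3 : total W3 <= (#|W3|%:R ^+ 2 / 2 + #|W3|%:R) * l.
    by apply: (IH' _ u) => //; apply: subset_trans (subsetDl _ _) (subsetDl _ _).
  rewrite (big_setD1 v vW) /= (big_setD1 x xW) /= (big_setD1 x xW) /= -/W3.
  move: B; rewrite !big_split /= sumr_const -[_ *+ #|W3|]mulr_natr.
  rewrite (del_card W u uW) (del_card _ v vW) (del_card _ x xW) -/W3.
  have := w_le u v; have := w_le u x; have := w_le v x.
  move: T3 l0; move: (total W3) (#|W3|%:R) (w u v) (w u x) (w v x) => t k3 a b c.
  move: (\sum_(y in W3) w u y) (\sum_(y in W3) w v y) (\sum_(y in W3) w x y) => s1' s2 s3.
  by generalize l => l1 *; nra.
have [/existsP[u /existsP[v /and3P[uW vW uv]]]|N2] := boolP [exists u : 'I_n, [exists v : 'I_n,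
   [&& u \in W, v \in W :\ u & (6 <= s u v)%N]]].
  have no3 x : x \in W :\ u :\ v -> (6 <= s u x)%N -> s v x = 1%N.
    move=> xW ux; apply/eqP; rewrite eqn_leq s1 andbT leqNgt.
    apply: contra N3 => vx; apply/existsP; exists u; apply/existsP; exists v.
    by apply/existsP; exists x; rewrite uW vW xW uv ux vx.
  have no3' x : x \in W :\ u :\ v -> (6 <= s v x)%N -> s u x = 1%N.
    move=> xW vx; apply/eqP; rewrite eqn_leq s1 andbT leqNgt.
    apply: contra N3 => ux; apply/existsP; exists v; apply/existsP; exists u.
    apply/existsP; exists x; move: vW xW; rewrite !inE => /andP[vu vW] /and3P[xv xu xW].
    by rewrite vW eq_sym vu uW xu xv xW sC uv vx ux.
  rewrite (total_del uW) (total_del vW).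
  set W2 := W :\ u :\ v.
  have B : \sum_(y in W2) (w u y + w v y) <= \sum_(y in W2) l.
    apply: ler_sum => y yW.
    have [uy|uy] := leqP 6 (s u y).
      by rewrite [w v y]w_small no3 // ln1 addr0 w_le.
    have [vy|vy] := leqP 6 (s v y).
      by rewrite [w u y]w_small no3' // ln1 add0r w_le.
    by have := w_small_le (uy : s u y <= 5)%N; have := w_small_le (vy : s v y <= 5)%N; lra.
  have T2 : total W2 <= (#|W2|%:R ^+ 2 / 2 + #|W2|%:R) * l.
    by apply: (IH' _ u) => //; apply: subsetDl.
  rewrite (big_setD1 v vW) /= -/W2.
  move: B; rewrite !big_split /= sumr_const -[_ *+ #|W2|]mulr_natr.
  rewrite (del_card W u uW) (del_card _ v vW) -/W2.
  have := w_le u v.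
  move: T2 l0; move: (total W2) (#|W2|%:R) (w u v) => t k3 a.
  move: (\sum_(y in W2) w u y) (\sum_(y in W2) w v y) => s1' s2.
  by generalize l => l1 *; nra.
apply: (@le_trans _ _ (\sum_(u : 'I_n | u \in W) \sum_(v in W) l / 2)).
  apply: ler_sum => u uW; rewrite [X in _ <= X](big_setD1 u) //=.
  apply: ler_wpDl; first by rewrite divr_ge0 // l0.
  apply: ler_sum => v vW; apply: w_small_le; rewrite leqNgt.
  by apply: contra N2 => uv; apply/existsP; exists u; apply/existsP; exists v; rewrite uW vW uv.
rewrite !sumr_const -[(l / 2) *+ _]mulr_natr -[X in X <= _]mulr_natr.
have : 0 <= #|W|%:R * l by rewrite mulr_ge0 // l0.
by move: (#|W|%:R) => a; generalize l => b *; nra.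
Qed.

End Extremal.

(** * Sampling *)

Section Sampling.

Lemma card_ffun_fiber (I V : finType) (s : seq I) (t : I -> V) : uniq s ->
  #|[set f : {ffun I -> V} | all (fun i => f i == t i) s]| = (#|V| ^ (#|I| - size s))%N.
Proof.
move=> us; pose F i : {set V} := if i \in s then [set t i] else setT.
have -> : #|[set f : {ffun I -> V} | all (fun i => f i == t i) s]| = #|family F|.
  rewrite cardsE; apply: eq_card => f; apply/allP/familyP => H i; rewrite /F.
    by case: ifP => [/H/eqP->|_]; rewrite !inE.
  by move=> is_; have := H i; rewrite /F is_ inE.
rewrite card_family; transitivity (\prod_i #|F i|)%N.
  by rewrite foldrE big_image.
rewrite (bigID (mem s)) /= big1 ?mul1n; last by move=> i; rewrite /F => ->; rewrite cards1.
rewrite (eq_bigr (fun=> #|V|)); last by move=> i /negbTE; rewrite /F => ->; rewrite cardsT.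
by rewrite prod_nat_const -(card_uniqP us) -(cardC (mem s)) addKn.
Qed.

Variable R : realType.

Lemma sum_ffun2 (m n : nat) (H : 'I_n -> 'I_n -> R) (i j : 'I_m) : i != j ->
  \sum_(f : {ffun 'I_m -> 'I_n}) H (f i) (f j) =
    (n ^ (m - 2))%:R * \sum_u \sum_v H u v.
Proof.
move=> ij; rewrite pair_bigA /= mulr_sumr.
rewrite (partition_big (fun f : {ffun 'I_m -> 'I_n} => (f i, f j)) xpredT) //=.
apply: eq_bigr => -[u v] _ /=.
rewrite (eq_bigr (fun=> H u v)); last by move=> f /eqP[-> ->].
rewrite sumr_const mulr_natl; congr (_ *+ _).
have us : uniq [:: i; j] by rewrite /= inE ij.
have := card_ffun_fiber (fun a => if a == i then u else v) us.
rewrite !card_ord => <-; rewrite -sum1_card -[RHS]sum1_card; apply: eq_bigl => f.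
rewrite [RHS]inE /= eqxx (eq_sym j) (negbTE ij) andbT.
exact: xpair_eqE.
Qed.

Lemma card_ffun4 (m n : nat) (B : {set ('I_n * 'I_n) * ('I_n * 'I_n)}) (i j k l : 'I_m) :
  uniq [:: i; j; k; l] ->
  #|[set f : {ffun 'I_m -> 'I_n} | ((f i, f j), (f k, f l)) \in B]| =
    (#|B| * n ^ (m - 4))%N.
Proof.
move=> U.
rewrite -sum1_card (partition_big (fun f : {ffun 'I_m -> 'I_n} => ((f i, f j), (f k, f l)))
  (mem B)) /=; last by move=> f; rewrite inE.
rewrite (eq_bigr (fun=> n ^ (m - 4))%N) ?sum_nat_const // => -[[x y] [u v]] bB.
have := card_ffun_fiber (fun a => if a == i then x else if a == j then y
  else if a == k then u else v) U.
rewrite !card_ord => <-; rewrite -sum1_card; apply: eq_bigl => f.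
move: U; rewrite /= !inE !negb_or -!andbA => /and5P[ij ik il jk /and3P[jl kl _]].
rewrite eqxx !(eq_sym _ i) (negbTE ij) (negbTE ik) (negbTE il) eqxx.
rewrite !(eq_sym _ j) (negbTE jk) (negbTE jl) eqxx (eq_sym l) (negbTE kl) andbT.
rewrite !xpair_eqE -!andbA; apply: andb_idl => /and4P[/eqP-> /eqP-> /eqP-> /eqP->].
exact: bB.
Qed.

(** Each of the six possible coincidences leaves three vertices free. *)
Lemma card_nonuniq_quads n : (#|[set p : ('I_n * 'I_n) * ('I_n * 'I_n) |
  ~~ uniq [:: p.1.1; p.1.2; p.2.1; p.2.2]]| <= 6 * n ^ 3)%N.
Proof.
pose T := (('I_n * 'I_n) * ('I_n * 'I_n))%type.
have inj (S : {set T}) (f : T -> 'I_n * 'I_n * 'I_n) : {in S &, injective f} -> (#|S| <= n ^ 3)%N.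
  move=> /card_in_imset <-; apply: leq_trans (max_card _) _.
  by rewrite !card_prod !card_ord !expnS expn0 muln1 mulnA.
pose S1 := [set p : T | p.1.1 == p.1.2]; pose S2 := [set p : T | p.1.1 == p.2.1].
pose S3 := [set p : T | p.1.1 == p.2.2]; pose S4 := [set p : T | p.1.2 == p.2.1].
pose S5 := [set p : T | p.1.2 == p.2.2]; pose S6 := [set p : T | p.2.1 == p.2.2].
have c1 : (#|S1| <= n ^ 3)%N.
  by apply: (inj _ (fun p => (p.1.2, p.2.1, p.2.2))) => -[[a b] [c d]] [[a' b'] [c' d']];
    rewrite !inE /= => /eqP-> /eqP-> [-> -> ->].
have c2 : (#|S2| <= n ^ 3)%N.
  by apply: (inj _ (fun p => (p.1.2, p.2.1, p.2.2))) => -[[a b] [c d]] [[a' b'] [c' d']];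
    rewrite !inE /= => /eqP-> /eqP-> [-> -> ->].
have c3 : (#|S3| <= n ^ 3)%N.
  by apply: (inj _ (fun p => (p.1.2, p.2.1, p.2.2))) => -[[a b] [c d]] [[a' b'] [c' d']];
    rewrite !inE /= => /eqP-> /eqP-> [-> -> ->].
have c4 : (#|S4| <= n ^ 3)%N.
  by apply: (inj _ (fun p => (p.1.1, p.2.1, p.2.2))) => -[[a b] [c d]] [[a' b'] [c' d']];
    rewrite !inE /= => /eqP-> /eqP-> [-> -> ->].
have c5 : (#|S5| <= n ^ 3)%N.
  by apply: (inj _ (fun p => (p.1.1, p.2.1, p.2.2))) => -[[a b] [c d]] [[a' b'] [c' d']];
    rewrite !inE /= => /eqP-> /eqP-> [-> -> ->].
have c6 : (#|S6| <= n ^ 3)%N.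
  by apply: (inj _ (fun p => (p.1.1, p.1.2, p.2.2))) => -[[a b] [c d]] [[a' b'] [c' d']];
    rewrite !inE /= => /eqP-> /eqP-> [-> -> ->].
apply: (@leq_trans #|S1 :|: S2 :|: S3 :|: S4 :|: S5 :|: S6|).
  apply: subset_leq_card; apply/subsetP => -[[a b] [c d]]; rewrite !inE /= !inE.
  by case: (a == b); case: (a == c); case: (a == d); case: (b == c); case: (b == d); case: (c == d).
have U2 (A B : {set T}) : (#|A :|: B| <= #|A| + #|B|)%N by rewrite cardsU leq_subr.
have := U2 (S1 :|: S2 :|: S3 :|: S4 :|: S5) S6; have := U2 (S1 :|: S2 :|: S3 :|: S4) S5.
have := U2 (S1 :|: S2 :|: S3) S4; have := U2 (S1 :|: S2) S3; have := U2 S1 S2.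
move: c1 c2 c3 c4 c5 c6; clear inj U2.
move: (#|S1 :|: S2|) (#|S1 :|: S2 :|: S3|) (#|S1 :|: S2 :|: S3 :|: S4|).
move: (#|S1 :|: S2 :|: S3 :|: S4 :|: S5|) (#|S1 :|: S2 :|: S3 :|: S4 :|: S5 :|: S6|).
move: (#|S1|) (#|S2|) (#|S3|) (#|S4|) (#|S5|) (#|S6|) (n ^ 3)%N; lia.
Qed.

Variable q : nat.
Local Notation color := 'I_q.+1.

Lemma rainbow_sel_comp m n (L : 'I_n -> 'I_n -> {set color}) (f : 'I_m -> 'I_n) x y u v :
  rainbow_sel (fun i j => L (f i) (f j)) x y u v = rainbow_sel L (f x) (f y) (f u) (f v).
Proof. by apply: eq_existsb => -[[|c1 [|c2 [|c3 [|c4 [|c5 [|c6 []]]]]]]]. Qed.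

(** A random map from m points to the vertices rarely meets a bad or degenerate
    quadruple; when it does not, [total_weight_le] applies to the lists it induces. The
    average over all maps is the density of the total weight. *)
Lemma sampled_weight (eps : R) : 0 < eps -> exists2 beta : R, 0 < beta <= 1 &
  exists n0, forall n, (n0 <= n)%N -> forall (rho : R) (L : 'I_n -> 'I_n -> {set color}),
  25 <= rho -> (forall u v, L u v = L v u) -> (forall u v, L u v != set0) ->
  #|bad_quads L|%:R <= beta * n%:R ^+ 4 ->
  \sum_(p : ipair n) lweight rho (L (val p).1 (val p).2) <=
    (1 / 4 + eps) * n%:R ^+ 2 * ln rho.
Proof.
move=> eps0.
(* A clean sample has density 1 / 2 + 3 / (2 (m - 1)), and 3 / (m - 1) <= eps. *)
pose m := (Num.bound (3 / eps)).+4.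
set M : R := m%:R.
have M4 : 4 <= M by rewrite /M (ler_nat _ 4).
have M1 : M - 1 = m.-1%:R by rewrite /M -[in LHS](@prednK m) // -natr1 addrK.
have Meps : 3 <= eps * (M - 1).
  rewrite mulrC -ler_pdivrMr //.
  have h : 0 <= 3 / eps by rewrite divr_ge0 // ltW.
  apply: le_trans (ltW (archi_boundP h)) _.
  by rewrite M1 ler_nat; do 3 apply: leqW.
have M6 : 0 < 4 * M ^+ 5 by rewrite mulr_gt0 // exprn_gt0 //; lra.
pose beta := Num.min 1 (eps / (4 * M ^+ 5)).
have b0 : 0 < beta by rewrite /beta lt_min ltr01 divr_gt0.
have b1 : beta <= 1 by rewrite /beta ge_min lexx.
have b2 : beta * (4 * M ^+ 5) <= eps.
  by rewrite -ler_pdivlMr // /beta ge_min lexx orbT.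
exists beta; first by rewrite b0.
exists (maxn m (Num.bound (6 / beta))) => n; rewrite geq_max => /andP[mn nb].
move=> rho L rho25 LC L0 fewbad.
have n0 : (0 < n)%N by apply: leq_trans mn.
have N0 : 0 < n%:R :> R by rewrite ltr0n.
have nbeta : 6 <= beta * n%:R.
  rewrite mulrC -ler_pdivrMr //.
  have h : 0 <= 6 / beta by rewrite divr_ge0 // ltW.
  by apply: le_trans (ltW (archi_boundP h)) _; rewrite ler_nat.
set l := ln rho; have l0 : 0 <= l by rewrite ln_ge0 //; lra.
pose g u v := lweight rho (L u v).
have g0 u v : 0 <= g u v.
  rewrite /g /lweight; case: ifP => _; apply: ln_ge0; last by lra.
  by rewrite ler1n card_gt0.
have gl u v : g u v <= l.
  rewrite /g /lweight /l; have c0 : (0 < #|L u v|)%N by rewrite card_gt0.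
  case: ifP => // c5; rewrite ler_ln ?posrE ?ltr0n //; last by lra.
  by apply: (@le_trans _ _ 5); [rewrite (ler_nat _ _ 5)|lra].
have gC u v : g u v = g v u by rewrite /g LC.
pose B := bad_quads L :|: [set p : ('I_n * 'I_n) * ('I_n * 'I_n) |
  ~~ uniq [:: p.1.1; p.1.2; p.2.1; p.2.2]].
have cB : #|B|%:R <= 2 * beta * n%:R ^+ 4.
  have : (#|B| <= #|bad_quads L| + 6 * n ^ 3)%N.
    by apply: leq_trans (_ : _ <= _ + _)%N (leq_add (leqnn _) (card_nonuniq_quads n));
      rewrite cardsU leq_subr.
  rewrite -(ler_nat R) natrD natrM natrX => cB.
  have : 6 * n%:R ^+ 3 <= beta * n%:R * n%:R ^+ 3 by rewrite ler_wpM2r // exprn_ge0 // ltW.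
  have -> : beta * n%:R * n%:R ^+ 3 = beta * n%:R ^+ 4 by ring.
  by move: (n%:R ^+ 4) (n%:R ^+ 3) fewbad cB => x y; lra.
pose Tot (f : {ffun 'I_m -> 'I_n}) : R := \sum_i \sum_(j | j != i) g (f i) (f j).
pose dirty (f : {ffun 'I_m -> 'I_n}) := [exists i, exists j, exists k, exists h,
  uniq [:: i; j; k; h] && (((f i, f j), (f k, f h)) \in B)].
have cardm : #|[set: 'I_m]|%:R = M by rewrite cardsT card_ord.
have TotE f : Tot f = \sum_(i : 'I_m | i \in setT) \sum_(j in setT :\ i) g (f i) (f j).
  rewrite /Tot; apply: eq_big => [i|i _]; first by rewrite inE.
  by apply: eq_bigl => j; rewrite !inE andbT.
have Tot_clean f : ~~ dirty f -> Tot f <= (M ^+ 2 / 2 + M) * l.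
  move=> df; rewrite TotE -cardm.
  apply: (@total_weight_le R q m rho rho25 (fun i j => L (f i) (f j))) => // i j k h U.
  apply: contra df => sel; apply/existsP; exists i; apply/existsP; exists j.
  apply/existsP; exists k; apply/existsP; exists h; rewrite U !inE /=.
  by rewrite -rainbow_sel_comp sel andbT orbN.
have Tot_le f : Tot f <= M ^+ 2 * l.
  rewrite TotE; apply: (@le_trans _ _ (\sum_(i : 'I_m | i \in setT) \sum_(j : 'I_m | j \in setT) l)).
    apply: ler_sum => i _; rewrite [X in _ <= X](big_setD1 i) ?inE //=.
    by apply: ler_wpDl => //; apply: ler_sum => j _; apply: gl.
  rewrite !sumr_const cardsT card_ord -mulrnA -[_ *+ _]mulr_natl natrM -expr2; lra.
have cdirty : #|[set f | dirty f]|%:R * n%:R ^+ 4 <= M ^+ 4 * (#|B|%:R * (n ^ m)%:R).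
  have sub : [set f | dirty f] \subset \bigcup_(t : ('I_m * 'I_m) * ('I_m * 'I_m) |
      uniq [:: t.1.1; t.1.2; t.2.1; t.2.2])
      [set f : {ffun 'I_m -> 'I_n} | ((f t.1.1, f t.1.2), (f t.2.1, f t.2.2)) \in B].
    apply/subsetP => f; rewrite inE => /existsP[i /existsP[j /existsP[k /existsP[h]]]].
    move=> /andP[U fB]; apply/bigcupP; exists ((i, j), (k, h)) => //.
    by rewrite in_set.
  have : (#|[set f | dirty f]| <= \sum_(t : ('I_m * 'I_m) * ('I_m * 'I_m)) #|B| * n ^ (m - 4))%N.
    apply: leq_trans (subset_leq_card sub) _.
    apply: (@leq_trans (\sum_(t : ('I_m * 'I_m) * ('I_m * 'I_m) |
      uniq [:: t.1.1; t.1.2; t.2.1; t.2.2]) #|B| * n ^ (m - 4))%N).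
      elim/big_rec2: _ => [|t x S U IH]; first by rewrite cards0.
      apply: leq_trans (_ : _ <= #|[set f : {ffun 'I_m -> 'I_n} |
         ((f t.1.1, f t.1.2), (f t.2.1, f t.2.2)) \in B]| + #|S|)%N _.
        by rewrite cardsU leq_subr.
      by rewrite card_ffun4 // leq_add2l.
    by rewrite [X in (_ <= X)%N](bigID (fun t : ('I_m * 'I_m) * ('I_m * 'I_m) =>
       uniq [:: t.1.1; t.1.2; t.2.1; t.2.2])) /= leq_addr.
  rewrite sum_nat_const !card_prod !card_ord => le.
  have : (#|[set f | dirty f]| * n ^ 4 <= m ^ 4 * (#|B| * n ^ m))%N.
    apply: leq_trans (leq_mul le (leqnn _)) _.
    have e : (n ^ m = n ^ (m - 4) * n ^ 4)%N by rewrite -expnD subnK.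
    rewrite e leq_eqVlt; apply/orP; left; apply/eqP.
    by move: (n ^ (m - 4))%N #|B| => a b; rewrite !expnS !expn0 !muln1; ring.
  rewrite -(ler_nat R) [X in X <= _]natrM [X in _ <= X]natrM [(#|B| * _)%:R]natrM.
  by rewrite (natrX _ n 4) (natrX _ m 4).
have main : M * (M - 1) * (n ^ (m - 2))%:R * \sum_u \sum_v g u v <=
    (n ^ m)%:R * ((M ^+ 2 / 2 + M) * l) + #|[set f | dirty f]|%:R * (M ^+ 2 * l).
  have -> : M * (M - 1) * (n ^ (m - 2))%:R * \sum_u \sum_v g u v = \sum_f Tot f.
    rewrite /Tot [RHS]exchange_big /= [RHS](eq_bigr (fun=> (M - 1) * ((n ^ (m - 2))%:R * \sum_u \sum_v g u v))).
      by rewrite sumr_const card_ord -[RHS]mulr_natl !mulrA.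
    move=> i _; rewrite [LHS]exchange_big /=.
    rewrite (eq_bigr (fun=> (n ^ (m - 2))%:R * \sum_u \sum_v g u v)); last first.
      by move=> j ji; rewrite sum_ffun2 // eq_sym.
    by rewrite sumr_const cardC1 card_ord -[LHS]mulr_natl M1.
  apply: (@le_trans _ _ (\sum_(f : {ffun 'I_m -> 'I_n})
      ((M ^+ 2 / 2 + M) * l + (if dirty f then M ^+ 2 * l else 0)))).
    apply: ler_sum => f _; case: ifP => [_|/negbT/Tot_clean]; last by rewrite addr0.
    apply: ler_wpDl (Tot_le f); rewrite mulr_ge0 // addr_ge0 ?divr_ge0 ?sqr_ge0 //; lra.
  rewrite big_split /= sumr_const card_ffun !card_ord -big_mkcond /= sumr_const.
  have -> : #|dirty| = #|[set f | dirty f]| by rewrite cardsE.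
  by rewrite -[X in X + _]mulr_natl -[X in _ + X]mulr_natl.
have G : \sum_u \sum_v g u v <= n%:R ^+ 2 * l * (1 / 2 + 2 * eps).
  have nm2 : (n ^ m)%:R = (n ^ (m - 2))%:R * n%:R ^+ 2 :> R.
    by rewrite -natrX -natrM -expnD subnK.
  have D0 : 0 < (n ^ (m - 2))%:R :> R by rewrite ltr0n expn_gt0 n0.
  have N40 : 0 < n%:R ^+ 4 :> R by rewrite exprn_gt0.
  have dirty_le : #|[set f | dirty f]|%:R <= M ^+ 4 * (2 * beta * (n ^ m)%:R).
    rewrite -(ler_pM2r N40); apply: le_trans cdirty _.
    have h : #|B|%:R * (n ^ m)%:R <= 2 * beta * n%:R ^+ 4 * (n ^ m)%:R by rewrite ler_wpM2r.
    have h' : M ^+ 4 * (#|B|%:R * (n ^ m)%:R) <= M ^+ 4 * (2 * beta * n%:R ^+ 4 * (n ^ m)%:R).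
      by rewrite ler_wpM2l // exprn_ge0 //; lra.
    by apply: le_trans h' _; rewrite le_eqVlt; apply/orP; left; apply/eqP; ring.
  have MM : 0 < M * (M - 1) by rewrite mulr_gt0 //; lra.
  rewrite -(ler_pM2l D0) -(ler_pM2l MM).
  rewrite mulrA; apply: le_trans main _.
  have h : #|[set f | dirty f]|%:R * (M ^+ 2 * l) <= M ^+ 4 * (2 * beta * (n ^ m)%:R) * (M ^+ 2 * l).
    by rewrite ler_wpM2r // mulr_ge0 // sqr_ge0.
  apply: le_trans (lerD (lexx _) h) _; rewrite nm2.
  set D := (n ^ (m - 2))%:R; set N2 := n%:R ^+ 2.
  have X0 : 0 <= D * N2 * l by rewrite !mulr_ge0 // ?ltW // exprn_gt0.
  have -> : D * N2 * ((M ^+ 2 / 2 + M) * l) + M ^+ 4 * (2 * beta * (D * N2)) * (M ^+ 2 * l) =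
     (D * N2 * l) * (M ^+ 2 / 2 + M + 2 * beta * M ^+ 6) by ring.
  have -> : M * (M - 1) * (D * (N2 * l * (1 / 2 + 2 * eps))) =
     (D * N2 * l) * (M * (M - 1) * (1 / 2 + 2 * eps)) by ring.
  apply: ler_wpM2l => //.
  have h1 : M * 3 <= M * (eps * (M - 1)) by rewrite ler_wpM2l //; lra.
  have h2 : M * (beta * (4 * M ^+ 5)) <= M * eps by rewrite ler_wpM2l //; lra.
  have h3 : 0 <= M * eps by rewrite mulr_ge0 // ?ltW //; lra.
  have h4 : 0 <= M * eps * (M - 2) by rewrite mulr_ge0 //; lra.
  have e1 : M * (beta * (4 * M ^+ 5)) = 4 * beta * M ^+ 6 by ring.
  move: h1 h2 h3 h4; rewrite e1; move: (beta * M ^+ 6) => *; nra.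
have := sum_ipair gC; rewrite -mulr_natr => E.
have : \sum_u \sum_(v | v != u) g u v <= \sum_u \sum_v g u v.
  apply: ler_sum => u _; rewrite [X in _ <= X](bigID (fun v => v != u)) /=.
  by apply: ler_wpDr => //; apply: sumr_ge0.
by rewrite E -/l; move: G; lra.
Qed.

End Sampling.

(** * Growth rate, and distance to five colors *)

Section CrudeBounds.
Variable R : realType.
Variable q : nat.
Local Notation color := 'I_q.+1.

(** The template of the whole family, weighed with rho the number of colors. *)
Theorem rfree_upper_bound (eps : R) : (25 <= q.+1)%N -> 0 < eps ->
  exists n0, forall n, (n0 <= n)%N ->
  #|rfree q n|%:R <= q.+1%:R `^ ((1 / 4 + eps) * n%:R ^+ 2) :> R.
Proof.
move=> r25 eps0; set r : R := q.+1%:R.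
have r25' : 25 <= r by rewrite /r (ler_nat _ 25).
have lr : 0 < ln r by apply: ln_gt0; lra.
have e2 : 0 < eps / 2 by lra.
have [beta b01 [n1 samp]] := @sampled_weight R q _ e2.
have e3 : 0 < eps / 2 * ln r by rewrite mulr_gt0.
have [n2 temp] := @regular_template R q _ _ e3 b01.
exists (maxn n1 n2) => n; rewrite geq_max => /andP[nn1 nn2].
have [->|F0] := eqVneq (rfree q n) set0; first by rewrite cards0 powR_ge0.
have [L [[LC L0] fewbad lnF _]] := temp n nn2 _ F0 (subxx _).
have := samp n nn1 r L r25' LC L0 fewbad.
have W (A : {set color}) : A != set0 -> ln (#|A|%:R : R) <= lweight r A.
  move=> A0; rewrite /lweight; case: ifP => // _.
  have r0 : 0 < r by apply: lt_le_trans r25'.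
  rewrite ler_ln ?posrE ?ltr0n ?card_gt0 //.
  by rewrite ler_nat (leq_trans (max_card _)) // card_ord.
have : \sum_(p : ipair n) ln (#|L (val p).1 (val p).2|%:R : R) <=
    \sum_(p : ipair n) lweight r (L (val p).1 (val p).2).
  by apply: ler_sum => p _; apply: W.
move: lnF; set S1 := \sum_p _; set S2 := \sum_p _; set N := n%:R ^+ 2 => h1 h2 h3.
have F1 : 0 < #|rfree q n|%:R :> R by rewrite ltr0n card_gt0.
rewrite /powR gt_eqF; last by apply: lt_le_trans r25'.
rewrite -[X in X <= _](lnK (x := #|rfree q n|%:R)) ?posrE // ler_expR.
by move: h1 h2 h3; clear; move: (ln #|_|%:R) S1 S2 (ln r) => a b c d; lra.
Qed.

Section Lists.
Variable n : nat.
Implicit Types (L : 'I_n -> 'I_n -> {set color}).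

Definition off (C : {set color}) (phi : coloring q.+1 (complete_graph n)) :=
  unlisted (fun _ _ => C) phi.

Let T := (('I_n * 'I_n) * ('I_n * 'I_n))%type.

Lemma card_nonfive L (k : nat) : (forall u v, L u v = L v u) ->
  (#|[set p : ipair n | #|L (val p).1 (val p).2| != 5%N]| <= k)%N ->
  (#|[set e : 'I_n * 'I_n | (e.2 != e.1) && (#|L e.1 e.2| != 5%N)]| <= 2 * k)%N.
Proof.
move=> LC few5; set Z := [set e : 'I_n * 'I_n | _].
have HC u v : (#|L u v| != 5%N)%:R = (#|L v u| != 5%N)%:R :> int by rewrite LC.
have := sum_ipair HC; rewrite -[RHS]mulr_natr.
have -> : \sum_(p : ipair n) (#|L (val p).1 (val p).2| != 5%N)%:R =
   #|[set p : ipair n | #|L (val p).1 (val p).2| != 5%N]|%:R :> int.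
  rewrite -sum1_card natr_sum [RHS]big_mkcond /=; apply: eq_bigr => p _.
  by rewrite inE; case: (_ != _).
have -> : \sum_u \sum_(v | v != u) (#|L u v| != 5%N)%:R = #|Z|%:R :> int.
  rewrite pair_big_dep /= -sum1_card natr_sum [LHS]big_mkcond /= [RHS]big_mkcond /=.
  by apply: eq_bigr => e _; rewrite inE; case: (_ != _); case: (_ != _).
by move=> E; rewrite mulnC; move: few5; rewrite -(leq_pmul2r (_ : 0 < 2)%N) //; move: E; lia.
Qed.

(** By [selects_five], a quadruple that is neither bad nor degenerate and whose six
    lists have size 5 has equal lists on opposite edges. *)
Lemma card_differ L (k : nat) : (forall u v, L u v = L v u) ->
  (#|[set p : ipair n | #|L (val p).1 (val p).2| != 5%N]| <= k)%N ->
  (#|[set p : T | L p.1.1 p.1.2 != L p.2.1 p.2.2]| <=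
     #|bad_quads L| + 6 * n ^ 3 + 12 * (k * n ^ 2))%N.
Proof.
move=> LC few5.
pose Z := [set e : 'I_n * 'I_n | (e.2 != e.1) && (#|L e.1 e.2| != 5%N)].
have cZ : (#|Z| <= 2 * k)%N by apply: card_nonfive.
have inj (f : T -> ('I_n * 'I_n) * ('I_n * 'I_n)) : injective f ->
    (#|[set p : T | (f p).1 \in Z]| <= 2 * k * n ^ 2)%N.
  move=> fI; rewrite -(card_imset _ fI); apply: (@leq_trans #|setX Z [set: 'I_n * 'I_n]|).
    apply: subset_leq_card; apply/subsetP => _ /imsetP[p pZ ->].
    by rewrite inE in pZ; rewrite [f p]surjective_pairing in_setX pZ inE.
  by rewrite cardsX cardsT card_prod card_ord mulnn leq_mul2r cZ orbT.
pose D (f : T -> ('I_n * 'I_n) * ('I_n * 'I_n)) := [set p : T | (f p).1 \in Z].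
pose f1 (p : T) := p; pose f2 (p : T) := (p.2, p.1).
pose f3 (p : T) := ((p.1.1, p.2.1), (p.1.2, p.2.2)).
pose f4 (p : T) := ((p.1.1, p.2.2), (p.1.2, p.2.1)).
pose f5 (p : T) := ((p.1.2, p.2.1), (p.1.1, p.2.2)).
pose f6 (p : T) := ((p.1.2, p.2.2), (p.1.1, p.2.1)).
have d1 : (#|D f1| <= 2 * k * n ^ 2)%N by apply: inj.
have d2 : (#|D f2| <= 2 * k * n ^ 2)%N by apply: inj => -[a b] [c d] [-> ->].
have d3 : (#|D f3| <= 2 * k * n ^ 2)%N.
  by apply: inj => -[[a b] [c d]] [[a' b'] [c' d']] [-> -> -> ->].
have d4 : (#|D f4| <= 2 * k * n ^ 2)%N.
  by apply: inj => -[[a b] [c d]] [[a' b'] [c' d']] [-> -> -> ->].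
have d5 : (#|D f5| <= 2 * k * n ^ 2)%N.
  by apply: inj => -[[a b] [c d]] [[a' b'] [c' d']] [-> -> -> ->].
have d6 : (#|D f6| <= 2 * k * n ^ 2)%N.
  by apply: inj => -[[a b] [c d]] [[a' b'] [c' d']] [-> -> -> ->].
have sub : [set p : T | L p.1.1 p.1.2 != L p.2.1 p.2.2] \subset
   bad_quads L :|: [set p : T | ~~ uniq [:: p.1.1; p.1.2; p.2.1; p.2.2]]
   :|: D f1 :|: D f2 :|: D f3 :|: D f4 :|: D f5 :|: D f6.
  apply/subsetP => -[[x y] [u v]]; rewrite inE /= => ne.
  case: (boolP (((x, y), (u, v)) \in _)) => // N; exfalso.
  move: N; rewrite !in_setU !negb_or -!andbA.
  rewrite [_ \in bad_quads L]inE [_ \in [set p : T | ~~ _]]inE /= negbK.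
  case/and5P => nb U z1 z2 /and4P[z3 z4 z5 z6].
  rewrite U /= in nb.
  have in5 a b : (b != a) -> ((a, b) \notin Z) -> #|L a b| == 5%N.
    by rewrite inE /= => -> /= ; rewrite negbK.
  have all5 : all (fun p : 'I_n * 'I_n => #|L p.1 p.2| == 5%N) (k4edges x y u v).
    move: U z1 z2 z3 z4 z5 z6; rewrite /= !inE !negb_or -!andbA.
    rewrite /f1 /f2 /f3 /f4 /f5 /f6 /=.
    case/and5P=> xy xu xv yu /and3P[yv uv _] z1 z2 z3 z4 z5 z6.
    by rewrite !in5 // ?inE //= eq_sym.
  have [g sg] := selects_five (uniq_k4edges U) all5 ne.
  by rewrite (selects_rainbow sg) in nb.
have U2 (A B : {set T}) : (#|A :|: B| <= #|A| + #|B|)%N by rewrite cardsU leq_subr.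
apply: leq_trans (subset_leq_card sub) _.
have := card_nonuniq_quads n.
set A0 := bad_quads L; set A1 := [set p : T | ~~ _] => c1.
have := U2 (A0 :|: A1 :|: D f1 :|: D f2 :|: D f3 :|: D f4 :|: D f5) (D f6).
have := U2 (A0 :|: A1 :|: D f1 :|: D f2 :|: D f3 :|: D f4) (D f5).
have := U2 (A0 :|: A1 :|: D f1 :|: D f2 :|: D f3) (D f4).
have := U2 (A0 :|: A1 :|: D f1 :|: D f2) (D f3).
have := U2 (A0 :|: A1 :|: D f1) (D f2).
have := U2 (A0 :|: A1) (D f1).
have := U2 A0 A1.
move: c1 d1 d2 d3 d4 d5 d6; clear; rewrite -mulnA.
move: (#|A0 :|: A1 :|: D f1 :|: D f2 :|: D f3 :|: D f4 :|: D f5 :|: D f6|).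
move: (#|A0 :|: A1 :|: D f1 :|: D f2 :|: D f3 :|: D f4 :|: D f5|).
move: (#|A0 :|: A1 :|: D f1 :|: D f2 :|: D f3 :|: D f4|).
move: (#|A0 :|: A1 :|: D f1 :|: D f2 :|: D f3|).
move: (#|A0 :|: A1 :|: D f1 :|: D f2|).
move: (#|A0 :|: A1 :|: D f1|).
move: (#|A0 :|: A1|) (#|A0|) (#|A1|) (#|D f1|) (#|D f2|) (#|D f3|) (#|D f4|) (#|D f5|) (#|D f6|).
by move: (n ^ 3)%N (k * n ^ 2)%N; lia.
Qed.

(** Averaging [card_differ] over the edges with lists of size 5, which are at least half
    of all pairs, finds one that agrees with almost all other edges. *)
Lemma majority_list L (k : nat) : (0 < n)%N ->
  (forall u v, L u v = L v u) ->
  (#|[set p : ipair n | #|L (val p).1 (val p).2| != 5%N]| <= k)%N ->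
  (2 * (n + 2 * k) <= n ^ 2)%N ->
  exists2 C : {set color}, #|C| = 5%N &
    (#|[set p : 'I_n * 'I_n | L p.1 p.2 != C]| * n ^ 2 <=
     2 * (#|bad_quads L| + 6 * n ^ 3 + 12 * (k * n ^ 2)))%N.
Proof.
move=> n0 LC few5 nk.
have := card_differ LC few5; set B := (_ + 12 * _)%N.
set Dif := [set p : T | _] => cD.
pose c (e : 'I_n * 'I_n) := #|[set p : 'I_n * 'I_n | L p.1 p.2 != L e.1 e.2]|.
have sumc : (\sum_e c e = #|Dif|)%N.
  rewrite -[RHS]sum1_card (partition_big (fun p : T => p.1) xpredT) //=.
  apply: eq_bigr => e _; rewrite /c -sum1_card [RHS](reindex_onto (fun p => (e, p)) snd) /=.
    by apply: eq_bigl => p; rewrite !inE /= !eqxx !andbT eq_sym.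
  by move=> [e1 e2] /andP[_ /eqP /= ->].
pose P5 := [set e : 'I_n * 'I_n | #|L e.1 e.2| == 5%N].
have [/existsP[e /andP[e5 ce]]|N] := boolP [exists e : 'I_n * 'I_n,
    (e \in P5) && (c e * n ^ 2 <= 2 * B)%N].
  by exists (L e.1 e.2); [move: e5; rewrite inE => /eqP|].
have cP5 : (n ^ 2 <= 2 * #|P5|)%N.
  have := card_nonfive LC few5; set Z := [set e : 'I_n * 'I_n | _] => cZ.
  pose dg := [set e : 'I_n * 'I_n | e.2 == e.1].
  have cdg : (#|dg| <= n)%N.
    rewrite -[X in (_ <= X)%N]card_ord -(card_in_imset (f := fst) (D := dg)) ?max_card //.
    by move=> [a b] [a' b']; rewrite !inE /= => /eqP-> /eqP-> ->.
  have sub : ~: P5 \subset dg :|: Z.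
    by apply/subsetP => e; rewrite !inE => ->; rewrite andbT orbN.
  have := subset_leq_card sub; rewrite cardsU; have := cardsC P5.
  rewrite card_prod !card_ord mulnn; move: nk cdg cZ; clear.
  move: (n ^ 2)%N (#|~: P5|) (#|dg :&: Z|) (#|dg|) (#|Z|) (#|P5|); lia.
have : (#|P5| * (2 * B).+1 <= n ^ 2 * #|Dif|)%N.
  rewrite -sum_nat_const [X in (_ <= X)%N]mulnC -sumc big_distrl /=.
  apply: leq_trans (_ : \sum_(e in P5) c e * n ^ 2 <= _)%N.
    apply: leq_sum => e e5; rewrite ltnNge; apply: contra N => H.
    by apply/existsP; exists e; rewrite e5.
  by rewrite [X in (_ <= X)%N](bigID (mem P5)) leq_addr.
have n20 : (0 < n ^ 2)%N by rewrite expn_gt0 n0.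
have : (n ^ 2 * #|Dif| <= n ^ 2 * B)%N by rewrite leq_mul2l cD orbT.
have : (n ^ 2 * B <= 2 * #|P5| * B)%N by rewrite leq_mul2r cP5 orbT.
have : (0 < #|P5|)%N by move: cP5 n20; case: #|P5| => //; lia.
rewrite mulnS mulnA (mulnC #|P5| 2); move: (2 * #|P5| * B)%N (n ^ 2 * B)%N (n ^ 2 * #|Dif|)%N #|P5|; clear; lia.
Qed.

End Lists.

(** If there were more such colorings, their template would have nearly maximal weight.
    Lists with at least 6 colors have at most 24 and fall short of the weight 25 they
    are granted, so they are few; then lists with less than 5 colors are few as well,
    and by [majority_list] almost all lists equal one set C. As some coloring of the
    family follows the template, it is close to C after all. *)
Theorem far_bound (delta : R) : (q.+1 <= 24)%N -> 0 < delta ->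
  exists2 zeta : R, 0 < zeta & exists n0, forall n, (n0 <= n)%N ->
  #|[set phi in rfree q n | [forall C : {set color}, (#|C| == 5%N) ==>
       (delta * n%:R ^+ 2 < #|off C phi|%:R)]]|%:R <=
    5 ^+ 'C(n, 2) * expR (- (zeta * n%:R ^+ 2)).
Proof.
move=> r24 delta0.
pose c1 : R := ln (25 / 24); have c10 : 0 < c1 by apply: ln_gt0; lra.
pose c2 : R := ln (5 / 4); have c20 : 0 < c2 by apply: ln_gt0; lra.
pose c3 : R := 7 / c1 + (2 + 14 / c1) / c2.
have c30 : 0 < c3 by rewrite addr_gt0 // divr_gt0 // addr_gt0 // divr_gt0.
(* c3 bounds the proportion of lists with a size other than 5 in units of z. *)
pose z : R := Num.min (delta / (5 + 24 * c3)) (1 / (16 * c3)).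
have d5 : 0 < 5 + 24 * c3 by lra.
have d16 : 0 < 16 * c3 by lra.
have z0 : 0 < z by rewrite lt_min !divr_gt0.
have z1 : z * (5 + 24 * c3) <= delta by rewrite -ler_pdivlMr // ge_min lexx.
have z2 : z * (16 * c3) <= 1 by rewrite -ler_pdivlMr // ge_min lexx orbT.
have [beta' b01' [n1 samp]] := @sampled_weight R q _ z0.
pose beta := Num.min beta' z.
have b01 : 0 < beta <= 1.
  by case/andP: b01' => b0 b1; rewrite lt_min b0 z0 ge_min b1.
have [n2 temp] := @regular_template R q _ _ z0 b01.
exists z => //.
exists (maxn (maxn n1 n2) (maxn 16 (Num.bound (6 / z)))) => n.
rewrite !geq_max -!andbA => /and4P[nn1 nn2 n16 nz].
set Far := [set phi in _ | _]; set N2 : R := n%:R ^+ 2.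
rewrite leNgt; apply/negP => big.
have F0 : Far != set0.
  apply: contraTneq big => ->; rewrite cards0 -leNgt mulr_ge0 ?expR_ge0 //.
  by rewrite exprn_ge0 //; lra.
have Ff : Far \subset rfree q n by apply/subsetP => phi; rewrite inE => /andP[].
have [L [[LC L0] fewbad lnF [phi phiF few]]] := temp n nn2 _ F0 Ff.
have fewbad' : #|bad_quads L|%:R <= beta' * n%:R ^+ 4.
  apply: le_trans fewbad _; rewrite ler_wpM2r ?exprn_ge0 //.
  by rewrite /beta ge_min lexx.
have := samp n nn1 25 L (lexx _) LC L0 fewbad'.
have ln25 : ln 25 = 2 * ln 5 :> R.
  have -> : 25 = 5 ^+ 2 :> R by ring.
  by rewrite lnXn // -[LHS]mulr_natl.
rewrite ln25 -/N2 => wle.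
have n0 : (0 < n)%N by apply: leq_trans n16.
have N16 : 16 <= n%:R :> R by rewrite (ler_nat _ 16).
have nz' : 6 <= z * n%:R.
  rewrite mulrC -ler_pdivrMr //.
  have h : 0 <= 6 / z by rewrite divr_ge0 // ltW.
  by apply: le_trans (ltW (archi_boundP h)) _; rewrite ler_nat.
have ln5_0 : 0 < ln 5 :> R by apply: ln_gt0; rewrite ltr1n.
have ln5_2 : ln 5 <= 2 :> R.
  have e : 3 / 2 <= expR (1 / 2 : R) by apply: le_trans (expR_ge1Dx _); clear; lra.
  rewrite -[2](@expRK R) ler_ln ?posrE ?expR_gt0 //.
  have -> : 2 = 4%:R * (1 / 2) :> R by field.
  rewrite expRM_natl; apply: le_trans (_ : (3 / 2) ^+ 4 <= _); first by clear; lra.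
  by rewrite ler_pXn2r // nnegrE ?expR_ge0 // divr_ge0.
pose P := #|{: ipair n}|.
have PE : 2 * P%:R = n%:R * (n%:R - 1) :> R.
  rewrite /P card_ipair -natrM mul2n bin2 -[n%:R - 1](_ : n.-1%:R = _).
    by rewrite -natrM; congr (_%:R); have := odd_double_half (n * n.-1);
      rewrite -[X in _ = X -> _]/(n * n.-1)%N oddM -[X in odd X && _](prednK n0) /= andNb.
  by rewrite -[in RHS](prednK n0) -natr1 addrK.
pose large := [set p : ipair n | (5 < #|L (val p).1 (val p).2|)%N].
pose small := [set p : ipair n | (#|L (val p).1 (val p).2| < 5)%N].
have lnbig : P%:R * ln 5 - z * N2 < ln #|Far|%:R.
  have -> : P%:R * ln 5 - z * N2 = ln (5 ^+ 'C(n, 2) * expR (- (z * N2))).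
    rewrite lnM ?posrE ?expR_gt0 ?exprn_gt0 // expRK lnXn // -[ln 5 *+ _]mulr_natl.
    by rewrite -card_ipair.
  by rewrite ltr_ln ?posrE ?mulr_gt0 ?expR_gt0 ?exprn_gt0 // ltr0n card_gt0.
have Wlarge : \sum_(p : ipair n) ln (#|L (val p).1 (val p).2|%:R : R) <=
   \sum_(p : ipair n) lweight 25 (L (val p).1 (val p).2) - c1 * #|large|%:R.
  rewrite mulr_natr -sumr_const [X in _ - X]big_mkcond -sumrB.
  apply: ler_sum => p _; rewrite inE /lweight ltnNge.
  have c0 : (0 < #|L (val p).1 (val p).2|)%N by rewrite card_gt0.
  case: ifP => le5 /=; first by rewrite subr0.
  have -> : ln 25 - c1 = ln 24 :> R.
    by rewrite /c1 -ln_div ?posrE ?divr_gt0 //; congr ln; field.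
  rewrite ler_ln ?posrE ?ltr0n // (ler_nat _ _ 24).
  by apply: leq_trans r24; rewrite (leq_trans (max_card _)) // card_ord.
have Wsmall : \sum_(p : ipair n) ln (#|L (val p).1 (val p).2|%:R : R) <=
   P%:R * ln 5 + ln 5 * #|large|%:R - c2 * #|small|%:R.
  rewrite mulr_natl -sumr_const !mulr_natr -!sumr_const.
  rewrite [X in _ + X - _]big_mkcond [X in _ - X]big_mkcond -big_split -sumrB /=.
  apply: ler_sum => p _; rewrite !inE.
  have c0 : (0 < #|L (val p).1 (val p).2|)%N by rewrite card_gt0.
  have c24 : (#|L (val p).1 (val p).2| <= 24)%N.
    by apply: leq_trans r24; rewrite (leq_trans (max_card _)) // card_ord.
  have up (a : nat) : (#|L (val p).1 (val p).2| <= a)%N ->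
     ln #|L (val p).1 (val p).2|%:R <= ln a%:R :> R.
    move=> le; rewrite ler_ln ?posrE ?ltr0n ?ler_nat //; exact: leq_trans le.
  case: ltngtP => c5 /=.
  - have -> : ln 5 + ln 5 - 0 = ln 25%:R :> R by rewrite ln25; ring.
    by apply: up; apply: leq_trans c24 _.
  - have -> : ln 5 + 0 - c2 = ln 4%:R :> R.
      by rewrite addr0 /c2 -ln_div ?posrE ?divr_gt0 //; congr ln; field.
    exact: up.
  - by rewrite addr0 subr0 c5.
have zn : n%:R <= z * N2.
  have : 6 * n%:R <= z * n%:R * n%:R by rewrite ler_wpM2r.
  by rewrite -mulrA -expr2 -/N2; move: N16; clear; lra.
have N20 : 0 <= N2 by apply: sqr_ge0.
have PE' : P%:R * ln 5 = N2 * ln 5 / 2 - n%:R * ln 5 / 2 :> R.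
  have -> : P%:R = n%:R * (n%:R - 1) / 2 :> R by rewrite -PE; field.
  by rewrite /N2; field.
have zl : z * N2 * ln 5 <= z * N2 * 2 by rewrite ler_wpM2l // mulr_ge0 // ltW.
have nl : n%:R * ln 5 <= n%:R * 2 :> R by rewrite ler_wpM2l.
have cl : c1 * #|large|%:R <= 7 * z * N2.
  move: lnF; rewrite -/N2 => lnF.
  move: PE' zl nl lnF lnbig Wlarge wle zn; clear.
  move: (\sum_p _) (\sum_p _) (ln #|Far|%:R) => S1 S2 f.
  move: (c1 * _) (P%:R * ln 5) (n%:R * ln 5) => x y t.
  move: (ln 5) (n%:R : R) => l nn.
  lra.
have cl' : #|large|%:R <= 7 * z * N2 / c1 by rewrite ler_pdivlMr // mulrC.
have cs : c2 * #|small|%:R <= (2 * z + 14 * z / c1) * N2.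
  move: lnF; rewrite -/N2 => lnF.
  have l2 : ln 5 * #|large|%:R <= 2 * #|large|%:R :> R by rewrite ler_wpM2r.
  have -> : (2 * z + 14 * z / c1) * N2 = 2 * z * N2 + 2 * (7 * z * N2 / c1) by ring.
  move: lnF lnbig Wsmall l2 cl'; clear.
  move: (\sum_p _) (ln #|Far|%:R) => S1 f.
  move: (#|large|%:R : R) (c2 * _) (P%:R * ln 5) (ln 5 * _) (7 * z * N2 / c1) => v x y t w.
  lra.
pose k := (#|large| + #|small|)%N.
have kle : k%:R <= c3 * z * N2.
  have cs' : #|small|%:R <= (2 * z + 14 * z / c1) * N2 / c2 by rewrite ler_pdivlMr // mulrC.
  rewrite /k natrD; apply: le_trans (lerD cl' cs') _.
  by rewrite le_eqVlt; apply/orP; left; apply/eqP; rewrite /c3; field; rewrite !gt_eqF.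
have few5 : (#|[set p : ipair n | #|L (val p).1 (val p).2| != 5%N]| <= k)%N.
  have -> : [set p : ipair n | #|L (val p).1 (val p).2| != 5%N] = large :|: small.
    by apply/setP => p; rewrite !inE; case: ltngtP.
  by rewrite cardsU leq_subr.
have nk : (2 * (n + 2 * k) <= n ^ 2)%N.
  rewrite -(ler_nat R) natrX -/N2 natrM natrD natrM.
  have h1 : n%:R * 16 <= N2 by rewrite /N2 expr2 ler_wpM2l.
  have h2 : z * (16 * c3) * N2 <= 1 * N2 by rewrite ler_wpM2r.
  move: N20 h1 h2 kle; clear; move: (n%:R : R) (k%:R : R) N2 => a b N2; lra.
have [C C5 cC] := majority_list n0 LC few5 nk.
have offle : #|off C phi|%:R <= delta * N2.
  pose D := [set p : 'I_n * 'I_n | L p.1 p.2 != C].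
  have h1 : (#|off C phi| <= #|unlisted L phi| + #|D|)%N.
    apply: (@leq_trans (#|unlisted L phi| + #|[set p : ipair n | val p \in D]|)%N).
      have -> : (#|unlisted L phi| + #|[set p : ipair n | val p \in D]|)%N =
        (#|unlisted L phi :|: [set p : ipair n | val p \in D]| +
         #|unlisted L phi :&: [set p : ipair n | val p \in D]|)%N by rewrite cardsUI.
      apply: leq_trans (leq_addr _ _); apply: subset_leq_card; apply/subsetP => p.
      by rewrite !inE => offp; case: eqVneq => [->|]; rewrite ?orbT ?offp.
    rewrite leq_add2l -(card_imset _ val_inj); apply: subset_leq_card.
    by apply/subsetP => _ /imsetP[p pD ->]; rewrite inE in pD.
  have h2 : #|D|%:R <= (4 * z + 24 * c3 * z) * N2.
    have N2p : 0 < N2 by rewrite exprn_gt0 // ltr0n.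
    rewrite -(ler_pM2r N2p).
    have : #|D|%:R * N2 <= 2 * (#|bad_quads L|%:R + 6 * n%:R ^+ 3 + 12 * (k%:R * N2)).
      by rewrite /N2 -!natrX -!natrM -!natrD -natrM ler_nat.
    have b1 : #|bad_quads L|%:R <= z * (N2 * N2).
      apply: le_trans fewbad _; have -> : n%:R ^+ 4 = N2 * N2 by rewrite /N2; ring.
      by rewrite ler_wpM2r ?mulr_ge0 // /beta ge_min lexx orbT.
    have b2 : 6 * n%:R ^+ 3 <= z * (N2 * N2).
      have -> : z * (N2 * N2) = z * n%:R * n%:R ^+ 3 by rewrite /N2; ring.
      by rewrite ler_wpM2r // exprn_ge0.
    have b3 : k%:R * N2 <= c3 * z * N2 * N2 by rewrite ler_wpM2r.
    move: b1 b2 b3; clear.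
    move: (n%:R ^+ 3 : R) (k%:R * N2) (#|bad_quads L|%:R : R) (#|D|%:R * N2) => x1 x2 x3 x4.
    lra.
  have : #|off C phi|%:R <= #|unlisted L phi|%:R + #|D|%:R :> R by rewrite -natrD ler_nat.
  have h3 : z * (5 + 24 * c3) * N2 <= delta * N2 by rewrite ler_wpM2r.
  move: h3 h2 few; rewrite -/N2; clear.
  move: (#|off C phi|%:R : R) (#|unlisted L phi|%:R : R) (#|D|%:R : R) => x1 x2 x3.
  lra.
by move: phiF; rewrite inE => /andP[_ /forallP/(_ C)]; rewrite C5 eqxx /= ltNge offle.
Qed.

End CrudeBounds.

(** * Extending colorings by one or two vertices *)

Section Extension.
Variable R : realType.
Variable q : nat.
Local Notation color := 'I_q.+1.
Local Notation Col n := (coloring q.+1 (complete_graph n)).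

(** A coloring is recovered from its restriction and the colors at the removed vertices.
    The lists may depend on the restriction, on the position s of the removed vertices
    and on a parameter i; W stores the colors between removed vertices. *)
Lemma card_extensions (m n : nat) (S T Z W : finType) (f : S -> 'I_m -> 'I_n)
  (ext : S -> Col n -> {ffun 'I_m -> Z} * W) (valid : T -> Col m -> bool)
  (A : T -> Col m -> 'I_m -> {set Z}) (t B : R) :
  (forall s, injective (f s)) ->
  (forall s phi psi, pullback (f s) phi = pullback (f s) psi ->
     ext s phi = ext s psi -> phi = psi) ->
  0 <= B ->
  (forall i phi, valid i phi ->
     #|[set g : {ffun 'I_m -> Z} | #|exceptions (A i phi) g|%:R <= t]|%:R <= B) ->
  #|[set phi in rfree q n | [exists s, exists i, valid i (pullback (f s) phi) &&
      (#|exceptions (A i (pullback (f s) phi)) (ext s phi).1|%:R <= t)]]|%:R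
    <= (#|S| * #|T| * #|W|)%:R * (#|rfree q m|%:R * B).
Proof.
move=> fI extI B0 hB.
pose E (p : S * T) := [set phi in rfree q n | valid p.2 (pullback (f p.1) phi) &&
  (#|exceptions (A p.2 (pullback (f p.1) phi)) (ext p.1 phi).1|%:R <= t)].
have cE p : #|E p|%:R <= #|W|%:R * (#|rfree q m|%:R * B).
  pose enc (phi : Col n) := (pullback (f p.1) phi, ext p.1 phi).
  have encI : injective enc by move=> phi psi [? ?]; apply: (extI p.1) => //.
  pose G phi := [set g : {ffun 'I_m -> Z} | #|exceptions (A p.2 phi) g|%:R <= t].
  pose P phi := (phi \in rfree q m) && valid p.2 phi.
  pose X := [set x : Col m * ({ffun 'I_m -> Z} * W) | P x.1 && (x.2.1 \in G x.1)].
  have sub : enc @: E p \subset X.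
    apply/subsetP => _ /imsetP[phi pE ->]; move: pE; rewrite [_ \in E p]inE.
    case/and3P=> pf pv pe; rewrite [_ \in X]inE /P /= pullback_rfree //= pv /=.
    by rewrite in_set.
  have cX : #|X| = (\sum_(phi | P phi) #|G phi| * #|W|)%N.
    rewrite -sum1_card (partition_big (fun x => x.1) P) /=; last first.
      by move=> x; rewrite inE => /andP[].
    apply: eq_bigr => phi Pphi; rewrite (reindex_onto (fun y => (phi, y)) snd) /=; last first.
      by move=> [x1 x2] /andP[_ /eqP /= ->].
    rewrite -[X in (_ * X)%N]cardsT -cardsX -sum1_card; apply: eq_bigl => -[g w].
    by rewrite in_setX !inE /= Pphi !eqxx !andbT.
  rewrite -(card_imset _ encI).
  apply: (@le_trans _ _ #|X|%:R); first by rewrite ler_nat subset_leq_card.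
  rewrite cX natr_sum.
  apply: (@le_trans _ _ (\sum_(phi in rfree q m) #|W|%:R * B)); last first.
    by rewrite sumr_const -[X in X <= _]mulr_natl mulrCA.
  rewrite big_mkcondr /=; apply: ler_sum => phi _; case: ifP => pv.
    by rewrite natrM mulrC ler_wpM2l // hB.
  by rewrite mulr_ge0.
apply: (@le_trans _ _ (\sum_(p : S * T) #|E p|%:R)).
  rewrite -natr_sum ler_nat.
  apply: (@leq_trans #|\bigcup_p E p|).
    apply: subset_leq_card; apply/subsetP => phi; rewrite inE.
    case/andP=> pf /existsP[s /existsP[i H]]; apply/bigcupP; exists (s, i) => //.
    by rewrite inE pf.
  elim/big_rec2: _ => [|p x S' _ IH]; first by rewrite cards0.
  apply: leq_trans (_ : _ <= #|E p| + #|S'|)%N _; first by rewrite cardsU leq_subr.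
  by rewrite leq_add2l.
apply: le_trans (ler_sum _ (fun p _ => cE p)) _.
by rewrite sumr_const card_prod -[X in X <= _]mulr_natl !natrM !mulrA.
Qed.

Definition star_colors n (v : 'I_n.+1) (phi : Col n.+1) : {ffun 'I_n -> color} :=
  [ffun x => col phi v (lift v x)].

Lemma star_colors_inj n (v : 'I_n.+1) (phi psi : Col n.+1) :
  pullback (lift v) phi = pullback (lift v) psi -> star_colors v phi = star_colors v psi -> phi = psi.
Proof.
move=> Ep /ffunP Ea.
have Ev b : b != v -> col phi v b = col psi v b.
  rewrite eq_sym => /unlift_some[b' -> _].
  by have := Ea b'; rewrite !ffunE.
apply: col_inj => a b ab.
have [av|av] := eqVneq a v; first by rewrite av Ev // -av eq_sym.
have [bv|bv] := eqVneq b v; first by rewrite bv !(colC _ a) Ev.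
move: av bv; rewrite eq_sym => /unlift_some[a' -> _]; rewrite eq_sym => /unlift_some[b' -> _].
by rewrite -!(col_pullback _ _ _ (@lift_inj _ v)) Ep.
Qed.

Definition lift2 n (p : 'I_n.+2 * 'I_n.+1) (x : 'I_n) : 'I_n.+2 := lift p.1 (lift p.2 x).

Lemma lift2_inj n (p : 'I_n.+2 * 'I_n.+1) : injective (lift2 p).
Proof. by move=> x y /lift_inj/lift_inj. Qed.

Definition star_colors2 n (p : 'I_n.+2 * 'I_n.+1) (phi : Col n.+2) :
    {ffun 'I_n -> color * color} * color :=
  ([ffun x => (col phi p.1 (lift2 p x), col phi (lift p.1 p.2) (lift2 p x))],
   col phi p.1 (lift p.1 p.2)).

Lemma star_colors2_inj n (p : 'I_n.+2 * 'I_n.+1) (phi psi : Col n.+2) :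
  pullback (lift2 p) phi = pullback (lift2 p) psi -> star_colors2 p phi = star_colors2 p psi -> phi = psi.
Proof.
move=> Ep [/ffunP Ea Ec]; case: p Ep Ea Ec => u v Ep Ea Ec.
apply: (@star_colors_inj _ u).
  apply: (@star_colors_inj _ v).
    apply: col_inj => a b _; rewrite !(col_pullback _ _ _ (@lift_inj _ _)).
    have := congr1 (fun phi => col phi a b) Ep.
    by rewrite !(col_pullback _ _ _ (@lift2_inj _ _)) => H;
      rewrite !(col_pullback _ _ _ (@lift_inj _ u)); apply: H.
  apply/ffunP => x; rewrite !ffunE !(col_pullback _ _ _ (@lift_inj _ u)).
  by have := Ea x; rewrite !ffunE => -[].
apply/ffunP => x; rewrite !ffunE.
have [->|] := eqVneq x v; first exact: Ec.
rewrite eq_sym => /unlift_some[y -> _].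
by have := Ea y; rewrite !ffunE => -[].
Qed.

End Extension.

(** * Local structure of colorings close to five colors *)

Section Structure.
Variable R : realType.
Variables q n : nat.
Local Notation color := 'I_q.+1.
Variables (phi : coloring q.+1 (complete_graph n)) (C : {set color}).
Variables G k h : R.

Definition cclass (v : 'I_n) (c : color) := [set x | (x != v) && (col phi v x == c)].
Definition outside (D : {set color}) (v : 'I_n) := [set x | (x != v) && (col phi v x \notin D)].

Lemma card_outside_le (D : {set color}) v (b : R) :
  (forall c, c \notin D -> #|cclass v c|%:R <= b) -> 0 <= b ->
  #|outside D v|%:R <= q.+1%:R * b.
Proof.
move=> H b0.
have -> : #|outside D v| = (\sum_(c | c \notin D) #|cclass v c|)%N.
  rewrite -sum1_card (partition_big (fun x => col phi v x) (fun c => c \notin D)) /=; last first.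
    by move=> x; rewrite inE => /andP[].
  apply: eq_bigr => c cD; rewrite -sum1_card; apply: eq_bigl => x; rewrite !inE.
  by case: (col phi v x =P c) => [->|]; rewrite ?cD ?andbT ?andbF.
rewrite natr_sum; apply: (@le_trans _ _ (\sum_(c : color) b)).
  rewrite [X in _ <= X](bigID (fun c => c \notin D)) /=; apply: ler_wpDr; first exact: sumr_ge0.
  by apply: ler_sum => c; apply: H.
by rewrite sumr_const card_ord -[X in X <= _]mulr_natl.
Qed.

(** Unless some vertex sees essentially two colors, every vertex has popular colors besides
    any two given ones. If a color c1 outside C is popular at u, take two further popular
    colors c2, c3 there and a typical c1-neighbor x of u: either x has a typical
    c2-neighbor y of u with a fourth color on xy, which gives the last pattern, or x is
    confined to three colors towards the c2-neighbors of u. If colors outside C are rare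
    at every vertex, the ends of the edge u0 v0 either nearly agree in their colors, or
    some y distinguishes them and serves as a pivot in the last pattern. *)
Lemma off_edge_structure (u0 v0 : 'I_n) :
  0 < h -> h <= G -> h <= k -> 2 * (q.+1%:R * h) <= k ->
  #|[set v | k < #|outside C v|%:R]|%:R < h ->
  u0 != v0 -> col phi u0 v0 \notin C ->
  [\/ exists v c1 c2, #|outside [set c1; c2] v|%:R <= q.+1%:R * G,
      exists v u, u != v /\
        #|[set x | [&& x != v, x != u & col phi v x != col phi u x]]|%:R <= k,
      exists v u c1 c2 c3, [/\ u != v, G <= #|cclass u c2|%:R &
        #|[set x | [&& x != v, x != u & col phi v x \notin
            (if col phi u x == c2 then [set c1; c2; c3] else C)]]|%:R <= 2 * k]
    | exists u v y c, [/\ uniq [:: u; v; y],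
        #|outside C u|%:R <= k /\ #|outside C v|%:R <= k,
        uniq [:: col phi u v; col phi u y; col phi v y; c],
        ~~ all (mem C) [:: col phi u v; col phi u y; col phi v y; c] &
        G <= #|cclass y c|%:R]].
Proof.
move=> h0 hG hk Kh nonlow uv0 off0.
have G0 : 0 <= G by apply: le_trans hG; apply: ltW.
have [/existsP[v /existsP[c1 /existsP[c2 H]]]|N1] := boolP [exists v, exists c1, exists c2,
    #|outside [set c1; c2] v|%:R <= q.+1%:R * G].
  by constructor 1; exists v, c1, c2.
have third v c1 c2 : exists c3, [/\ c3 != c1, c3 != c2 & G <= #|cclass v c3|%:R].
  have [/existsP[c3 /and3P[? ? ?]]|N] := boolP [exists c3, [&& c3 != c1, c3 != c2 & G <= #|cclass v c3|%:R]].
    by exists c3.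
  exfalso; move: N1; apply/negP/negPn; apply/existsP; exists v; apply/existsP; exists c1.
  apply/existsP; exists c2; apply: card_outside_le => // c; rewrite !inE negb_or => /andP[cc1 cc2].
  apply: ltW; rewrite ltNge; apply: contra N => H; apply/existsP; exists c.
  by rewrite cc1 cc2.
have [/existsP[u /existsP[c1 /andP[c1C big1]]]|N2] := boolP [exists u, exists c,
    (c \notin C) && (h <= #|cclass u c|%:R)].
  have [c2 [c21 _ big2]] := third u c1 c1.
  have [c3 [c31 c32 big3]] := third u c1 c2.
  have [x xc xlow] : exists2 x, x \in cclass u c1 & #|outside C x|%:R <= k.
    have [/existsP[x /andP[xc xl]]|N] := boolP [exists x, (x \in cclass u c1) && (#|outside C x|%:R <= k)].
      by exists x.
    have : (#|cclass u c1| <= #|[set v | (k < #|outside C v|%:R)%R]|)%N.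
      apply: subset_leq_card; apply/subsetP => x xc; rewrite inE ltNge.
      by apply: contra N => xl; apply/existsP; exists x; rewrite xc.
    by rewrite -(ler_nat R) => le; move: (lt_le_trans nonlow big1); rewrite ltNge le.
  move: xc; rewrite inE => /andP[xu /eqP cux].
  have [/existsP[y /and3P[]]|N] := boolP [exists y, [&& y \in cclass u c2,
      #|outside C y|%:R <= k & col phi x y \notin [set c1; c2; c3]]].
    rewrite inE => /andP[yu /eqP cuy] ylow; rewrite !inE !negb_or -andbA => /and3P[d1 d2 d3].
    have xy : x != y by apply: contraNneq c21 => E; rewrite -cuy -E cux.
    constructor 4; exists x, y, u, c3; rewrite (colC _ x u) (colC _ y u) cux cuy; split=> //.
    - by rewrite /= !inE !negb_or xy xu yu.
    - by rewrite /= !inE !negb_or d1 d2 d3 eq_sym c21 eq_sym c31 eq_sym c32.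
    - by rewrite /= [c1 \in C](negbTE c1C) andbF.
  constructor 3; exists x, u, c1, c2, c3; split=> //; first by rewrite eq_sym.
  set S := [set z | _].
  have : (#|S| <= #|outside C x| + #|[set v | (k < #|outside C v|%:R)%R]|)%N.
    apply: (@leq_trans #|outside C x :|: [set v | (k < #|outside C v|%:R)%R]|).
      apply: subset_leq_card; apply/subsetP => z; rewrite in_set => /and3P[zx zu].
      rewrite in_setU [z \in outside C x]inE zx /=.
      case: eqP => [cz|_] colz; last by rewrite colz.
      rewrite [X in _ || X]inE ltNge; apply/orP; right; apply: contra N => zl.
      by apply/existsP; exists z; rewrite zl colz inE zu cz eqxx.
    by rewrite cardsU leq_subr.
  by rewrite -(ler_nat R) natrD; move: xlow nonlow hk; clear; lra.
have small u c : c \notin C -> #|cclass u c|%:R <= h.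
  move=> cC; apply: ltW; rewrite ltNge; apply: contra N2 => H.
  by apply/existsP; exists u; apply/existsP; exists c; rewrite cC.
have out u : #|outside C u|%:R <= q.+1%:R * h.
  by apply: card_outside_le (ltW h0) => c; apply: small.
have Kh0 : 0 <= q.+1%:R * h by rewrite mulr_ge0 // ltW.
have [/existsP[y /and5P[yu yv cuv cu cv]]|N3] := boolP [exists y, [&& y != u0, y != v0,
    col phi u0 y != col phi v0 y, col phi u0 y \in C & col phi v0 y \in C]].
  have [c [cu' cv' big]] := third y (col phi u0 y) (col phi v0 y).
  have cC : c \in C.
    apply: contraNT N2 => cC; apply/existsP; exists y; apply/existsP; exists c.
    by rewrite cC (le_trans hG).
  constructor 4; exists u0, v0, y, c; split=> //.
  - by rewrite /= !inE !negb_or uv0 eq_sym yu eq_sym yv.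
  - by have := out u0; have := out v0; move: Kh Kh0; clear; split; lra.
  - have ne d : d \in C -> col phi u0 v0 != d by move=> dC; apply: contraNneq off0 => ->.
    by rewrite /= !inE !negb_or !ne // cuv ![col phi _ y == c]eq_sym cu' cv'.
  - by rewrite /= [col phi u0 v0 \in C](negbTE off0).
constructor 2; exists v0, u0; split=> //.
set S := [set x | _].
have : (#|S| <= #|outside C u0| + #|outside C v0|)%N.
  apply: (@leq_trans #|outside C u0 :|: outside C v0|).
    apply: subset_leq_card; apply/subsetP => z; rewrite in_set => /and3P[zv zu ne].
    rewrite !inE zu zv /= -negb_and; apply: contra N3 => /andP[c1 c2].
    by apply/existsP; exists z; rewrite zu zv eq_sym ne c1 c2.
  by rewrite cardsU leq_subr.
rewrite -(ler_nat R) natrD; have := out u0; have := out v0.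
by move: Kh Kh0; clear; lra.
Qed.

End Structure.

(** * Counting the local patterns *)

Section Counting.
Variable R : realType.
Variable q : nat.
Local Notation color := 'I_q.+1.
Local Notation Col n := (coloring q.+1 (complete_graph n)).

(** The conclusion of [exceptions_gain] for fixed constants, shared by the counts below. *)
Definition gains (gamma kappa c : R) (N : nat) := forall (I Z : finType) (b : R)
  (A : I -> {set Z}), (#|Z| <= N)%N -> 2 <= b -> (forall i, #|A i|%:R <= b) ->
    gamma * #|I|%:R <= #|[set i | #|A i|%:R <= 23 / 25 * b]|%:R ->
    #|[set g | #|exceptions A g|%:R <= kappa * #|I|%:R]|%:R
      <= b ^+ #|I| * expR (- (c * #|I|%:R)).

Lemma gains_count gamma kappa c N (I Z : finType) (b t : R) (A : I -> {set Z}) :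
  gains gamma kappa c N -> (#|Z| <= N)%N -> 2 <= b -> (forall i, #|A i|%:R <= b) ->
  gamma * #|I|%:R <= #|[set i | #|A i|%:R <= 23 / 25 * b]|%:R -> t <= kappa * #|I|%:R ->
  #|[set g | #|exceptions A g|%:R <= t]|%:R <= b ^+ #|I| * expR (- (c * #|I|%:R)).
Proof.
move=> gn ZN b2 Ab Asm tk; apply: le_trans (gn I Z b A ZN b2 Ab Asm).
rewrite ler_nat; apply: subset_leq_card; apply/subsetP => g; rewrite !inE => H.
exact: le_trans tk.
Qed.

Lemma card_lift n (v : 'I_n.+1) (P : pred 'I_n.+1) :
  #|[set x : 'I_n | P (lift v x)]| = #|[set y | (y != v) && P y]|.
Proof.
rewrite -(card_imset _ (@lift_inj _ v)); apply: eq_card => y; rewrite inE.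
apply/imsetP/andP => [[x]|[yv Py]].
  by rewrite inE => Px ->; rewrite eq_sym neq_lift.
move: yv; rewrite eq_sym => /unlift_some[x E _]; exists x => //.
by rewrite inE -E.
Qed.

Lemma card_lift2 n (p : 'I_n.+2 * 'I_n.+1) (P : pred 'I_n.+2) :
  #|[set x : 'I_n | P (lift2 p x)]| =
    #|[set y | [&& y != p.1, y != lift p.1 p.2 & P y]]|.
Proof.
rewrite -[LHS]/(#|[set x : 'I_n | (fun z => P (lift p.1 z)) (lift p.2 x)]|) card_lift.
rewrite -(card_imset _ (@lift_inj _ p.1)); apply: eq_card => y; rewrite inE.
apply/imsetP/and3P => [[x]|[y1 y2 Py]].
  by rewrite inE => /andP[xp Px ->]; rewrite eq_sym neq_lift (inj_eq (@lift_inj _ p.1)).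
move: y1; rewrite eq_sym => /unlift_some[x E _]; exists x => //.
by rewrite inE -E Py andbT -(inj_eq (@lift_inj _ p.1)) -E.
Qed.

Lemma card_set1U_le (T : finType) (P : pred T) (a : T) :
  (#|[set x | P x]| <= #|[set x | (x != a) && P x]|.+1)%N.
Proof.
apply: (@leq_trans #|a |: [set x | (x != a) && P x]|).
  by apply: subset_leq_card; apply/subsetP => x; rewrite !inE => ->; rewrite andbT orbN.
by rewrite cardsU1 -add1n leq_add2r; case: (_ \notin _).
Qed.

(** Each of the next four counts removes the special vertices of one pattern of
    [off_edge_structure] and lists the colors that the pattern allows at them. Here the
    lists have two colors. *)
Lemma count_two_colored n (kappa c t : R) : gains 1 kappa c q.+1 -> t <= kappa * n%:R ->
  #|[set phi in rfree q n.+1 | [exists v, [exists c1, [exists c2,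
      #|outside phi [set c1; c2] v|%:R <= t]]]]|%:R
   <= (n.+1 * q.+1 ^ 2)%:R * (#|rfree q n|%:R * (5 ^+ n * expR (- (c * n%:R)))).
Proof.
move=> gn tk.
have B0 : 0 <= 5 ^+ n * expR (- (c * n%:R)) :> R by rewrite mulr_ge0 ?expR_ge0 ?exprn_ge0.
pose A (i : color * color) (_ : Col n) (_ : 'I_n) := [set i.1; i.2].
have := @card_extensions R q n n.+1 'I_n.+1 (color * color)%type color unit (fun v => lift v)
  (fun v phi => (star_colors v phi, tt)) (fun _ _ => true) A t _ (fun v => @lift_inj _ v) _ B0.
rewrite !card_prod !card_ord card_unit muln1 => H.
apply: le_trans (H _ _); last 1 first.
- move=> i phi' _; have := @gains_count 1 kappa c q.+1 'I_n color 5 t (A i phi') gn.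
  rewrite !card_ord => H'; apply: H' => //.
  + by rewrite (ler_nat _ 2 5).
  + by move=> x; rewrite (ler_nat _ _ 5) cards2; case: (_ != _).
  + rewrite mul1r ler_nat -[X in (X <= _)%N]card_ord -cardsT subset_leq_card //.
    apply/subsetP => x _; rewrite inE; apply: (@le_trans _ _ 2); last lra.
    by rewrite (ler_nat _ _ 2) cards2; case: (_ != _).
- rewrite ler_nat; apply: subset_leq_card; apply/subsetP => phi; rewrite !inE.
  case/andP=> -> /existsP[v /existsP[c1 /existsP[c2 out]]] /=.
  apply/existsP; exists v; apply/existsP; exists (c1, c2) => /=.
  apply: le_trans out; rewrite ler_nat /outside -card_lift.
  by apply: subset_leq_card; apply/subsetP => x; rewrite !inE ffunE.
- by move=> v phi psi Ep [Ea]; apply: star_colors_inj Ep Ea.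
Qed.

(** The colors at v repeat those at u, so the lists are singletons. The edge uv itself
    accounts for one extra exception. *)
Lemma count_twins n (gamma kappa c t : R) : gains gamma kappa c q.+1 -> gamma <= 1 ->
  t + 1 <= kappa * n%:R ->
  #|[set phi in rfree q n.+1 | [exists v, [exists u, (u != v) &&
      (#|[set x | [&& x != v, x != u & col phi v x != col phi u x]]|%:R <= t)]]]|%:R
   <= (n.+1 * n)%:R * (#|rfree q n|%:R * (5 ^+ n * expR (- (c * n%:R)))).
Proof.
move=> gn g1 tk.
have B0 : 0 <= 5 ^+ n * expR (- (c * n%:R)) :> R by rewrite mulr_ge0 ?expR_ge0 ?exprn_ge0.
pose A (i : 'I_n) (psi : Col n) (x : 'I_n) := [set col psi i x].
have := @card_extensions R q n n.+1 'I_n.+1 'I_n color unit (fun v => lift v)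
  (fun v phi => (star_colors v phi, tt)) (fun _ _ => true) A (t + 1) _ (fun v => @lift_inj _ v) _ B0.
rewrite !card_ord card_unit muln1 => H.
apply: le_trans (H _ _); last 1 first.
- move=> i phi' _; have := @gains_count gamma kappa c q.+1 'I_n color 5 (t + 1) (A i phi') gn.
  rewrite !card_ord => H'; apply: H' => //.
  + by rewrite (ler_nat _ 2 5).
  + by move=> x; rewrite (ler_nat _ _ 5) cards1.
  + rewrite (_ : [set _ | _] = setT) ?cardsT ?card_ord ?ler_piMl //.
    by apply/setP => x; rewrite !inE cards1; apply/idP; lra.
- rewrite ler_nat; apply: subset_leq_card; apply/subsetP => phi; rewrite !inE.
  case/andP=> -> /existsP[v /existsP[u /andP[uv out]]] /=.
  apply/existsP; exists v.
  have vu : v != u by rewrite eq_sym.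
  have [u' uE _] := unlift_some vu.
  apply/existsP; exists u' => /=.
  apply: (@le_trans _ _ #|[set x | [&& x != v, x != u & col phi v x != col phi u x]]|.+1%:R).
    rewrite ler_nat.
    have := card_lift v (fun x => (x != u) && (col phi v x != col phi u x)) => <-.
    have := card_set1U_le (fun x : 'I_n => col phi v (lift v x) != col phi u (lift v x)) u'.
    have -> : [set x | (x != u') && (col phi v (lift v x) != col phi u (lift v x))] =
       [set x | (lift v x != u) && (col phi v (lift v x) != col phi u (lift v x))].
      by apply/setP => x; rewrite !inE uE (inj_eq (@lift_inj _ v)).
    apply: leq_trans; apply: subset_leq_card; apply/subsetP => x.
    by rewrite !inE ffunE (col_pullback _ _ _ (@lift_inj _ v)) uE.
  by rewrite -natr1 lerD2r.
- by move=> v phi psi Ep [Ea]; apply: star_colors_inj Ep Ea.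
Qed.

(** The lists have three colors at the many c2-neighbors of u, and are C elsewhere. *)
Lemma count_three_colored n (C : {set color}) (gamma kappa c G t : R) :
  gains gamma kappa c q.+1 -> #|C| = 5%N ->
  gamma * n%:R + 1 <= G -> t + 1 <= kappa * n%:R ->
  #|[set phi in rfree q n.+1 | [exists v, [exists u, [exists c1, [exists c2, [exists c3,
      [&& u != v, G <= #|cclass phi u c2|%:R &
       #|[set x | [&& x != v, x != u & col phi v x \notin
            (if col phi u x == c2 then [set c1; c2; c3] else C)]]|%:R <= t]]]]]]]|%:R
   <= (n.+1 * (n * q.+1 ^ 3))%:R * (#|rfree q n|%:R * (5 ^+ n * expR (- (c * n%:R)))).
Proof.
move=> gn C5 gG tk.
have B0 : 0 <= 5 ^+ n * expR (- (c * n%:R)) :> R by rewrite mulr_ge0 ?expR_ge0 ?exprn_ge0.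
pose T := ('I_n * (color * (color * color)))%type.
pose A (i : T) (psi : Col n) (x : 'I_n) :=
  if col psi i.1 x == i.2.2.1 then [set i.2.1; i.2.2.1; i.2.2.2] else C.
pose valid (i : T) (psi : Col n) :=
  gamma * n%:R <= #|[set x | col psi i.1 x == i.2.2.1]|%:R.
have := @card_extensions R q n n.+1 'I_n.+1 T color unit (fun v => lift v)
  (fun v phi => (star_colors v phi, tt)) valid A (t + 1) _ (fun v => @lift_inj _ v) _ B0.
rewrite !card_prod !card_ord card_unit muln1 => H.
have c3le (a b d : color) : (#|[set a; b; d]| <= 3)%N.
  rewrite setUC cardsU1; case: (_ \notin _); rewrite ?add0n ?add1n cards2; by case: (_ != _).
apply: le_trans (H _ _); last 1 first.
- move=> i phi' val; have := @gains_count gamma kappa c q.+1 'I_n color 5 (t + 1) (A i phi') gn.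
  rewrite !card_ord => H'; apply: H' => //.
  + by rewrite (ler_nat _ 2 5).
  + move=> x; rewrite (ler_nat _ _ 5) /A; case: ifP => _; last by rewrite C5.
    exact: leq_trans (c3le _ _ _) _.
  + apply: le_trans val _; rewrite ler_nat; apply: subset_leq_card; apply/subsetP => x.
    rewrite !inE /A => ->; apply: (@le_trans _ _ 3); last lra.
    by rewrite (ler_nat _ _ 3).
- rewrite ler_nat; apply: subset_leq_card; apply/subsetP => phi; rewrite !inE.
  case/andP=> -> /existsP[v /existsP[u /existsP[c1 /existsP[c2 /existsP[c3]]]]].
  case/and3P=> uv big out /=.
  apply/existsP; exists v.
  have vu : v != u by rewrite eq_sym.
  have [u' uE _] := unlift_some vu.
  apply/existsP; exists (u', (c1, (c2, c3))) => /=; apply/andP; split.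
    rewrite /valid /=; have : G <= #|[set x | col phi u (lift v x) == c2]|%:R + 1.
      apply: le_trans big _; rewrite natr1 ler_nat.
      have := card_lift v (fun x => col phi u x == c2) => ->.
      apply: leq_trans (card_set1U_le _ v); apply: subset_leq_card; apply/subsetP => x.
      by rewrite !inE => /andP[].
    have -> : [set x | col (pullback (lift v) phi) u' x == c2] =
       [set x | col phi u (lift v x) == c2].
      by apply/setP => x; rewrite !inE (col_pullback _ _ _ (@lift_inj _ v)) uE.
    by move: gG; clear; lra.
  pose P x := col phi v x \notin (if col phi u x == c2 then [set c1; c2; c3] else C).
  apply: (@le_trans _ _ #|[set x | [&& x != v, x != u & P x]]|.+1%:R).
    rewrite ler_nat.
    have := card_lift v (fun x => (x != u) && P x) => <-.
    have := card_set1U_le (fun x : 'I_n => P (lift v x)) u'.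
    have -> : [set x | (x != u') && P (lift v x)] = [set x | (lift v x != u) && P (lift v x)].
      by apply/setP => x; rewrite !inE uE (inj_eq (@lift_inj _ v)).
    apply: leq_trans; apply: subset_leq_card; apply/subsetP => x.
    by rewrite !inE ffunE /A /= (col_pullback _ _ _ (@lift_inj _ v)) /P uE.
  by rewrite -natr1 lerD2r.
- by move=> v phi psi Ep [Ea]; apply: star_colors_inj Ep Ea.
Qed.

(** As s contains a color outside C, two colors d, e of C are not in s; the pairs (d, e)
    and (e, d) are lost. *)
Lemma card_avoid_uniq (C : {set color}) (s : seq color) : #|C| = 5%N -> size s = 4%N ->
  uniq s -> ~~ all (mem C) s ->
  (#|[set p : color * color | [&& p.1 \in C, p.2 \in C & ~~ uniq (p.1 :: p.2 :: s)]]| <= 23)%N.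
Proof.
move=> C5 s4 us; rewrite -has_predC => /hasP[a sa /= aC].
have cs : #|[set x in s]| = 4%N by rewrite cardsE (card_uniqP us).
have c3 : (#|C :&: [set x in s]| <= 3)%N.
  rewrite -ltnS -cs; apply: proper_card; apply/properP; split; first exact: subsetIr.
  by exists a; rewrite !inE ?sa // andbT.
have : (1 < #|C :\: [set x in s]|)%N.
  by rewrite -(ltn_add2l #|C :&: [set x in s]|) cardsID C5 addn1 ltnS.
case/card_gt1P => d [e [dD eD de]].
move: dD eD; rewrite !inE => /andP[ds dC] /andP[es eC].
have := cardsX C C; rewrite C5 (cardsD1 (d, e)) in_setX dC eC.
rewrite (cardsD1 (e, d)) !inE /= dC eC xpair_eqE eq_sym (negbTE de) /= => cc.
apply: (@leq_trans #|setX C C :\ (d, e) :\ (e, d)|); last first.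
  by rewrite -[23%N]/(5 * 5 - 2)%N -cc !add1n !subSS subn0.
apply: subset_leq_card; apply/subsetP => -[x y]; rewrite !inE /= => /and3P[-> -> /negP nu].
rewrite !andbT; apply/andP; split; apply/eqP => -[xE yE]; apply: nu.
  by rewrite xE yE negb_or eq_sym de es ds us.
by rewrite xE yE negb_or de es ds us.
Qed.

Lemma perm_pivot (T : eqType) (a b d e f g : T) :
  perm_eq [:: f; g; a; b; e; d] [:: a; b; f; e; g; d].
Proof. by apply/permP => z /=; lia. Qed.

(** A pivot y whose edges to u and v, together with uv and the popular color d at y,
    use four colors not all in C: two colors of C are left, so the pairs of colors
    at (u, v) omit two of the 25 possibilities towards every d-neighbor of y. *)
Lemma count_pivot n (C : {set color}) (gamma kappa c G t : R) :
  gains gamma kappa c (q.+1 * q.+1) -> #|C| = 5%N ->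
  gamma * n%:R + 2 <= G -> t + t + 1 <= kappa * n%:R ->
  #|[set phi in rfree q n.+2 | [exists u, [exists v, [exists y, [exists d,
      [&& uniq [:: u; v; y], #|outside phi C u|%:R <= t, #|outside phi C v|%:R <= t,
        uniq [:: col phi u v; col phi u y; col phi v y; d],
        ~~ all (mem C) [:: col phi u v; col phi u y; col phi v y; d] &
        G <= #|cclass phi y d|%:R]]]]]]|%:R
   <= (n.+2 * n.+1 * (n * q.+1 ^ 4) * q.+1)%:R *
        (#|rfree q n|%:R * (25 ^+ n * expR (- (c * n%:R)))).
Proof.
move=> gn C5 gG tk.
have B0 : 0 <= 25 ^+ n * expR (- (c * n%:R)) :> R by rewrite mulr_ge0 ?expR_ge0 ?exprn_ge0.
pose T := ('I_n * (color * (color * (color * color))))%type.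
pose ds (i : T) := [:: i.2.1; i.2.2.1; i.2.2.2.1; i.2.2.2.2].
pose A (i : T) (psi : Col n) (x : 'I_n) := [set p : color * color |
  [&& p.1 \in C, p.2 \in C &
    (col psi i.1 x == i.2.2.2.2) ==> ~~ uniq (p.1 :: p.2 :: ds i)]].
pose valid (i : T) (psi : Col n) := [&& uniq (ds i), ~~ all (mem C) (ds i) &
  gamma * n%:R <= #|[set x | col psi i.1 x == i.2.2.2.2]|%:R].
have := @card_extensions R q n n.+2 ('I_n.+2 * 'I_n.+1)%type T (color * color)%type color
  (@lift2 n) (@star_colors2 q n) valid A (t + t + 1) _ (@lift2_inj n) (@star_colors2_inj q n) B0.
rewrite !card_prod !card_ord => H.
apply: le_trans (H _); last first.
- move=> i psi /and3P[us ns big].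
  have := @gains_count gamma kappa c (q.+1 * q.+1) 'I_n (color * color)%type 25 (t + t + 1) (A i psi) gn.
  rewrite !card_prod !card_ord => H'; apply: H' => //.
  + by rewrite (ler_nat _ 2 25).
  + move=> x; rewrite (ler_nat _ _ 25).
    apply: (@leq_trans #|setX C C|); last by rewrite cardsX C5.
    apply: subset_leq_card; apply/subsetP => -[a b].
    by rewrite !inE /= => /and3P[-> ->].
  + apply: le_trans big _; rewrite ler_nat; apply: subset_leq_card; apply/subsetP => x.
    rewrite !inE => xd; apply: (@le_trans _ _ 23); last lra.
    rewrite (ler_nat _ _ 23) /A xd /=.
    exact: card_avoid_uniq.
- rewrite ler_nat; apply: subset_leq_card; apply/subsetP => phi; rewrite in_set.
  case/andP=> pf /existsP[u /existsP[v /existsP[y /existsP[d]]]].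
  case/and5P=> U lowu lowv us /andP[ns big].
  have [uv uy vy] : [/\ u != v, u != y & v != y].
    by move: U; rewrite /= !inE negb_or -!andbA => /and4P[].
  have [v' vE _] := unlift_some uv.
  have [y1 yE1 _] := unlift_some uy.
  have [y' yE _] : {j | y1 = lift v' j & unlift v' y1 = Some j}.
    by apply: unlift_some; rewrite -(inj_eq (@lift_inj _ u)) -vE -yE1.
  have yE' : lift2 (u, v') y' = y by rewrite /lift2 /= -yE -yE1.
  rewrite in_set pf; apply/existsP; exists (u, v').
  apply/existsP; exists (y', (col phi u v, (col phi u y, (col phi v y, d)))).
  apply/andP; split.
    apply/and3P; split; [exact: us | exact: ns | rewrite /=].
    have : G <= #|[set x | col phi y (lift2 (u, v') x) == d]|%:R + 2.
      apply: le_trans big _; rewrite -[2]/(2%:R) -natrD ler_nat.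
      have := card_lift2 (u, v') (fun x => col phi y x == d) => ->.
      rewrite addn2; apply: (@leq_trans #|[set x | col phi y x == d]|).
        by apply: subset_leq_card; apply/subsetP => x; rewrite !inE => /andP[].
      apply: leq_trans (card_set1U_le _ u) _; rewrite ltnS.
      apply: leq_trans (card_set1U_le _ (lift u v')) _; rewrite ltnS.
      by apply: subset_leq_card; apply/subsetP => x; rewrite !inE andbCA.
    have -> : [set x | col (pullback (lift2 (u, v')) phi) y' x == d] =
       [set x | col phi y (lift2 (u, v') x) == d].
      by apply/setP => x; rewrite !inE (col_pullback _ _ _ (@lift2_inj _ _)) yE'.
    by move: gG; clear; lra.
  apply: (@le_trans _ _ (#|outside phi C u| + #|outside phi C v|).+1%:R); last first.
    by rewrite -natr1 natrD lerD2r; apply: lerD.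
  rewrite ler_nat; apply: leq_trans (card_set1U_le _ y') _; rewrite ltnS.
  apply: (@leq_trans #|[set x | (fun z => (col phi u z \notin C) || (col phi v z \notin C))
      (lift2 (u, v') x)]|).
    apply: subset_leq_card; apply/subsetP => x; rewrite in_set => /andP[xy xA].
    rewrite in_set -negb_and; apply: contra xA => /andP[xu xv].
    rewrite in_set ffunE /= -vE xu xv /=.
    apply/implyP; rewrite (col_pullback _ _ _ (@lift2_inj _ _)) yE' => /eqP yx.
    have U4 : uniq [:: u; v; y; lift2 (u, v') x].
      rewrite -[X in uniq X]/(rcons [:: u; v; y] (lift2 (u, v') x)) rcons_uniq U andbT.
      rewrite !inE !negb_or [lift2 _ _ == u]eq_sym neq_lift /= vE (inj_eq (@lift_inj _ u)).
      rewrite [_ == v']eq_sym neq_lift /= -yE' /lift2 /=.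
      by rewrite !(inj_eq (@lift_inj _ _)).
    have := rfree_k4 pf U4; rewrite /k4colors /= /pcol /= yx.
    set a := col phi u v; set b := col phi u y; set e := col phi v y.
    set f := col phi u _; set g := col phi v _.
    move=> nu; apply: contra nu.
    have pe := perm_pivot a b d e f g.
    by move=> U6; have : uniq [:: f; g; a; b; e; d] := U6; rewrite (perm_uniq pe).
  have := card_lift2 (u, v') (fun z => (col phi u z \notin C) || (col phi v z \notin C)) => ->.
  apply: (@leq_trans #|outside phi C u :|: outside phi C v|); last by rewrite cardsU leq_subr.
  apply: subset_leq_card; apply/subsetP => x; rewrite !inE /= -vE => /and3P[-> ->].
  by rewrite !andTb.
Qed.

End Counting.

(** * Colorings that are close to five colors but use more *)

Section UpperBound.
Variable R : realType.
Variable q : nat.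
Local Notation color := 'I_q.+1.
Local Notation Col n := (coloring q.+1 (complete_graph n)).

Lemma sum_outside n (phi : Col n) (C : {set color}) :
  \sum_v #|outside phi C v|%:R = 2 * #|off C phi|%:R :> R.
Proof.
have hC u v : (col phi u v \notin C)%:R = (col phi v u \notin C)%:R :> R by rewrite colC.
have := sum_ipair hC; rewrite -[RHS]mulr_natl.
have -> : \sum_(p : ipair n) (col phi (val p).1 (val p).2 \notin C)%:R = #|off C phi|%:R :> R.
  rewrite -sum1_card natr_sum [RHS]big_mkcond /=; apply: eq_bigr => p _.
  by rewrite inE /pcol; case: (_ \notin _).
move=> <-; apply: eq_bigr => u _.
rewrite -sum1_card natr_sum [LHS]big_mkcond [RHS]big_mkcond /=; apply: eq_bigr => v _.
by rewrite inE; case: (v != u); case: (_ \notin _).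
Qed.

Lemma card_nonlow n (phi : Col n) (C : {set color}) (k h : R) : 0 < k ->
  2 * #|off C phi|%:R < h * k ->
  #|[set v | k < #|outside phi C v|%:R]|%:R < h.
Proof.
move=> k0 H; rewrite -(ltr_pM2r k0); apply: le_lt_trans H; rewrite -sum_outside.
rewrite mulr_natl -sumr_const [X in X <= _]big_mkcond; apply: ler_sum => v _.
by rewrite inE; case: ifP => // /ltW.
Qed.

Definition has_off_edge n (phi : Col n) (C : {set color}) :=
  [exists u, [exists v, (u != v) && (col phi u v \notin C)]].

Definition near n (delta : R) := [set phi in rfree q n | [exists C : {set color},
  [&& #|C| == 5%N, #|off C phi|%:R <= delta * n%:R ^+ 2 & has_off_edge phi C]]].

(** The four patterns of [off_edge_structure] cover these colorings, and each of them
    loses an exponential factor compared with all extensions by five colors. *)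
Theorem near_bound : exists2 delta : R, 0 < delta & exists2 c : R, 0 < c &
  exists D n0 : nat, forall n, (n0 <= n)%N ->
  #|near n.+2 delta|%:R <= (D * n.+2 ^ 3)%:R * expR (- (c * n%:R)) *
    (5 ^+ n.+1 * #|rfree q n.+1|%:R + 25 ^+ n * #|rfree q n|%:R).
Proof.
set K : R := q.+1%:R; have K1 : 1 <= K by rewrite /K ler1n.
have K0 : 0 < K by lra.
have [k1 k10 [c1 c10 gain1]] := exceptions_gain q.+1 (ltr01 : 0 < 1 :> R).
(* A two-colored vertex gains on all its edges, which fixes the threshold g for popular
   colors; the other patterns gain on a proportion g / 2 only, and their exceptions must
   be few in comparison. *)
pose g := Num.min 1 (k1 / K).
have g0 : 0 < g by rewrite lt_min ltr01 divr_gt0.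
have g1 : g <= 1 by rewrite ge_min lexx.
have gK : K * g <= k1 by rewrite mulrC -ler_pdivlMr // ge_min lexx orbT.
have g20 : 0 < g / 2 by lra.
have [k2 k20 [c2 c20 gain2]] := exceptions_gain (q.+1 * q.+1) g20.
have gain2' : gains (g / 2) k2 c2 q.+1.
  by move=> I Z b A ZN; apply: gain2; apply: leq_trans ZN _; rewrite leq_pmulr.
pose h := Num.min g (k2 / (6 * K)).
have h0 : 0 < h by rewrite lt_min g0 divr_gt0 // mulr_gt0.
have hg : h <= g by rewrite ge_min lexx.
have hk : h * (6 * K) <= k2 by rewrite -ler_pdivlMr ?mulr_gt0 // ge_min lexx orbT.
have hk3 : h <= k2 / 3.
  have : h * 1 <= h * K by rewrite ler_wpM2l // ltW.
  by move: hk k20; clear; lra.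
pose delta := h * k2 / 25.
have d0 : 0 < delta by rewrite divr_gt0 // mulr_gt0.
exists delta => //.
pose c := Num.min c1 c2; have c0 : 0 < c by rewrite lt_min c10.
exists c => //.
exists (#|{: {set color}}| * (4 * q.+1 ^ 5))%N.
exists (maxn 2 (maxn (Num.bound (6 / g)) (Num.bound (3 / k2)))) => n.
rewrite !geq_max => /and3P[n2 ng nk].
have N2 : 2 <= n%:R :> R by rewrite (ler_nat _ 2).
have N0 : 0 < n%:R :> R by lra.
have ng' : 6 <= g * n%:R.
  rewrite mulrC -ler_pdivrMr //.
  have h' : 0 <= 6 / g by rewrite divr_ge0 // ltW.
  by apply: le_trans (ltW (archi_boundP h')) _; rewrite ler_nat.
have nk' : 3 <= k2 * n%:R.
  rewrite mulrC -ler_pdivrMr //.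
  have h' : 0 <= 3 / k2 by rewrite divr_ge0 // ltW.
  by apply: le_trans (ltW (archi_boundP h')) _; rewrite ler_nat.
pose G := g * n%:R; pose k := k2 / 3 * n%:R.
have nS : n.+1%:R = n%:R + 1 :> R by rewrite natr1.
pose E1 := [set phi in rfree q n.+2 | [exists v, [exists a1, [exists a2,
      #|outside phi [set a1; a2] v|%:R <= K * G]]]].
pose E2 := [set phi in rfree q n.+2 | [exists v, [exists u, (u != v) &&
      (#|[set x | [&& x != v, x != u & col phi v x != col phi u x]]|%:R <= k)]]].
pose E3 (C : {set color}) := [set phi in rfree q n.+2 | [exists v, [exists u, [exists a1, [exists a2, [exists a3,
      [&& u != v, G <= #|cclass phi u a2|%:R &
       #|[set x | [&& x != v, x != u & col phi v x \notin
            (if col phi u x == a2 then [set a1; a2; a3] else C)]]|%:R <= 2 * k]]]]]]].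
pose E4 (C : {set color}) := [set phi in rfree q n.+2 | [exists u, [exists v, [exists y, [exists d,
      [&& uniq [:: u; v; y], #|outside phi C u|%:R <= k, #|outside phi C v|%:R <= k,
        uniq [:: col phi u v; col phi u y; col phi v y; d],
        ~~ all (mem C) [:: col phi u v; col phi u y; col phi v y; d] &
        G <= #|cclass phi y d|%:R]]]]]].
pose X := expR (- (c * n%:R)) * (5 ^+ n.+1 * #|rfree q n.+1|%:R).
pose Y := expR (- (c * n%:R)) * (25 ^+ n * #|rfree q n|%:R).
pose P : R := (q.+1 ^ 5 * n.+2 ^ 3)%:R.
have X0 : 0 <= X by rewrite mulr_ge0 ?expR_ge0 // mulr_ge0 // exprn_ge0.
have Y0 : 0 <= Y by rewrite mulr_ge0 ?expR_ge0 // mulr_ge0 // exprn_ge0.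
have expc (a : R) m : c <= a -> (n <= m)%N -> expR (- (a * m%:R)) <= expR (- (c * n%:R)).
  move=> ca nm; rewrite ler_expR lerN2; apply: ler_pM => //; first exact: ltW.
  by rewrite ler_nat.
have toX (a : R) (p : nat) (b : R) : c <= a -> (p <= q.+1 ^ 5 * n.+2 ^ 3)%N ->
   b <= p%:R * (#|rfree q n.+1|%:R * (5 ^+ n.+1 * expR (- (a * n.+1%:R)))) -> b <= P * X.
  move=> ca pP; move/le_trans; apply.
  apply: ler_pM => //; first by rewrite mulr_ge0 // mulr_ge0 ?expR_ge0 // exprn_ge0.
    by rewrite ler_nat.
  rewrite mulrA mulrC /X [5 ^+ _ * _]mulrC ler_wpM2r //; last exact: expc.
  by rewrite mulr_ge0 // exprn_ge0.
have Kpow a b : (a <= b)%N -> (q.+1 ^ a <= q.+1 ^ b)%N by move=> ab; rewrite leq_pexp2l.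
have n3 : (n.+2 * n.+1 * n <= n.+2 ^ 3)%N.
  by rewrite expnSr -mulnn; apply: leq_mul; [apply: leq_mul | apply: leqW].
have n21 : (n.+2 <= n.+2 ^ 3)%N by rewrite -[X in (X <= _)%N]expn1 leq_pexp2l.
have n22 : (n.+2 * n.+1 <= n.+2 ^ 3)%N.
  by apply: (@leq_trans (n.+2 ^ 2)); [rewrite -mulnn leq_mul | rewrite leq_pexp2l].
have cc1 : c <= c1 by rewrite ge_min lexx.
have cc2 : c <= c2 by rewrite ge_min lexx orbT.
have b1 : #|E1|%:R <= P * X.
  apply: (toX c1 (n.+2 * q.+1 ^ 2)%N) => //; first by rewrite mulnC leq_mul // Kpow.
  apply: count_two_colored gain1 _; rewrite nS.
  have : K * g * n%:R <= k1 * n%:R by rewrite ler_wpM2r // ltW.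
  by rewrite /G mulrA; move: k10; clear; lra.
have b2 : #|E2|%:R <= P * X.
  apply: (toX c2 (n.+2 * n.+1)%N) => //.
    by apply: leq_trans n22 _; rewrite leq_pmull // expn_gt0.
  apply: count_twins gain2' _ _; first by move: g1 g0; clear; lra.
  by rewrite /k nS; move: nk' k20; clear; lra.
have b3 (C : {set color}) : #|C| = 5%N -> #|E3 C|%:R <= P * X.
  move=> C5; apply: (toX c2 (n.+2 * (n.+1 * q.+1 ^ 3))%N) => //.
    by rewrite mulnA mulnC leq_mul // Kpow.
  apply: count_three_colored gain2' C5 _ _; rewrite nS.
    by rewrite /G; move: ng' g1 g0; clear; lra.
  by rewrite /k; move: nk' k20; clear; lra.
have b4 (C : {set color}) : #|C| = 5%N -> #|E4 C|%:R <= P * Y.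
  move=> C5; apply: le_trans (_ : _ <= (n.+2 * n.+1 * (n * q.+1 ^ 4) * q.+1)%:R *
        (#|rfree q n|%:R * (25 ^+ n * expR (- (c2 * n%:R))))) _.
    apply: count_pivot gain2 C5 _ _.
      by rewrite /G; move: ng' g1 g0; clear; lra.
    by rewrite /k; move: nk' k20; clear; lra.
  apply: ler_pM => //; first by rewrite mulr_ge0 // mulr_ge0 ?expR_ge0 // exprn_ge0.
    rewrite ler_nat [X in (X <= _)%N](_ : _ = q.+1 ^ 5 * (n.+2 * n.+1 * n))%N; last first.
      by rewrite [(q.+1 ^ 5)%N]expnS; move: (q.+1 ^ 4)%N q.+1 n.+2 n.+1 => a b d e; ring.
    by rewrite leq_mul2l n3 orbT.
  rewrite mulrA mulrC /Y [25 ^+ _ * _]mulrC ler_wpM2r //; last exact: expc.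
  by rewrite mulr_ge0 // exprn_ge0.
have cover (C : {set color}) phi : #|C| == 5%N -> phi \in rfree q n.+2 ->
   #|off C phi|%:R <= delta * n.+2%:R ^+ 2 -> has_off_edge phi C ->
   phi \in E1 :|: E2 :|: E3 C :|: E4 C.
  move=> /eqP C5 pf close /existsP[u0 /existsP[v0 /andP[uv off0]]].
  have k0 : 0 < k by rewrite mulr_gt0 // divr_gt0.
  have nonlow : #|[set v | k < #|outside phi C v|%:R]|%:R < h * n%:R.
    apply: card_nonlow k0 _.
    have h1 : delta * n.+2%:R ^+ 2 <= delta * (2 * n%:R) ^+ 2.
      rewrite ler_wpM2l ?(ltW d0) // ler_pXn2r ?nnegrE ?mulr_ge0 //.
      by rewrite -natrM ler_nat; move: n2; clear; lia.
    apply: le_lt_trans (ler_wpM2l _ (le_trans close h1)) _ => //.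
    have -> : 2 * (delta * (2 * n%:R) ^+ 2) = 24 / 25 * (h * k2 / 3 * n%:R ^+ 2) by rewrite /delta; field.
    have -> : h * n%:R * k = h * k2 / 3 * n%:R ^+ 2 by rewrite /k; ring.
    have : 0 < h * k2 / 3 * n%:R ^+ 2 by rewrite mulr_gt0 ?exprn_gt0 // divr_gt0 // mulr_gt0.
    by clear; move: (h * k2 / 3 * _) => z; lra.
  have hn0 : 0 < h * n%:R by rewrite mulr_gt0.
  have hG : h * n%:R <= G by rewrite ler_wpM2r // ltW.
  have hk' : h * n%:R <= k by rewrite /k ler_wpM2r // ltW.
  have Kh : 2 * (q.+1%:R * (h * n%:R)) <= k.
    have : h * (6 * K) * n%:R <= k2 * n%:R by rewrite ler_wpM2r // ltW.
    by rewrite -/K /k; clear; lra.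
  have [[v [a1 [a2 H]]]|[v [u [ne H]]]|[v [u [a1 [a2 [a3 [ne H1 H2]]]]]]
       |[u [v [y [d [H1 [H2 H3] H4 H5 H6]]]]]] :=
    off_edge_structure hn0 hG hk' Kh nonlow uv off0.
  - rewrite !in_setU [_ \in E1]inE pf; apply/orP; left; apply/orP; left; apply/orP; left.
    by apply/existsP; exists v; apply/existsP; exists a1; apply/existsP; exists a2.
  - rewrite !in_setU [_ \in E2]inE pf; apply/orP; left; apply/orP; left; apply/orP; right.
    by apply/existsP; exists v; apply/existsP; exists u; rewrite ne.
  - rewrite !in_setU [_ \in E3 C]inE pf; apply/orP; left; apply/orP; right.
    apply/existsP; exists v; apply/existsP; exists u; apply/existsP; exists a1.
    by apply/existsP; exists a2; apply/existsP; exists a3; rewrite ne H1 H2.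
  - rewrite !in_setU [_ \in E4 C]inE pf; apply/orP; right.
    apply/existsP; exists u; apply/existsP; exists v; apply/existsP; exists y.
    by apply/existsP; exists d; apply/and5P; split=> //; apply/andP.
have PX0 : 0 <= P * X by rewrite mulr_ge0.
have PY0 : 0 <= P * Y by rewrite mulr_ge0.
pose U (C : {set color}) := if #|C| == 5%N then E1 :|: E2 :|: E3 C :|: E4 C else set0.
have cU C : #|U C|%:R <= 4 * (P * X + P * Y).
  rewrite /U; case: eqP => [C5|_]; last by rewrite cards0; move: PX0 PY0; clear; lra.
  have U2 (A B : {set Col n.+2}) : #|A :|: B|%:R <= #|A|%:R + #|B|%:R :> R.
    by rewrite -natrD ler_nat cardsU leq_subr.
  have := U2 (E1 :|: E2 :|: E3 C) (E4 C); have := U2 (E1 :|: E2) (E3 C); have := U2 E1 E2.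
  have := b4 C C5; have := b3 C C5; move: b1 b2 PX0 PY0; clear.
  move: (#|E1 :|: E2 :|: E3 C :|: E4 C|%:R : R) (#|E1 :|: E2 :|: E3 C|%:R : R).
  move: (#|E1 :|: E2|%:R : R) (#|E1|%:R : R) (#|E2|%:R : R) (#|E3 C|%:R : R) (#|E4 C|%:R : R).
  by move: (P * X) (P * Y) => *; lra.
have : (#|near n.+2 delta| <= \sum_C #|U C|)%N.
  apply: (@leq_trans #|\bigcup_C U C|).
    apply: subset_leq_card; apply/subsetP => phi; rewrite inE.
    case/andP=> pf /existsP[C /and3P[C5 close off]]; apply/bigcupP; exists C => //.
    by rewrite /U C5; apply: cover.
  elim/big_rec2: _ => [|C x S' _ IH]; first by rewrite cards0.
  apply: (@leq_trans (#|U C| + #|S'|)%N); first by rewrite cardsU leq_subr.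
  by rewrite leq_add2l.
rewrite -(ler_nat R) natr_sum => /le_trans; apply.
apply: le_trans (ler_sum _ (fun C _ => cU C)) _.
rewrite sumr_const -[X in X <= _]mulr_natl !natrM.
rewrite le_eqVlt; apply/orP; left; apply/eqP; rewrite /P /X /Y natrM.
by move: (expR _) (#|{: {set color}}|%:R : R) (25 ^+ n) (5 ^+ n.+1) => *; ring.
Qed.

End UpperBound.

(** * The recursion for at most 24 colors *)

Section Recursion.
Variable R : realType.

Lemma vanish_exp (c e : R) : 0 < c -> 0 < e ->
  exists n0, forall n, (n0 <= n)%N -> n%:R ^+ 3 * expR (- (c * n%:R)) <= e.
Proof.
move=> c0 e0.
have B0 : 0 <= 24 / (c ^+ 4 * e) by rewrite divr_ge0 // mulr_ge0 ?exprn_ge0 ?ltW.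
exists (maxn 1 (Num.bound (24 / (c ^+ 4 * e)))) => n; rewrite geq_max => /andP[n1 nb].
have N0 : 0 < n%:R :> R by rewrite ltr0n.
have cn0 : 0 <= c * n%:R by rewrite mulr_ge0 // ltW.
have big : 24 <= c ^+ 4 * e * n%:R.
  rewrite mulrC -ler_pdivrMr ?mulr_gt0 ?exprn_gt0 //.
  by apply: le_trans (ltW (archi_boundP B0)) _; rewrite ler_nat.
have := expR_ge1Dxn 3 cn0; rewrite -[(4`!)%:R]/(24%:R) => ex.
rewrite expRN -[X in X <= _]/(_ / _) ler_pdivrMr ?expR_gt0 //.
apply: le_trans (_ : e * (1 + (c * n%:R) ^+ 4 / 24) <= _); last by rewrite ler_wpM2l // ltW.
have N3 : 0 < n%:R ^+ 3 :> R by rewrite exprn_gt0.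
have : n%:R ^+ 3 * 24 <= n%:R ^+ 3 * (c ^+ 4 * e * n%:R) by rewrite ler_wpM2l // ltW.
have -> : n%:R ^+ 3 * (c ^+ 4 * e * n%:R) = e * (c * n%:R) ^+ 4 by ring.
by move: ((c * n%:R) ^+ 4) (n%:R ^+ 3) e0 => x y; lra.
Qed.

(** As long as t <= 1 / 4 the sequence stays bounded; then the feedback term tends to 0. *)
Lemma recursion_limsup (r t : nat -> R) (A : R) (n1 : nat) : 0 <= A ->
  (forall n, 0 <= r n) ->
  (forall e, 0 < e -> exists n0, forall n, (n0 <= n)%N -> t n <= e) ->
  (forall n, (n1 <= n)%N -> r n.+2 <= A + t n * (1 + r n.+1 + r n)) ->
  forall e, 0 < e -> exists n0, forall n, (n0 <= n)%N -> r n <= A + e.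
Proof.
move=> A0 r0 t0 rec e e0.
have [n2 tq] := t0 (1 / 4) ltac:(lra).
pose m := maxn n1 n2; pose K := 2 * A + 1 + r m + r m.+1.
have K0 : 0 < K by rewrite /K; have := r0 m; have := r0 m.+1; lra.
have bd n : (m <= n)%N -> r n <= K /\ r n.+1 <= K.
  elim: n => [|n IH].
    by rewrite leqn0 => /eqP E; rewrite /K E; have := r0 0%N; have := r0 1%N; split; lra.
  rewrite leq_eqVlt => /predU1P[<-|mn].
    split; first by rewrite /K; have := r0 m; have := r0 m.+1; lra.
    have [n1m n2m] : (n1 <= m)%N /\ (n2 <= m)%N by rewrite leq_maxl leq_maxr.
    have := rec m n1m; have := tq m n2m; have := r0 m; have := r0 m.+1.
    rewrite /K; move: (r m) (r m.+1) (r m.+2) (t m) => a b d s *.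
    have : s * (1 + b + a) <= 1 / 4 * (1 + b + a) by rewrite ler_wpM2r //; lra.
    lra.
  have [H1 H2] := IH mn; split=> //.
  have [n1m n2m] : (n1 <= n)%N /\ (n2 <= n)%N.
    by move: mn; rewrite ltnS geq_max => /andP[].
  have := rec n n1m; have := tq n n2m; have := r0 n; have := r0 n.+1; have := r0 m; have := r0 m.+1.
  move: H1 H2; rewrite /K; move: (r m) (r m.+1) (r n) (r n.+1) (r n.+2) (t n) => a b x y z s *.
  have : s * (1 + y + x) <= 1 / 4 * (1 + y + x) by rewrite ler_wpM2r //; lra.
  lra.
have e1 : 0 < e / (1 + 2 * K) by rewrite divr_gt0 //; lra.
have [n3 te] := t0 _ e1.
exists (maxn m n3).+2 => -[|[|n]] //; rewrite !ltnS geq_max => /andP[mn n3n].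
have [H1 H2] := bd n mn.
have n1n : (n1 <= n)%N by apply: leq_trans mn; rewrite leq_maxl.
apply: le_trans (rec n n1n) _; rewrite lerD2l.
have S0 : 0 <= 1 + r n.+1 + r n by have := r0 n; have := r0 n.+1; lra.
apply: le_trans (ler_wpM2r S0 (te n n3n)) _.
rewrite mulrAC ler_pdivrMr; last lra.
by rewrite ler_wpM2l ?(ltW e0) //; lra.
Qed.

End Recursion.

Section FiveColors.
Variable R : realType.
Variable q : nat.
Local Notation color := 'I_q.+1.
Local Notation Col n := (coloring q.+1 (complete_graph n)).

Definition colored_in n (C : {set color}) := [set phi : Col n | [forall e, phi e \in C]].

Lemma card_colored_in n (C : {set color}) : #|colored_in n C| = (#|C| ^ 'C(n, 2))%N.
Proof.
rewrite -card_edge -card_ffun_on; apply: eq_card => phi; rewrite inE.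
by apply/forallP/ffun_onP.
Qed.

Lemma colored_inP n (C : {set color}) (phi : Col n) :
  reflect (forall u v, u != v -> col phi u v \in C) (phi \in colored_in n C).
Proof.
rewrite inE; apply: (iffP forallP) => [H u v uv|H e].
  by rewrite (colE _ (edgeP uv)).
by have [u [v [uv ->]]] := edge_col q e; apply: H.
Qed.

(** A coloring uses at most five colors, or is far from every set of five colors, or is
    close to one and leaves it on some edge. Divided by 5 ^ 'C(n, 2), the last two counts
    give a recursion with vanishing feedback. *)
Theorem five_color_upper (eps : R) : (q.+1 <= 24)%N -> 0 < eps ->
  exists n0, forall n, (n0 <= n)%N ->
  #|rfree q n|%:R <= ('C(q.+1, 5)%:R + eps) * 5 ^+ 'C(n, 2) :> R.
Proof.
move=> r24 eps0.
have [delta d0 [c c0 [D [n1 nearb]]]] := near_bound R q.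
have [zeta z0 [n2 farb]] := far_bound r24 d0.
pose r n : R := #|rfree q n|%:R / 5 ^+ 'C(n, 2).
have p5 m : 0 < 5 ^+ m :> R by rewrite exprn_gt0.
pose t n : R := expR (- (zeta * n.+2%:R ^+ 2)) + (D * n.+2 ^ 3)%:R * expR (- (c * n%:R)).
have t0 e : 0 < e -> exists n0, forall n, (n0 <= n)%N -> t n <= e.
  move=> e0.
  have e1 : 0 < e / 2 by lra.
  have [m1 v1] := vanish_exp z0 e1.
  have e2 : 0 < e / 2 / (D.+1%:R * expR (2 * c)).
    by rewrite divr_gt0 // mulr_gt0 ?expR_gt0 // ltr0n.
  have [m2 v2] := vanish_exp c0 e2.
  exists (maxn m1 m2) => n; rewrite geq_max => /andP[h1 h2].
  have N1 : 1 <= n.+2%:R :> R by rewrite ler1n.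
  have a1 : expR (- (zeta * n.+2%:R ^+ 2)) <= e / 2.
    apply: le_trans (v1 n.+2 (leq_trans h1 _)); last by rewrite ltnW // ltnW.
    apply: (@le_trans _ _ (expR (- (zeta * n.+2%:R)))).
      by rewrite ler_expR lerN2 ler_wpM2l ?(ltW z0) // expr2 ler_peMl.
    by rewrite ler_peMl ?expR_ge0 // exprn_ege1.
  have a2 : (D * n.+2 ^ 3)%:R * expR (- (c * n%:R)) <= e / 2.
    have := v2 n.+2 (leq_trans h2 (ltnW (ltnW (leqnn _)))).
    rewrite ler_pdivlMr; last by rewrite mulr_gt0 ?expR_gt0 // ltr0n.
    have -> : expR (- (c * n.+2%:R)) = expR (- (c * n%:R)) / expR (2 * c).
      by rewrite -expRN -expRD -[n.+2]addn2 natrD; congr expR; ring.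
    have x0 : expR (2 * c) != 0 by rewrite gt_eqF ?expR_gt0.
    have -> : n.+2%:R ^+ 3 * (expR (- (c * n%:R)) / expR (2 * c)) * (D.+1%:R * expR (2 * c)) =
      D.+1%:R * n.+2%:R ^+ 3 * expR (- (c * n%:R)) by field.
    apply: le_trans; rewrite ler_wpM2r ?expR_ge0 // -natrX -natrM ler_nat.
    by rewrite leq_mul2r leqnSn orbT.
  by rewrite /t; lra.
have rec n : (maxn n1 n2 <= n)%N -> r n.+2 <= 'C(q.+1, 5)%:R + t n * (1 + r n.+1 + r n).
  rewrite geq_max => /andP[h1 h2].
  have cover : rfree q n.+2 \subset
      \bigcup_(C : {set color} | #|C| == 5%N) colored_in n.+2 C
      :|: [set phi in rfree q n.+2 | [forall C : {set color}, (#|C| == 5%N) ==>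
       (delta * n.+2%:R ^+ 2 < #|off C phi|%:R)]] :|: near q n.+2 delta.
    apply/subsetP => phi pf; rewrite !in_setU.
    rewrite [X in _ || X || _]inE pf /=.
    have [far|] := boolP [forall C : {set color}, (#|C| == 5%N) ==>
       (delta * n.+2%:R ^+ 2 < #|off C phi|%:R)]; first by rewrite orbT.
    rewrite negb_forall => /existsP[C]; rewrite negb_imply -leNgt => /andP[C5 close].
    have [in5|out] := boolP (phi \in colored_in n.+2 C).
      by rewrite orbF; apply/orP; left; apply/bigcupP; exists C.
    apply/orP; right; rewrite inE pf; apply/existsP; exists C; rewrite C5 close /=.
    apply: contraNT out => no; apply/colored_inP => u v uv.
    by apply: contraNT no => offC; apply/existsP; exists u; apply/existsP; exists v; rewrite uv.
  have cfive : (#|\bigcup_(C : {set color} | #|C| == 5%N) colored_in n.+2 C| <=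
      'C(q.+1, 5) * 5 ^ 'C(n.+2, 2))%N.
    have -> : 'C(q.+1, 5) = #|[set C : {set color} | #|C| == 5%N]| by rewrite card_draws card_ord.
    have -> : (#|[set C : {set color} | #|C| == 5%N]| * 5 ^ 'C(n.+2, 2) =
        \sum_(C : {set color} | #|C| == 5%N) 5 ^ 'C(n.+2, 2))%N.
      by rewrite -sum_nat_const; apply: eq_bigl => C; rewrite inE.
    elim/big_rec2: _ => [|C x S' C5 IH]; first by rewrite cards0.
    apply: (@leq_trans (#|colored_in n.+2 C| + #|S'|)%N); first by rewrite cardsU leq_subr.
    by rewrite card_colored_in (eqP C5) leq_add2l.
  have U2 (A B : {set Col n.+2}) : #|A :|: B|%:R <= #|A|%:R + #|B|%:R :> R.
    by rewrite -natrD ler_nat cardsU leq_subr.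
  have := farb n.+2 (leq_trans h2 (ltnW (ltnW (leqnn _)))).
  set Far := [set phi in _ | _] in cover * => cFar.
  have cNear := nearb n h1.
  have le1 : #|rfree q n.+2|%:R <=
      ('C(q.+1, 5) * 5 ^ 'C(n.+2, 2))%:R + #|Far|%:R + #|near q n.+2 delta|%:R :> R.
    apply: (@le_trans _ _ #|\bigcup_(C : {set color} | #|C| == 5%N) colored_in n.+2 C
      :|: Far :|: near q n.+2 delta|%:R); first by rewrite ler_nat subset_leq_card.
    apply: le_trans (U2 _ _) _; rewrite lerD2r; apply: le_trans (U2 _ _) _.
    by rewrite lerD2r ler_nat.
  rewrite {1}/r ler_pdivrMr //; apply: le_trans le1 _.
  rewrite natrM natrX.
  have eN1 : 5 ^+ 'C(n.+2, 2) = 5 ^+ 'C(n.+1, 2) * 5 ^+ n.+1 :> R by rewrite binS bin1 exprD.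
  have eN0 : 5 ^+ 'C(n.+1, 2) = 5 ^+ 'C(n, 2) * 5 ^+ n :> R by rewrite binS bin1 exprD.
  have E1 : 5 ^+ n.+1 * #|rfree q n.+1|%:R = r n.+1 * 5 ^+ 'C(n.+2, 2).
    rewrite /r eN1 mulrA divfK ?gt_eqF //; exact: mulrC.
  have E2 : 25 ^+ n * #|rfree q n|%:R <= r n * 5 ^+ 'C(n.+2, 2).
    rewrite eN1 eN0 /r !mulrA divfK ?gt_eqF // -mulrA mulrC ler_wpM2l //.
    have -> : 25 = 5 * 5 :> R by ring.
    by rewrite exprMn exprS ler_wpM2l ?exprn_ge0 // ler_peMl ?exprn_ge0 //; lra.
  set M := 5 ^+ 'C(n.+2, 2) in cFar E1 E2 *.
  have M0 : 0 <= M by rewrite exprn_ge0.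
  set p := (D * n.+2 ^ 3)%:R * _ in cNear.
  have pp0 : 0 <= p by rewrite mulr_ge0 ?expR_ge0.
  have x0 : 0 <= expR (- (zeta * n.+2%:R ^+ 2)) by exact: expR_ge0.
  rewrite E1 in cNear; rewrite /t -/p.
  have le2 : p * (r n.+1 * M + 25 ^+ n * #|rfree q n|%:R) <= p * (r n.+1 * M + r n * M).
    by rewrite ler_wpM2l // lerD2l.
  have r1 : 0 <= r n.+1 by rewrite divr_ge0 // exprn_ge0.
  have r2 : 0 <= r n by rewrite divr_ge0 // exprn_ge0.
  set x := expR _ in cFar x0 *.
  have xM : 0 <= x * M * (r n.+1 + r n) by rewrite mulr_ge0 ?addr_ge0 // mulr_ge0.
  have pM : 0 <= p * M by rewrite mulr_ge0.
  move: cFar cNear le2 xM pM.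
  by move: (#|Far|%:R : R) (#|near q n.+2 delta|%:R : R) (r n.+1) (r n) => a b y z; lra.
have r0 n : 0 <= r n by rewrite divr_ge0 // exprn_ge0.
have [n0 H] := recursion_limsup (ler0n _ _) r0 t0 rec eps0.
exists n0 => n nn0; rewrite -ler_pdivrMr //; exact: H.
Qed.

End FiveColors.

(** * Lower bounds *)

Section LowerBounds.
Variable R : realType.
Variable q : nat.
Local Notation color := 'I_q.+1.
Local Notation Col n := (coloring q.+1 (complete_graph n)).

(** A rainbow copy of K_4 has six colors. *)
Lemma colored_in_rfree n (C : {set color}) : (#|C| <= 5)%N ->
  colored_in n C \subset rfree q n.
Proof.
move=> C5; apply/subsetP => phi /colored_inP pC.
rewrite inE; apply/rainbow_freeP => x y u v U; apply/negP => /card_uniqP E.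
have : (#|k4colors phi x y u v| <= #|C|)%N.
  apply: subset_leq_card; apply/subsetP => c /mapP[p pk ->].
  by apply: pC; apply: (allP (k4edges_neq U)).
by rewrite E /= leqNgt; move/negP; apply; apply: leq_ltn_trans C5 _.
Qed.

Lemma rho_rfree n : rho q.+1 4 (complete_graph n) = #|rfree q n|.
Proof. by []. Qed.

Lemma rho_few_colors n : (q.+1 <= 5)%N ->
  rho q.+1 4 (complete_graph n) = (q.+1 ^ 'C(n, 2))%N.
Proof.
move=> r5; have C5 : (#|[set: color]| <= 5)%N by rewrite cardsT card_ord.
rewrite rho_rfree; have -> : rfree q n = colored_in n [set: color].
  apply/eqP; rewrite eqEsubset colored_in_rfree // andbT.
  by apply/subsetP => phi _; rewrite inE; apply/forallP => e; rewrite inE.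
by rewrite card_colored_in cardsT card_ord.
Qed.

(** A coloring with colors in C that misses the color c of C has its colors in C minus c. *)
Lemma card_exactly_five n (C : {set color}) : #|C| = 5%N ->
  (5 ^ 'C(n, 2) <= #|[set phi in rfree q n | [set phi e | e : edge (complete_graph n)] == C]|
     + 5 * 4 ^ 'C(n, 2))%N.
Proof.
move=> C5; set X := [set phi in _ | _].
have sub : colored_in n C \subset X :|: \bigcup_(c in C) colored_in n (C :\ c).
  apply/subsetP => phi pC.
  have pf : phi \in rfree q n by apply: (subsetP (colored_in_rfree n _)) pC; rewrite C5.
  rewrite in_setU; have [//|no] := boolP (phi \in X); apply/bigcupP.
  have im : [set phi e | e : edge (complete_graph n)] \subset C.
    by apply/subsetP => _ /imsetP[e _ ->]; move: pC; rewrite inE => /forallP.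
  have /subsetPn[c cC cim] : ~~ (C \subset [set phi e | e : edge (complete_graph n)]).
    by apply: contra no => sub; rewrite inE pf eqEsubset im.
  exists c => //; rewrite inE; apply/forallP => e; rewrite !inE.
  have -> : phi e \in C by apply: (subsetP im); apply: imset_f.
  by rewrite andbT; apply: contraNneq cim => <-; apply: imset_f.
have := subset_leq_card sub; rewrite card_colored_in C5 => /leq_trans; apply.
apply: (@leq_trans (#|X| + #|\bigcup_(c in C) colored_in n (C :\ c)|)%N).
  by rewrite cardsU leq_subr.
rewrite leq_add2l -C5 -sum_nat_const.
elim/big_rec2: _ => [|c x S' cC IH]; first by rewrite cards0.
apply: (@leq_trans (#|colored_in n (C :\ c)| + #|S'|)%N); first by rewrite cardsU leq_subr.
apply: leq_add => //; rewrite card_colored_in.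
by have := cardsD1 c C; rewrite cC C5 add1n => -[<-].
Qed.

Lemma five_color_lower (eps : R) : 0 < eps ->
  exists n0, forall n, (n0 <= n)%N ->
  ('C(q.+1, 5)%:R - eps) * 5 ^+ 'C(n, 2) <= #|rfree q n|%:R :> R.
Proof.
move=> eps0; set B : R := 'C(q.+1, 5)%:R.
have B0 : 0 <= B by [].
have h0 : 0 <= 20 * B / eps by rewrite divr_ge0 ?mulr_ge0 // ltW.
exists (maxn 3 (Num.bound (20 * B / eps))) => n; rewrite geq_max => /andP[n3 nb].
set N := 'C(n, 2).
have nN : (n <= N)%N.
  by rewrite /N bin2 -divn2 leq_divRL // leq_mul2l; move: n3; lia.
have count : ('C(q.+1, 5) * 5 ^ N <= #|rfree q n| + 'C(q.+1, 5) * (5 * 4 ^ N))%N.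
  have -> : 'C(q.+1, 5) = #|[set C : {set color} | #|C| == 5%N]| by rewrite card_draws card_ord.
  rewrite -!sum_nat_const.
  apply: (@leq_trans (\sum_(C in [set C : {set color} | #|C| == 5%N])
    (#|[set phi in rfree q n | [set phi e | e : edge (complete_graph n)] == C]| + 5 * 4 ^ N))%N).
    by apply: leq_sum => C; rewrite inE => /eqP; apply: card_exactly_five.
  rewrite big_split leq_add2r /=.
  rewrite -[X in (_ <= X)%N]sum1_card
    (partition_big (fun phi : Col n => [set phi e | e : edge (complete_graph n)]) xpredT) //=.
  rewrite [X in (_ <= X)%N](bigID (mem [set C : {set color} | #|C| == 5%N])) /=.
  apply: leq_trans (leq_addr _ _); apply: leq_sum => C _.
  by rewrite -sum1_card; apply: eq_leq; apply: eq_bigl => phi; rewrite inE.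
have bern : N%:R / 4 * 4 ^+ N <= 5 ^+ N :> R.
  elim: (N) => [|m IH]; first by rewrite !expr0 -[0%:R]/(0 : R); lra.
  rewrite !exprS -natr1.
  have : 4 ^+ m <= 5 ^+ m :> R by apply: lerXn2r; rewrite ?nnegrE ?ler_nat.
  move: IH; lra.
move: count; rewrite -(ler_nat R) natrD !natrM !natrX -/B => count.
have nbig : 20 * B <= eps * N%:R.
  rewrite -ler_pdivrMl // mulrC; apply: le_trans (ltW (archi_boundP h0)) _.
  by rewrite ler_nat; apply: leq_trans nN.
have P4 : 0 <= 4 ^+ N :> R by rewrite exprn_ge0.
have h1 : 20 * B * 4 ^+ N <= eps * N%:R * 4 ^+ N by rewrite ler_wpM2r.
have h2 : eps * (N%:R / 4 * 4 ^+ N) <= eps * 5 ^+ N by rewrite ler_wpM2l // ltW.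
move: count h1 h2; clear; move: (4 ^+ N) (5 ^+ N) (N%:R : R) (#|_|%:R : R) => a b d e; lra.
Qed.

(** One fixed color inside A and inside its complement, arbitrary colors across, except
    that a double star with centers a in A and b outside A avoids the fixed color: its
    edges connect all vertices, so they determine the two sides. *)
Definition bipartite_colorings n (A : {set 'I_n}) : {set Col n} :=
  [set phi | [forall x, forall y, ((x \in A) == (y \in A)) ==> (col phi x y == ord0)] &&
    [exists a in A, exists b in ~: A,
      [forall y in ~: A, col phi a y != ord0] && [forall x in A, col phi x b != ord0]]].

Lemma bipartite_rfree n (A : {set 'I_n}) : bipartite_colorings A \subset rfree q n.
Proof.
apply/subsetP => phi; rewrite inE => /andP[/forallP same _].
have same' x y : (x \in A) = (y \in A) -> col phi x y = ord0.
  by move=> E; have /forallP/(_ y) := same x; rewrite E eqxx => /eqP.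
rewrite inE; apply/rainbow_freeP => x y u v U.
(* Among four vertices on two sides, at least two pairs lie on one side. *)
have [sxy sxu sxv] := And3 (@same' x y) (@same' x u) (@same' x v).
have [syu syv suv] := And3 (@same' y u) (@same' y v) (@same' u v).
rewrite /k4colors /= /pcol /= !inE.
by case: (x \in A) sxy sxu sxv => sxy sxu sxv; case: (y \in A) sxy syu syv => sxy syu syv;
  case: (u \in A) sxu syu suv => sxu syu suv; case: (v \in A) sxv syv suv => sxv syv suv;
  rewrite ?(sxy erefl) ?(sxu erefl) ?(sxv erefl) ?(syu erefl) ?(syv erefl) ?(suv erefl)
    !eqxx ?orbT ?andbF.
Qed.

(** All edges of the double star of A cross A'; starting from a, this decides for every
    vertex on which side of A' it lies. *)
Lemma bipartite_sides n (A A' : {set 'I_n}) phi :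
  phi \in bipartite_colorings A -> phi \in bipartite_colorings A' -> A' = A \/ A' = ~: A.
Proof.
rewrite inE => /andP[_ /existsP[a /andP[aA /existsP[b /andP[bA /andP[/forall_inP sa /forall_inP sb]]]]]].
rewrite inE => /andP[/forallP same _].
have differ x y : col phi x y != ord0 -> (x \in A') != (y \in A').
  by have /forallP/(_ y) := same x; case: eqP => // _ /eqP ->; rewrite eqxx.
have out y : y \notin A -> (a \in A') != (y \in A').
  by move=> yA; apply: differ; apply: sa; rewrite inE.
have inn x : x \in A -> (x \in A') = (a \in A').
  move=> xA; have := differ _ _ (sb x xA); have := out b; rewrite -in_setC => /(_ bA).
  by case: (x \in A'); case: (a \in A'); case: (b \in A').
have [aA'|aA'] := boolP (a \in A'); [left|right]; apply/setP => x; rewrite ?inE.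
  have [xA|xA] := boolP (x \in A); first by rewrite inn.
  by have := out x xA; rewrite aA'; case: (x \in A').
have [xA|xA] := boolP (x \in A); first by rewrite inn // (negbTE aA').
by have := out x xA; rewrite (negbTE aA'); case: (x \in A').
Qed.

(** A crossing edge has q + 1 choices, or the proportion 1 - 1 / (q + 1) of them if it is
    one of the n - 1 edges of the double star. *)
Lemma card_bipartite n (A : {set 'I_n}) : A != set0 -> ~: A != set0 ->
  (1 - 1 / q.+1%:R) ^+ (n - 1) * q.+1%:R ^+ (#|A| * #|~: A|) <=
    #|bipartite_colorings A|%:R :> R.
Proof.
move=> /set0Pn[a aA] /set0Pn[b bA].
pose E := edge (complete_graph n).
pose cross := [set [set x; y] | x in A, y in ~: A].
pose tree := [set [set a; y] | y in ~: A] :|: [set [set x; b] | x in A].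
pose F (e : E) : {set color} := if val e \in tree then ~: [set ord0]
  else if val e \in cross then setT else [set ord0].
have aE y : y \in ~: A -> a != y by move=> yA; apply: contraTneq yA => <-; rewrite inE aA.
have bE x : x \in A -> x != b by move=> xA; apply: contraTneq bA => <-; rewrite inE xA.
have tree_cross : tree \subset cross.
  apply/subsetP => s /setUP[] /imsetP[x xA ->]; apply/imset2P; first by exists a x.
  by exists x b.
have crossP x y : [set x; y] \in cross -> (x \in A) != (y \in A).
  case/imset2P => p r pA; rewrite inE => rA EE.
  have := set21 x y; have := set22 x y; rewrite EE !inE.
  have pr : p != r by apply: contraNneq rA => <-.
  case/orP => /eqP Ey; case/orP => /eqP Ex; rewrite Ex Ey ?pA ?(negbTE rA) //.
    by have := set22 p r; rewrite -EE Ex Ey !inE orbb eq_sym (negbTE pr).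
  by have := set21 p r; rewrite -EE Ex Ey !inE orbb (negbTE pr).
have sub : [set phi : Col n | [forall e, phi e \in F e]] \subset bipartite_colorings A.
  apply/subsetP => phi; rewrite inE => /forallP pF; rewrite inE; apply/andP; split.
    apply/forallP => x; apply/forallP => y; apply/implyP => /eqP same.
    have [->|xy] := eqVneq x y; first by rewrite coluu.
    rewrite (colE _ (edgeP xy)).
    have := pF (exist (fun e => e \in edges (complete_graph n)) [set x; y] (edgeP xy)).
    have nc : [set x; y] \notin cross by apply: contraL (introT eqP same); apply: crossP.
    rewrite /F /= (negbTE nc) (negbTE (contra (subsetP tree_cross _) nc)).
    by rewrite inE.
  apply/existsP; exists a; rewrite aA; apply/existsP; exists b; rewrite bA /=.
  apply/andP; split; apply/forall_inP => x xA.
    rewrite (colE _ (edgeP (aE x xA))).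
    have := pF (exist (fun e => e \in edges (complete_graph n)) [set a; x] (edgeP (aE x xA))).
    have tx : [set a; x] \in tree by apply/setUP; left; apply: imset_f.
    by rewrite /F /= tx !inE.
  rewrite (colE _ (edgeP (bE x xA))).
  have := pF (exist (fun e => e \in edges (complete_graph n)) [set x; b] (edgeP (bE x xA))).
  have tx : [set x; b] \in tree.
    by apply/setUP; right; apply: (imset_f (fun x => [set x; b])).
  by rewrite /F /= tx !inE.
apply: (@le_trans _ _ #|[set phi : Col n | [forall e, phi e \in F e]]|%:R); last first.
  by rewrite ler_nat subset_leq_card.
have -> : #|[set phi : Col n | [forall e, phi e \in F e]]| = (\prod_e #|F e|)%N.
  transitivity #|family F|; last by rewrite card_family foldrE big_image.
  by apply: eq_card => phi; rewrite inE; apply/forallP/familyP.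
set r : R := q.+1%:R; have r1 : 1 <= r by rewrite /r ler1n.
have x0 : 0 <= 1 - 1 / r by rewrite subr_ge0 div1r invf_le1 //; lra.
have x1 : 1 - 1 / r <= 1 by rewrite lerBlDr lerDl divr_ge0 //; lra.
rewrite natr_prod.
have -> : \prod_(e : E) #|F e|%:R = \prod_(e : E) ((if e \in [set e : E | val e \in tree] then 1 - 1 / r else 1)
     * (if e \in [set e : E | val e \in cross] then r else 1)).
  apply: eq_bigr => e _.
  rewrite (in_set (fun e : E => val e \in tree)) (in_set (fun e : E => val e \in cross)) /F.
  case: ifP => [et|_].
    rewrite (subsetP tree_cross _ et) cardsC1 card_ord /=.
    have r0 : r != 0 by rewrite pnatr_eq0.
    by rewrite mulrBl div1r mulVf // mul1r /r -[q.+1%:R]natr1 addrK.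
  by case: ifP => _; rewrite mul1r ?cardsT ?card_ord ?cards1.
rewrite big_split /= -!big_mkcond /= !prodr_const.
have card_val (S : {set {set 'I_n}}) : (#|[set e : E | val e \in S]| <= #|S|)%N.
  rewrite -(card_imset _ val_inj); apply: subset_leq_card.
  by apply/subsetP => _ /imsetP[e eS ->]; rewrite inE in eS.
have ctree : (#|[set e : E | val e \in tree]| <= n - 1)%N.
  apply: leq_trans (card_val _) _; rewrite cardsU.
  have c1 : (#|[set [set a; y] | y in ~: A]| <= #|~: A|)%N := leq_imset_card _ _.
  have c2 : (#|[set [set x; b] | x in A]| <= #|A|)%N := leq_imset_card _ _.
  have c3 : (0 < #|[set [set a; y] | y in ~: A] :&: [set [set x; b] | x in A]|)%N.
    apply/card_gt0P; exists [set a; b]; rewrite in_setI; apply/andP; split.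
      exact: imset_f.
    exact: (imset_f (fun x => [set x; b])).
  have := cardsC A; rewrite card_ord => c4.
  apply: (@leq_trans (#|~: A| + #|A| - 1)); first by rewrite leq_sub // leq_add.
  by rewrite addnC c4.
have ccross : (#|A| * #|~: A| <= #|[set e : E | val e \in cross]|)%N.
  have -> : #|[set e : E | val e \in cross]| = #|cross|.
    rewrite -(card_imset _ val_inj); apply: eq_card => s; apply/imsetP/idP => [[e]|sc].
      by rewrite inE => ec ->.
    have sE : s \in edges (complete_graph n).
      by case/imset2P: sc => x y xA yA ->; apply: edgeP; apply: contraTneq yA => <-; rewrite inE xA.
    by exists (exist (fun e => e \in edges (complete_graph n)) s sE); rewrite ?inE.
  rewrite -cardsX /cross curry_imset2X card_in_imset //.
  move=> [x y] [x' y'] /setXP[/= xA yA] /setXP[/= xA' yA'] /= E'.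
  have xx : x = x'.
    have := set21 x y; rewrite E' !inE => /orP[/eqP//|/eqP xy'].
    by rewrite xy' in xA; move: yA'; rewrite inE xA.
  congr pair => //.
  have := set22 x y; rewrite E' !inE => /orP[/eqP yx'|/eqP//].
  by rewrite -yx' in xA'; move: yA; rewrite inE xA'.
have r0 : 0 <= r by lra.
by apply: ler_pM (exprn_ge0 _ x0) (exprn_ge0 _ r0) (ler_wiXn2l x0 x1 ctree) (ler_weXn2l r1 ccross).
Qed.

(** By [bipartite_sides] a coloring arises from at most two sets A. *)
Theorem bipartite_lower n : (2 <= n)%N ->
  1 / 2 * 'C(n, n %/ 2)%:R * (1 - 1 / q.+1%:R) ^+ (n - 1) * q.+1%:R ^+ (n ^ 2 %/ 4)
    <= #|rfree q n|%:R :> R.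
Proof.
move=> n2; pose H := [set A : {set 'I_n} | #|A| == (n %/ 2)%N].
have cH : #|H| = 'C(n, n %/ 2) by rewrite /H card_draws card_ord.
have h1 : (0 < n %/ 2)%N by rewrite divn_gt0.
have h2 : (n %/ 2 < n)%N by rewrite ltn_Pdiv //; move: n2; lia.
have split_n : (n %/ 2 * (n - n %/ 2) = n ^ 2 %/ 4)%N.
  have := divn_eq n 2; have := ltn_pmod n (isT : 0 < 2)%N.
  move: (n %/ 2)%N (n %% 2)%N => k [|[|//]] _ ->.
    have -> : ((k * 2 + 0) ^ 2 = k * k * 4)%N by rewrite addn0 -mulnn; ring.
    by rewrite mulnK //; congr (_ * _)%N; lia.
  have -> : ((k * 2 + 1) ^ 2 = k * (k + 1) * 4 + 1)%N by rewrite -mulnn; ring.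
  by rewrite divnMDl // addn0; congr (_ * _)%N; lia.
have each A : A \in H -> (1 - 1 / q.+1%:R) ^+ (n - 1) * q.+1%:R ^+ (n ^ 2 %/ 4) <=
    #|bipartite_colorings A|%:R :> R.
  rewrite inE => /eqP cA.
  have cC : #|~: A| = (n - n %/ 2)%N by rewrite -cA -[X in _ = (X - _)%N](card_ord n) -(cardsC A) addKn.
  rewrite -split_n -cC -{1}cA; apply: card_bipartite; rewrite -card_gt0 ?cA ?cC //.
  by rewrite subn_gt0.
have twice : (\sum_(A in H) #|bipartite_colorings A| <= 2 * #|rfree q n|)%N.
  under eq_bigr do rewrite -sum1_card big_mkcond.
  rewrite exchange_big /= mulnC -sum_nat_const [X in (_ <= X)%N]big_mkcond.
  apply: leq_sum => phi _; rewrite -big_mkcondr /= sum1_card.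
  case: ifP => [pf|nf]; last first.
    rewrite eq_card0 // => A; rewrite !inE; apply/negbTE; apply: contraFN nf => /andP[_ pA].
    exact: (subsetP (bipartite_rfree A)).
  have [/existsP[A /andP[AH pA]]|N] := boolP [exists A, (A \in H) && (phi \in bipartite_colorings A)].
    apply: (@leq_trans #|[set A; ~: A]|); last by rewrite cards2; case: (_ != _).
    apply: subset_leq_card; apply/subsetP => A' /andP[_ pA'].
    by rewrite !inE; have [->|->] := bipartite_sides pA pA'; rewrite eqxx ?orbT.
  rewrite eq_card0 // => A; apply/negbTE; apply: contra N => HA; apply/existsP; exists A.
  exact: HA.
set X := (_ ^+ (n - 1)) in each *; set Y := (_ ^+ (_ %/ 4)) in each *.
rewrite -mulrA.
have : \sum_(A in H) X * Y <= \sum_(A in H) #|bipartite_colorings A|%:R :> R.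
  by apply: ler_sum => A; apply: each.
rewrite sumr_const cH -[_ *+ _]mulr_natl -natr_sum.
move: twice; rewrite -(ler_nat R) natrM.
by move: ('C(n, n %/ 2)%:R : R) (X * Y) => *; lra.
Qed.

End LowerBounds.

(** * The theorem *)

Theorem theorem1p1 (R : realType) (r : nat) (hr : (1 <= r)%N)
    (eps : R) (heps : 0 < eps) :
  exists n0 : nat, forall n : nat, (n0 <= n)%N ->
    let N := 'C(n, 2) in
    let rho4 := rho r 4 (complete_graph n) in
    [/\ (r <= 5)%N -> rho4 = (r ^ N)%N,
        (6 <= r <= 24)%N ->
          ('C(r, 5)%:R - eps) * 5 ^+ N <= rho4%:R
            <= ('C(r, 5)%:R + eps) * 5 ^+ N
      & (25 <= r)%N ->
          1 / 2 * 'C(n, n %/ 2)%:R * (1 - 1 / r%:R) ^+ (n - 1)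
              * r%:R ^+ (n ^ 2 %/ 4) <= rho4%:R :> R
          /\ rho4%:R <= r%:R `^ ((1 / 4 + eps) * n%:R ^+ 2) :> R].
Proof.
case: r hr => // q _.
have [r25|r24] := leqP 25 q.+1.
  have [n1 upper] := @rfree_upper_bound R q eps r25 heps.
  exists (maxn 2 n1) => n; rewrite geq_max => /andP[n2 nn1] N rho4.
  split=> [r5|/andP[_ r24]|_].
  - by have := leq_trans r25 r5.
  - by have := leq_trans r25 r24.
  - by split; [apply: bipartite_lower | apply: upper].
have [n1 upper] := five_color_upper r24 heps.
have [n2 lower] := five_color_lower q heps.
exists (maxn n1 n2) => n; rewrite geq_max => /andP[nn1 nn2] N rho4.
split=> [r5|_|//]; first exact: rho_few_colors.
by rewrite lower ?upper.
Qed.
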